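(* Let $\bar T>0$. If $u_1$ and $u_2$ are strong solutions of $\partial_t u=\tfrac12 u\,\partial_x^2u$ on a common time interval $[0,\bar T)$ (in one space dimension, $x\in\mathbb{R}$) with the same initial data $u_1(0,\cdot)=u_2(0,\cdot)$, then $u_1=u_2$.
   Context: Write $\langle x\rangle=(x^2+1)^{1/2}$; $\langle x\rangle^{\ell}L^\infty$ denotes the space of functions $f$ with $\langle x\rangle^{-\ell}f\in L^\infty$. Consider the equation $\partial_t u=\tfrac12 u\,\partial_x^2u$, $u(0,\cdot)=u_0$, for $(t,x)\in[0,\infty)\times\mathbb{R}$. Weak solution: given $T>0$, $u\in C([0,T);W^{1,\infty}_{\mathrm{loc}}(\mathbb{R}))$ is a weak solution on $[0,T)$ if $u\ge0$ and for all $\psi\in C_c^\infty([0,T)\times\mathbb{R})$, $$\int_{\mathbb{R}}u_0\,\psi(0,\cdot)+\int_{[0,T)\times\mathbb{R}}\Big[u\,\partial_t\psi-\tfrac12\,\partial_x(\psi u)\,\partial_xu\Big]=0 .$$ Strong solution: given $\bar T>0$, a weak solution $u$ on $[0,\bar T)$ is a strong solution on $[0,\bar T)$ if for all $T\in(0,\bar T)$ we have $u\in\langle x\rangle^2L^\infty([0,T]\times\mathbb{R})$ and $\partial_x^2u\in L^1([0,T];L^\infty(\mathbb{R}))$. *)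

(* Defs.v *)
From HB Require Import structures.
From mathcomp Require Import all_boot all_order all_algebra.
From mathcomp Require Import all_classical all_reals all_analysis.

Set Implicit Arguments.
Unset Strict Implicit.
Unset Printing Implicit Defensive.
Import Order.TTheory GRing.Theory Num.Theory.
Import numFieldNormedType.Exports.

Local Open Scope classical_set_scope.
Local Open Scope ring_scope.

(* Functions of (t, x) are curried, u : R -> R -> R, and only their values at
   times t in the time interval under consideration matter.  Elements of
   L^oo, W^{1,oo}_loc, ... are represented by Borel functions, and statements
   about them (u >= 0, u1 = u2, ...) are understood almost everywhere. *)

Section Calculus.
Context {R : realType}.

(* Differentiability plus continuity of all iterated directional derivatives
   up to order k; in finite dimension this is the usual class C^k. *)
Fixpoint Ck (V : normedModType R) (k : nat) (f : V -> R) : Prop :=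
  match k with
  | 0 => continuous f
  | k'.+1 => (forall x, differentiable f x) /\ forall v, Ck k' ('D_v f)
  end.

Definition smooth (V : normedModType R) (f : V -> R) : Prop :=
  forall k, Ck k f.

(* C_c^oo(Omega), extended by zero to the whole space. *)
Definition test_function (V : normedModType R) (Omega : set V) (f : V -> R) :
    Prop :=
  smooth f /\
  exists K : set V, [/\ compact K, K `<=` Omega & forall x, ~ K x -> f x = 0].

(* C_c^oo([0,T) x R) consists of the restrictions to t >= 0 of the functions
   in C_c^oo((-oo,T) x R); their values at t < 0 are never used below. *)
Definition spacetime_test (T : R) (psi : R * R -> R) : Prop :=
  test_function [set p : R * R | p.1 < T] psi.

Definition dt (psi : R * R -> R) : R * R -> R := 'D_((1, 0) : R * R) psi.

Definition weak_derivative (n : nat) (f g : R -> R) : Prop :=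
  [/\ locally_integrable setT f, locally_integrable setT g &
      forall phi : R -> R, test_function setT phi ->
        \int[lebesgue_measure]_x (f x * derive1n n phi x) =
        (-1) ^+ n * \int[lebesgue_measure]_x (g x * phi x)].

Definition Linf_norm (D : set R) (f : R -> R) : \bar R :=
  Lnorm (@lebesgue_measure R) +oo%E (EFin \o (f \_ D)).

Definition Linf_loc (f : R -> R) : Prop :=
  measurable_fun setT f /\
  forall r : R, ((Linf_norm `[- r, r] f)%R < +oo)%E.

End Calculus.

Section SpaceTime.
Context {R : realType}.

Local Notation RR := (measurableTypeR R * measurableTypeR R)%type.

Local Notation spacetime_measure :=
  (@lebesgue_measure R \x @lebesgue_measure R)%E.

Definition spacetime_measurable (I : set R) (u : R -> R -> R) : Prop :=
  measurable_fun (I `*` setT : set RR) (fun p : RR => u p.1 p.2).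

Definition spacetime_dx (n : nat) (I : set R) (u v : R -> R -> R) : Prop :=
  spacetime_measurable I v /\
  {ae @lebesgue_measure R, forall t, I t -> weak_derivative n (u t) (v t)}.

(* u in C([0,T); W^{1,oo}_loc(R)), with spatial derivative ux.  The topology of
   W^{1,oo}_loc(R) is given by the seminorms of W^{1,oo}(-r,r), r > 0. *)
Definition C_W1oo_loc (T : R) (u ux : R -> R -> R) : Prop :=
  [/\ spacetime_measurable `[0, T[ u,
      spacetime_measurable `[0, T[ ux,
      forall t, t \in `[0, T[ ->
        [/\ Linf_loc (u t), Linf_loc (ux t) & weak_derivative 1 (u t) (ux t)] &
      forall s r : R, s \in `[0, T[ ->
        ((Linf_norm `[- r, r] (u t \- u s))%R +
         (Linf_norm `[- r, r] (ux t \- ux s))%R)%E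
          @[t --> within `[0, T[ (nbhs s)] --> 0%E].

Definition weak_solution (T : R) (u0 : R -> R) (u : R -> R -> R) : Prop :=
  exists ux : R -> R -> R,
  [/\ C_W1oo_loc T u ux,
      forall t, t \in `[0, T[ -> {ae @lebesgue_measure R, forall x, 0 <= u t x} &
      forall psi : R * R -> R, spacetime_test T psi ->
        exists dx_psi_u : R -> R -> R,
          spacetime_dx 1 `[0, T[ (fun t x => psi (t, x) * u t x) dx_psi_u /\
          \int[lebesgue_measure]_x (u0 x * psi (0, x)) +
          \int[spacetime_measure]_(p in `[0, T[ `*` setT)
            (u p.1 p.2 * dt psi p - 2^-1 * (dx_psi_u p.1 p.2 * ux p.1 p.2))
          = 0].

Definition bracket (x : R) : R := Num.sqrt (x ^+ 2 + 1).

(* u in <x>^l L^oo(I x R) *)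
Definition bracket_Linf (l : nat) (I : set R) (u : R -> R -> R) : Prop :=
  spacetime_measurable I u /\
  ((Lnorm spacetime_measure +oo%E
      (EFin \o ((fun p : RR => (bracket p.2) ^- l * u p.1 p.2)
                  \_ (I `*` setT))))%R < +oo)%E.

(* The L^1([0,T]; L^oo(R)) condition is read as: a jointly measurable
   representative of the second weak derivative whose spatial L^oo norm is
   integrable in time. *)
Definition strong_solution (Tbar : R) (u0 : R -> R) (u : R -> R -> R) : Prop :=
  weak_solution Tbar u0 u /\
  forall T : R, 0 < T < Tbar ->
    bracket_Linf 2 `[0, T] u /\
    exists uxx : R -> R -> R,
      spacetime_dx 2 `[0, T] u uxx /\
      (@lebesgue_measure R).-integrable `[0, T]
        (fun t => Linf_norm setT (uxx t)).

End SpaceTime.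

(* Main.v *)
(* For two strong solutions put w = u1 - u2 and E(t) = int w(t,x)^2 (1+x^2)^-4 dx.
   As uxx is bounded for almost every time, testing with mollified indicators of
   time intervals shows that w(t,x) is, for almost every x, the time integral of
   eta = (u1 u1xx - u2 u2xx) / 2, so E is absolutely continuous with
   E' = 2 int w eta (1+x^2)^-4.  Writing u1 u1xx - u2 u2xx = u1 wxx + w u2xx and
   integrating by parts twice, the term - u1 wx^2 has a sign, and everything else
   is at most a constant times (1 + |u1xx|_oo + |u2xx|_oo) E, because u1 <= C (1+x^2)
   and, by Taylor's formula, |u1x| <= (6 C + |u1xx|_oo) (1+x^2)^(1/2).  Gronwall's
   inequality gives E = 0. *)

Require Import Defs.
From HB Require Import structures.
From mathcomp Require Import all_boot all_order all_algebra.
From mathcomp Require Import all_classical all_reals all_analysis.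
From mathcomp Require Import ring lra measurable_realfun ess_sup_inf.

Set Implicit Arguments.
Unset Strict Implicit.
Unset Printing Implicit Defensive.
Import Order.TTheory GRing.Theory Num.Theory.
Import numFieldNormedType.Exports.
Local Open Scope classical_set_scope.
Local Open Scope ring_scope.

(** * Smooth functions and the smooth step *)

Section Smoothness.
Context {R : realType}.
Implicit Types V W : normedModType R.

(** Two features of weak solutions shape the proof. The derivative of [psi u] in the weak
    formulation is a witness that depends on the test function, and identities in [x] at a given
    time hold off a null set that depends on the time. Against the first, pointwise derivatives are
    replaced by pairs [primitive P p], an absolutely continuous function with its density: on almost
    every slice the weak derivatives become such pairs, and uniqueness of densities determines the
    witness. Against the second, the energy argument runs on the time integral of eta, which is
    jointly measurable, defined at every (t, x), and equal to w only slice by slice. The power 4 in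
    the weight makes room at infinity: the boundary terms of the integrations by parts are at most
    of order (1+x^2)^3, so the weight makes them vanish there. The rate in Gronwall's inequality may
    only be affine in the sup norms of the second derivatives, since these are merely integrable in
    time; this is why the gradient bound has to be linear in |u1xx|_oo, and why both derivatives are
    moved onto u1 times the weight. *)

Lemma CkW V k (f : V -> R) : Ck k.+1 f -> Ck k f.
Proof.
elim: k f => [|k IH] f /= [df Df]; first by move=> x; exact: differentiable_continuous.
by split=> // v; apply: IH; apply: Df.
Qed.

Lemma Ck_cst V k (c : R) : Ck k (cst c : V -> R).
Proof.
elim: k c => [|k IH] c /=; first by move=> x; exact: cvg_cst.
split=> // v; rewrite (_ : 'D_v (cst c) = cst 0); first exact: IH.
by apply/funext => x; rewrite derive_cst.
Qed.

Lemma Ck_add V k (f g : V -> R) : Ck k f -> Ck k g -> Ck k (f \+ g).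
Proof.
elim: k f g => [|k IH] f g /=.
  by move=> cf cg x; apply: cvgD; [exact: cf|exact: cg].
move=> [df Df] [dg Dg]; split=> [x|v]; first exact: differentiableD.
rewrite (_ : 'D_v (f \+ g) = 'D_v f \+ 'D_v g); first exact: IH.
by apply/funext => x; rewrite deriveD//; exact: diff_derivable.
Qed.

Lemma Ck_mul V k (f g : V -> R) : Ck k f -> Ck k g -> Ck k (f \* g).
Proof.
elim: k f g => [|k IH] f g.
  by move=> cf cg x; exact: (cvgM (cf x) (cg x)).
move=> cf cg; have [df Df] := cf; have [dg Dg] := cg.
split=> [x|v]; first exact: differentiableM.
rewrite (_ : 'D_v (f \* g) = (f \* 'D_v g) \+ (g \* 'D_v f)).
  by apply: Ck_add; apply: IH; [exact: CkW|exact: Dg|exact: CkW|exact: Df].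
by apply/funext => x; rewrite deriveM//; exact: diff_derivable.
Qed.

Lemma Ck_scale V k (c : R) (f : V -> R) : Ck k f -> Ck k (fun x => c * f x).
Proof. by move=> cf; apply: (@Ck_mul _ _ (cst c)) => //; exact: Ck_cst. Qed.

Lemma Ck_inv V k (f : V -> R) : (forall x, f x != 0) -> Ck k f ->
  Ck k (fun x => (f x)^-1).
Proof.
move=> f0; elim: k => [|k IH].
  by move=> cf x; apply: cvgV => //; exact: cf.
move=> cf; have [df Df] := cf; split=> [x|v]; first exact: differentiableV.
rewrite (_ : 'D_v _ = (fun x => -1 * (((f x)^-1 * (f x)^-1) * 'D_v f x))).
  apply: Ck_scale; apply: (@Ck_mul _ _ (fun x => (f x)^-1 * (f x)^-1)) => //.
    by apply: (@Ck_mul _ _ (fun x => (f x)^-1)); apply: IH; exact: CkW.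
  exact: Df.
apply/funext => x; rewrite deriveV//; last exact: diff_derivable.
by rewrite /GRing.scale/= expr2 invfM mulN1r mulNr.
Qed.

(** The induction closes because the derivative along [v] is again a composite, of ['D_(L v) f].
    General [V] and [W] cover both rescalings of the line and the projections of the time-space
    plane. *)
Lemma Ck_comp_affine V W k (L : {linear V -> W}) (c : W) (f : W -> R) :
  continuous L -> Ck k f -> Ck k (fun x => f (L x + c)).
Proof.
move=> cL; elim: k f => [|k IH] f.
  move=> cf x; apply: continuous_comp; last exact: cf.
  by apply: cvgD; [exact: cL|exact: cvg_cst].
have dL x : differentiable (fun x => L x + c) x.
  apply: differentiableD; last exact: differentiable_cst.
  exact: linear_differentiable.
move=> [df Df]; split=> [x|v].
  by apply: (@differentiable_comp _ _ _ _ (fun x => L x + c)).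
rewrite (_ : 'D_v _ = (fun x => 'D_(L v) f (L x + c))); first exact: (IH _ (Df _)).
apply/funext => x; rewrite !deriveE//; last first.
  by apply: (@differentiable_comp _ _ _ _ (fun x => L x + c)).
rewrite (diff_comp (f := fun x => L x + c))//=.
rewrite (diffD (f := L) (g := cst c))//; last first.
  exact: linear_differentiable.
by rewrite /= diff_cst /= addr0 diff_lin.
Qed.

End Smoothness.

Section SmoothStep.
Context {R : realType}.
Implicit Types (x y : R) (n k : nat).

Lemma Ck_is_derive k (f f' : R -> R) :
  (forall x : R, is_derive x (1 : R) f (f' x)) -> Ck k f' -> Ck k.+1 f.
Proof.
move=> ff' Ckf'.
have df x : differentiable f x by apply/derivable1_diffP.
split=> // v; rewrite (_ : 'D_v f = (fun x => v * f' x)); first exact: Ck_scale.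
apply/funext => x; rewrite deriveE// -[v in LHS]mulr1 -[v * 1]/(v *: 1) linearZ/=.
by rewrite -deriveE// (@derive_val _ _ _ _ _ _ _ (ff' x)).
Qed.

(** The classical flat function [exp(-1/x)] with the factors [x^-n] that its derivatives produce, so
    that the family is closed under differentiation up to linear combinations. *)
Definition flat n x : R := if 0 < x then x ^- n * expR (- x^-1) else 0.

Lemma flat_ge0 n x : 0 <= flat n x.
Proof.
by rewrite /flat; case: ifP => // x0; rewrite mulr_ge0 ?expR_ge0// invr_ge0 exprn_ge0// ltW.
Qed.

Lemma flat_le0 n x : x <= 0 -> flat n x = 0.
Proof. by rewrite /flat leNgt; case: ifP. Qed.

Lemma flat_gt0 n x : 0 < x -> 0 < flat n x.
Proof. by move=> x0; rewrite /flat x0 mulr_gt0 ?expR_gt0// invr_gt0 exprn_gt0. Qed.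

(** With [y = 1/x], the exponential dominates [y^(n+1) / (n+1)!], one power more than the prefactor
    [y^n]; the spare power is the factor [|x|]. *)
Lemma flat_norm_le n x : `|flat n x| <= (n.+1)`!%:R * `|x|.
Proof.
rewrite ger0_norm ?flat_ge0//; have [x0|x0] := ltP 0 x; last first.
  by rewrite flat_le0// mulr_ge0.
rewrite /flat x0 expRN gtr0_norm// -exprVn.
have y0 : 0 < x^-1 by rewrite invr_gt0.
have := expR_ge1Dxn n (ltW y0).
have f0 : 0 < (n.+1)`!%:R :> R by rewrite ltr0n fact_gt0.
move=> H; have {}H : (x^-1) ^+ n.+1 <= (n.+1)`!%:R * expR x^-1.
  by rewrite -ler_pdivrMl// mulrC; apply: le_trans H; rewrite lerDr.
rewrite ler_pdivrMr ?expR_gt0// mulrAC -ler_pdivrMr//.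
by rewrite -exprSr.
Qed.

Lemma flat_div n x : x != 0 -> flat n x / x = flat n.+1 x.
Proof.
move=> x0; rewrite /flat; case: ifP => [_|]; last by rewrite mul0r.
by rewrite mulrAC -!exprVn exprSr.
Qed.

Lemma is_derive_flat n x :
  is_derive x (1 : R) (flat n) (flat n.+2 x - n%:R * flat n.+1 x).
Proof.
have [x0|x0|->] := ltgtP x 0.
- have E : {near x, cst 0 =1 flat n}.
    by near=> z; rewrite flat_le0//; near: z; exact: lt_le_nbhsl.
  apply: (near_eq_is_derive E).
  by apply: is_derive_eq; rewrite !flat_le0 ?ltW// mulr0 subrr.
- have E : {near x, (fun z => (z ^+ n)^-1) * (expR \o (fun z => - z^-1)) =1 flat n}.
    by near=> z; rewrite /flat ifT//; near: z; exact: lt_nbhsr.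
  have xn0 : x != 0 by rewrite gt_eqF.
  have d1 : is_derive x (1 : R) (fun z => (z ^+ n)^-1)
      (- (x ^+ n) ^- 2 *: (n%:R *: x ^+ n.-1 *: (1 : R))).
    apply: is_deriveV; first by rewrite expf_neq0.
    by apply: DeriveDef; [exact: exprn_derivable|exact: exp_derive].
  have d2 : is_derive x (1 : R) (fun z => - z^-1) (x ^- 2).
    have -> : x ^- 2 = - (- x ^- 2 *: (1 : R)).
      by rewrite scaleNr opprK; exact: esym (mulr1 _).
    apply: is_deriveN; apply: (is_deriveV (f := id)) => //.
  apply: (near_eq_is_derive E).
  apply: is_derive_eq.
  rewrite /flat x0 /GRing.scale/=; case: n {E d1} => [|n].
    by rewrite !expr0 !mul0r mulr0; field.
  by rewrite /= !exprS; field; rewrite xn0 expf_neq0.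
- rewrite !flat_le0// mulr0 subrr.
  (* At the origin the difference quotient of [flat n] is [flat n.+1], which tends to zero by the
     linear bound. *)
  have cv : h^-1 *: (flat n (h *: 1 + 0) - flat n 0) @[h --> 0^'] --> (0 : R).
    apply/cvgr0Pnorm_le => e e0; near=> h.
    have h0 : h != 0 by near: h; exact: nbhs_dnbhs_neq.
    rewrite (flat_le0 _ (lexx 0)) subr0 addr0 [h *: 1]mulr1 [h^-1 *: _]mulrC flat_div//.
    apply: le_trans (flat_norm_le _ _) _; rewrite -ler_pdivlMl ?ltr0n ?fact_gt0//.
    near: h; apply: dnbhs0_le; rewrite mulr_gt0// invr_gt0 ltr0n fact_gt0//.
  apply: DeriveDef; first by apply/cvg_ex; exists 0.
  exact: cvg_lim cv.
Unshelve. all: by end_near. Qed.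

Lemma Ck_flat n k : Ck k (flat n).
Proof.
elim: k n => [|k IH] n.
  move=> x; apply: differentiable_continuous; apply/derivable1_diffP.
  by have [] := is_derive_flat n x.
apply: (Ck_is_derive (is_derive_flat n)).
rewrite (_ : (fun x => _) = flat n.+2 \+ (fun x => (- n%:R) * flat n.+1 x)).
  by apply: Ck_add => //; exact: Ck_scale.
by apply/funext => x /=; rewrite mulNr.
Qed.

Definition sstep x := flat 0 x / (flat 0 x + flat 0 (1 - x)).

Lemma sstep_den_gt0 x : 0 < flat 0 x + flat 0 (1 - x).
Proof.
have [x0|x0] := ltP 0 x; first by rewrite ltr_wpDr ?flat_ge0 ?flat_gt0.
by rewrite ltr_wpDl ?flat_ge0// flat_gt0// subr_gt0 (le_lt_trans x0).
Qed.

Lemma sstep_le0 x : x <= 0 -> sstep x = 0.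
Proof. by move=> x0; rewrite /sstep flat_le0// mul0r. Qed.

Lemma sstep_ge1 x : 1 <= x -> sstep x = 1.
Proof.
move=> x1; rewrite /sstep (@flat_le0 _ (1 - x)) ?subr_le0// addr0 divff//.
by rewrite gt_eqF// flat_gt0// (lt_le_trans _ x1).
Qed.

Lemma sstep_ge0 x : 0 <= sstep x.
Proof. by rewrite divr_ge0 ?flat_ge0// ltW// sstep_den_gt0. Qed.

Lemma sstep_le1 x : sstep x <= 1.
Proof. by rewrite ler_pdivrMr ?sstep_den_gt0// mul1r lerDl flat_ge0. Qed.

Lemma Ck_comp_line k (a b : R) (f : R -> R) :
  Ck k f -> Ck k (fun x : R => f (a * x + b)).
Proof.
have cL : continuous ( *:%R a : R -> R) by move=> x; apply: cvgMl_tmp; exact: cvg_id.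
move=> Cf; exact: (@Ck_comp_affine _ _ _ k ( *:%R a : {linear R -> R}) b f cL Cf).
Qed.

Lemma smooth_sstep : smooth (sstep : R -> R).
Proof.
move=> k; apply: (@Ck_mul _ _ k (flat 0) (fun x => (flat 0 x + flat 0 (1 - x))^-1)).
  exact: Ck_flat.
apply: (@Ck_inv _ _ k (fun x => flat 0 x + flat 0 (1 - x))).
  by move=> x; rewrite gt_eqF// sstep_den_gt0.
apply: Ck_add; first exact: Ck_flat.
rewrite (_ : (fun x => _) = (fun x => flat 0 (-1 * x + 1))).
  exact/Ck_comp_line/Ck_flat.
by apply/funext => x; rewrite mulN1r addrC.
Qed.

End SmoothStep.

(** * Almost everywhere statements and Fubini for real integrals *)

Section RealIntegrals.
Context d (T : measurableType d) (R : realType) (mu : {measure set T -> \bar R}).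
Implicit Types (D : set T) (f g : T -> R).

Lemma ae_imp (P Q : T -> Prop) : (forall x, P x -> Q x) ->
  {ae mu, forall x, P x} -> {ae mu, forall x, Q x}.
Proof. by move=> PQ; apply: filterS. Qed.

Lemma ae_imp2 (P Q S : T -> Prop) : (forall x, P x -> Q x -> S x) ->
  {ae mu, forall x, P x} -> {ae mu, forall x, Q x} -> {ae mu, forall x, S x}.
Proof. by move=> PQS; apply: filterS2. Qed.

Lemma ae_and (P Q : T -> Prop) :
  {ae mu, forall x, P x} -> {ae mu, forall x, Q x} -> {ae mu, forall x, P x /\ Q x}.
Proof. exact: ae_imp2. Qed.

Lemma ae_true (P : T -> Prop) : (forall x, P x) -> {ae mu, forall x, P x}.
Proof. by move=> HP; apply: filterE. Qed.

Lemma measurable_patch D f : measurable D -> measurable_fun D f ->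
  measurable_fun setT (f \_ D).
Proof. by move=> mD; apply: (iffLR (measurable_restrictT _ mD)). Qed.

Lemma integrable_patch D f : measurable D ->
  mu.-integrable D (EFin \o f) -> mu.-integrable setT (EFin \o (f \_ D)).
Proof.
by move=> mD intf; rewrite -restrict_EFin; apply/integrable_restrict; rewrite //= ?setTI ?setIT.
Qed.

Lemma ae_le_integrable D f g : measurable D -> measurable_fun D f ->
  mu.-integrable D (EFin \o g) ->
  {ae mu, forall x, D x -> `|f x| <= g x} -> mu.-integrable D (EFin \o f).
Proof.
move=> mD mf /integrableP[mg ig] fg; apply/integrableP; split.
  exact/measurable_EFinP.
apply: le_lt_trans ig; apply: ae_ge0_le_integral => //=.
- by apply/measurable_EFinP; apply: measurableT_comp.
- by apply/measurable_EFinP; apply: measurableT_comp => //; exact/measurable_EFinP.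
- apply: filterS fg => x /= + Dx => /(_ Dx) fg.
  by rewrite lee_fin (le_trans fg) ?ler_norm.
Qed.

Lemma integrable_EFinZ D f (r : R) : measurable D ->
  mu.-integrable D (EFin \o f) -> mu.-integrable D (EFin \o (fun x => r * f x)).
Proof.
move=> mD intf; rewrite (_ : EFin \o _ = (fun x => r%:E * (EFin \o f) x)%E).
  exact: integrableZl.
by apply/funext => x /=; rewrite EFinM.
Qed.

Lemma integrable_EFin_norm D f :
  mu.-integrable D (EFin \o f) -> mu.-integrable D (EFin \o (fun x => `|f x|)).
Proof. exact: integrable_norm. Qed.

Lemma integrable_EFinD D f g : measurable D ->
  mu.-integrable D (EFin \o f) -> mu.-integrable D (EFin \o g) ->
  mu.-integrable D (EFin \o (f \+ g)).
Proof.
move=> mD intf intg; rewrite (_ : EFin \o _ = ((EFin \o f) \+ (EFin \o g))%E).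
  exact: integrableD.
by apply/funext => x /=; rewrite EFinD.
Qed.

Lemma integrable_EFinB D f g : measurable D ->
  mu.-integrable D (EFin \o f) -> mu.-integrable D (EFin \o g) ->
  mu.-integrable D (EFin \o (f \- g)).
Proof.
move=> mD intf intg; rewrite (_ : EFin \o _ = ((EFin \o f) \- (EFin \o g))%E).
  exact: integrableB.
by apply/funext => x /=; rewrite EFinB.
Qed.

Lemma ae_eq_Rintegral D f g : measurable D -> measurable_fun D f ->
  measurable_fun D g -> {ae mu, forall x, D x -> f x = g x} ->
  \int[mu]_(x in D) f x = \int[mu]_(x in D) g x.
Proof.
move=> mD mf mg fg; rewrite /Rintegral; congr fine.
apply: ae_eq_integral => //; [exact/measurable_EFinP|exact/measurable_EFinP|].
by apply: filterS fg => x /= + Dx => /(_ Dx) ->.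
Qed.

Lemma ae_integrable_eq D f g : measurable D -> measurable_fun D g ->
  mu.-integrable D (EFin \o f) -> {ae mu, forall x, D x -> f x = g x} ->
  mu.-integrable D (EFin \o g).
Proof.
move=> mD mg intf fg.
have intnf : mu.-integrable D (EFin \o (fun x => `|f x|)).
  exact: (integrable_norm intf).
apply: (ae_le_integrable mD mg intnf).
by apply: filterS fg => x /= + Dx => /(_ Dx) ->.
Qed.

(** The difference [g - f] is replaced by its positive part, which has the same integral and is
    nonnegative everywhere. *)
Lemma ae_le_Rintegral D f g : measurable D ->
  mu.-integrable D (EFin \o f) -> mu.-integrable D (EFin \o g) ->
  {ae mu, forall x, D x -> f x <= g x} ->
  \int[mu]_(x in D) f x <= \int[mu]_(x in D) g x.
Proof.
move=> mD intf intg fg.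
have mf : measurable_fun D f by apply/measurable_EFinP; case/integrableP : intf.
have mg : measurable_fun D g by apply/measurable_EFinP; case/integrableP : intg.
rewrite -subr_ge0 -RintegralB//.
rewrite (@ae_eq_Rintegral _ _ (fun x => Num.max (g x - f x) 0))//.
- by apply: Rintegral_ge0 => x _; rewrite le_max lexx orbT.
- exact: measurable_funB.
- by apply: measurable_maxr => //; exact: measurable_funB.
- apply: filterS fg => x /= + Dx => /(_ Dx) fg.
  by rewrite max_l// subr_ge0.
Qed.

Lemma ae_Rintegral0 D f : measurable D -> measurable_fun D f ->
  {ae mu, forall x, D x -> f x = 0} -> \int[mu]_(x in D) f x = 0.
Proof.
move=> mD mf f0; rewrite (@ae_eq_Rintegral _ _ (cst 0))//.
by rewrite Rintegral_cst// mul0r.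
Qed.

End RealIntegrals.

Section RealFubini.
Context d1 d2 (T1 : measurableType d1) (T2 : measurableType d2) (R : realType).
Variable m1 : {sigma_finite_measure set T1 -> \bar R}.
Variable m2 : {sigma_finite_measure set T2 -> \bar R}.
Implicit Type f : T1 * T2 -> R.

(** Tonelli's criterion. It suits majorants such as the sup norm of [uxx], which are integrable in
    time and control almost every slice. *)
Lemma ae_le_integrable_prod f (g : T1 -> R) : measurable_fun setT f ->
  m1.-integrable setT (EFin \o g) ->
  {ae m1, forall x, (\int[m2]_y `|f (x, y)|%:E <= (g x)%:E)%E} ->
  (m1 \x m2)%E.-integrable setT (EFin \o f).
Proof.
move=> mf /integrableP[mg ig] fg.
have mF : measurable_fun setT (EFin \o f) by exact/measurable_EFinP.
apply/(integrable12ltyP m1 m2 mF); apply: le_lt_trans ig.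
apply: ae_ge0_le_integral => //.
- by move=> x _; exact: integral_ge0.
- apply: (@measurable_fun_fubini_tonelli_F _ _ _ _ _ m2 (abse \o (EFin \o f))) => //.
    exact: measurableT_comp.
  by move=> z; exact: abse_ge0.
- exact: measurableT_comp.
- apply: filterS fg => x /= fg _; apply: le_trans fg _.
  by rewrite lee_fin ler_norm.
Qed.

Variable f : T1 * T2 -> R.
Hypothesis intf : (m1 \x m2)%E.-integrable setT (EFin \o f).

(** On slices that are not integrable, [fine] may turn an infinite inner integral into 0, so the
    real and the extended inner integrals are compared almost everywhere only. *)
Lemma integrable_Rintegral1 :
  m1.-integrable setT (EFin \o (fun x => \int[m2]_y f (x, y))).
Proof.
have /integrableP[mF iF] := integrable_fubini_F intf.
apply/integrableP; split.
  by apply/measurable_EFinP; exact: (measurableT_comp (f := fine)).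
rewrite (ae_eq_integral (fun x => `|fubini_F m2 (EFin \o f) x|)%E)//.
- by apply/measurableT_comp => //; apply/measurable_EFinP; exact: (measurableT_comp (f := fine)).
- exact: measurableT_comp.
- have := ae_integrable1 intf; apply: filterS => x /= ifx _.
  exact: EFin_normr_Rintegral.
Qed.

Lemma integrable_Rintegral2 :
  m2.-integrable setT (EFin \o (fun y => \int[m1]_x f (x, y))).
Proof.
have mF := measurable_fubini_G intf.
have mf : measurable_fun setT (EFin \o f) by case/integrableP : intf.
have mR : measurable_fun setT (fun y => \int[m1]_x f (x, y)).
  exact: (measurableT_comp (f := fine)).
apply/integrableP; split; first exact/measurable_EFinP.
apply: le_lt_trans ((integrable21ltyP m1 m2 mf).1 intf).
apply: ae_ge0_le_integral => //.
- by apply: measurableT_comp => //; exact/measurable_EFinP.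
- by move=> y _; exact: integral_ge0.
- apply: (@measurable_fun_fubini_tonelli_G _ _ _ _ _ m1 (abse \o (EFin \o f))) => //.
    exact: measurableT_comp.
  by move=> z; exact: abse_ge0.
- have := ae_integrable2 intf; apply: filterS => y /= ify _.
  rewrite EFin_normr_Rintegral//; apply: le_abse_integral => //.
  by case/integrableP : ify.
Qed.

Lemma Rintegral12 :
  \int[m1]_x \int[m2]_y f (x, y) = \int[(m1 \x m2)%E]_z f z.
Proof.
rewrite [RHS]/Rintegral -[X in fine X](integral12_prod_meas1 intf)/=.
rewrite [LHS]/Rintegral; congr fine.
have /integrableP[mF iF] := integrable_fubini_F intf.
apply: ae_eq_integral => //.
  by apply/measurable_EFinP; exact: (measurableT_comp (f := fine)).
have := ae_integrable1 intf; apply: filterS => x /= ifx _.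
by rewrite /Rintegral fineK//; exact: integrable_fin_num.
Qed.

Lemma Rintegral21 :
  \int[m2]_y \int[m1]_x f (x, y) = \int[(m1 \x m2)%E]_z f z.
Proof.
rewrite [RHS]/Rintegral -[X in fine X](integral21_prod_meas1 intf)/=.
rewrite [LHS]/Rintegral; congr fine.
have mF := measurable_fubini_G intf.
apply: ae_eq_integral => //.
  by apply/measurable_EFinP; exact: (measurableT_comp (f := fine)).
have := ae_integrable2 intf; apply: filterS => x /= ifx _.
by rewrite /Rintegral fineK//; exact: integrable_fin_num.
Qed.

End RealFubini.

(** * Absolutely continuous functions *)

Section Primitives.
Context {R : realType}.
Local Notation mu := (@lebesgue_measure R).
Implicit Types (P Q p q f g h : R -> R) (a b c x : R).

Lemma integrableM_bound (D : set (measurableTypeR R)) h g (M : R) : measurable D ->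
  measurable_fun D h -> (forall x, D x -> `|h x| <= M) ->
  mu.-integrable D (EFin \o g) -> mu.-integrable D (EFin \o (h \* g)).
Proof.
move=> mD mh hM ig.
have mg : measurable_fun D g by apply/measurable_EFinP; case/integrableP : ig.
apply: (@ae_le_integrable _ _ _ mu D _ (fun x => M * `|g x|)) => //.
- exact: measurable_funM.
- exact: (integrable_EFinZ M mD (integrable_norm ig)).
- by apply/ae_true => x Dx /=; rewrite normrM ler_wpM2r// hM.
Qed.

Lemma continuous_itv_bounded f a b : continuous f ->
  exists M : R, forall x : R, `[a, b]%classic x -> `|f x| <= M.
Proof.
move=> cf; have cf' : {within `[a, b], continuous f} by exact: continuous_subspaceT.
have /compact_bounded[M [_ HM]] := continuous_compact cf' (@segment_compact R a b).
exists (M + 1) => x abx; apply: (HM (M + 1)); first by rewrite ltrDl.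
by exists x.
Qed.

Lemma continuous_itv_integrable f a b : continuous f ->
  mu.-integrable `[a, b] (EFin \o f).
Proof.
move=> cf; apply: continuous_compact_integrable; first exact: segment_compact.
exact: continuous_subspaceT.
Qed.

Lemma Rintegral_itv_cat f a b c : a <= b -> b <= c ->
  mu.-integrable `[a, c] (EFin \o f) ->
  \int[mu]_(x in `[a, c]) f x = \int[mu]_(x in `[a, b]) f x + \int[mu]_(x in `[b, c]) f x.
Proof.
move=> ab bc intf; apply/eqP; rewrite addrC -subr_eq; apply/eqP.
rewrite Rintegral_itvB//.
rewrite Rintegral_itv_obnd_cbnd//; apply: integrableS intf => //.
by apply: subset_itv; rewrite bnd_simp.
Qed.

(** Absolute continuity on compact intervals, with a Borel density carried along in place of a
    pointwise derivative. *)
Definition primitive P p := [/\ measurable_fun (setT : set (measurableTypeR R)) p,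
  forall a b, mu.-integrable `[a, b] (EFin \o p) &
  forall a b, a <= b -> P b - P a = \int[mu]_(x in `[a, b]) p x].

Lemma primitive_exists p c x0 : measurable_fun (setT : set (measurableTypeR R)) p ->
  (forall a b, mu.-integrable `[a, b] (EFin \o p)) ->
  exists2 P, primitive P p & P x0 = c.
Proof.
move=> mp ip.
pose P x := c + (if x0 <= x then \int[mu]_(y in `[x0, x]) p y
                 else - \int[mu]_(y in `[x, x0]) p y).
exists P; last by rewrite /P lexx set_itv1 Rintegral_set1 addr0.
split=> // a b ab; rewrite /P.
have [x0a|ax0] := leP x0 a.
  by rewrite (le_trans x0a ab) (Rintegral_itv_cat x0a ab)//; ring.
have [x0b|bx0] := leP x0 b.
  by rewrite (Rintegral_itv_cat (ltW ax0) x0b)//; ring.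
by rewrite (Rintegral_itv_cat ab (ltW bx0))//; ring.
Qed.

Lemma primitive_continuous P p : primitive P p -> continuous P.
Proof.
move=> [mp ip Pp] x.
have ab : x - 1 < x + 1 by rewrite ltrBlDr -addrA ltrDl addr_gt0.
have := parameterized_integral_continuous (ltW ab) (ip (x - 1) (x + 1)).
move/(within_continuous_continuous ab) => /(_ x).
have xab : x \in `](x - 1), (x + 1)[%R.
  by rewrite in_itv/= ltrDl ltr01 gtrDl ltrN10.
move=> /(_ xab) cx.
have E : {near x, (fun y => P (x - 1) + parameterized_integral mu (x - 1) y p) =1 P}.
  near=> y; rewrite /parameterized_integral -Pp; first by rewrite addrC subrK.
  by near: y; apply: lt_le_nbhsr; rewrite gtrDl ltrN10.
rewrite /continuous_at -(nbhs_singleton E); apply: cvg_trans.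
  exact: (near_eq_cvg E).
by apply: cvgD => //; exact: cvg_cst.
Unshelve. all: by end_near. Qed.

Lemma primitive_measurable P p : primitive P p -> measurable_fun (setT : set (measurableTypeR R)) P.
Proof. by move/primitive_continuous; exact: continuous_measurable_fun. Qed.

Lemma primitive_ae_eq P p q : measurable_fun (setT : set (measurableTypeR R)) q ->
  {ae mu, forall x, p x = q x} -> primitive P p -> primitive P q.
Proof.
move=> mq pq [mp ip Pp]; split => // [a b|a b ab].
  apply: (ae_integrable_eq _ _ (ip a b)) => //.
    exact: measurable_funTS.
  by apply: ae_imp pq => x ->.
rewrite Pp//; apply: ae_eq_Rintegral => //.
- exact: measurable_funTS.
- exact: measurable_funTS.
- by apply: ae_imp pq => x ->.
Qed.

Lemma primitiveD P Q p q : primitive P p -> primitive Q q ->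
  primitive (P \+ Q) (p \+ q).
Proof.
move=> [mp ip Pp] [mq iq Qq]; split=> [|a b|a b ab].
- exact: measurable_funD.
- exact: integrable_EFinD.
- by rewrite /= RintegralD// -Pp// -Qq//; ring.
Qed.

Lemma primitive_cst c : primitive (cst c) (cst 0).
Proof.
split=> [|a b|a b ab]; first exact: measurable_cst.
  exact: (continuous_itv_integrable _ _ (fun x => cvg_cst _)).
by rewrite Rintegral_cst// mul0r subrr.
Qed.

Lemma is_derive_primitive f g : (forall x, is_derive x (1 : R) f (g x)) ->
  continuous g -> primitive f g.
Proof.
move=> fg cg; split=> [|a b|a b].
- exact: continuous_measurable_fun.
- exact: continuous_itv_integrable.
- rewrite le_eqVlt => /predU1P[->|ab].
    by rewrite subrr set_itv1 Rintegral_set1.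
  have cf : continuous f.
    by move=> x; apply/differentiable_continuous/derivable1_diffP.
  rewrite /Rintegral (@continuous_FTC2 _ g f a b)//.
  + exact: continuous_subspaceT.
  + split; first by move=> x _.
      by apply: cvg_at_right_filter; exact: cf.
    by apply: cvg_at_left_filter; exact: cf.
  + by move=> x _; rewrite derive1E derive_val.
Qed.

End Primitives.

(** * Integration by parts and uniqueness of densities *)

Section PrimitiveProducts.
Context {R : realType}.
Local Notation mu := (@lebesgue_measure R).
Local Notation mR := (measurableTypeR R).
Implicit Types (P Q p q f g h : R -> R) (a b c x : R).

Lemma primitive_integrableM P p h a b : primitive P p -> continuous h ->
  mu.-integrable `[a, b] (EFin \o (h \* p)).
Proof.
move=> [mp ip _] ch; have [M hM] := continuous_itv_bounded a b ch.
apply: (@integrableM_bound _ _ _ _ M) => //.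
by apply: measurable_funTS; exact: continuous_measurable_fun.
Qed.

(* Fubini's theorem for [p(x) q(y)] on the triangle [y <= x]. *)
Lemma primitive_triangle P Q p q a b : primitive P p -> primitive Q q -> a <= b ->
  \int[mu]_(x in `[a, b]) ((Q x - Q a) * p x) =
  \int[mu]_(y in `[a, b]) ((P b - P y) * q y).
Proof.
move=> HP HQ ab; have [mp ip Pp] := HP; have [mq iq Qq] := HQ.
pose D : set mR := `[a, b]%classic.
have mD : measurable D by exact: measurable_itv.
pose pt : mR -> R := p \_ D; pose qt : mR -> R := q \_ D.
have mpt : measurable_fun setT pt.
  by apply: measurable_patch => //; exact: measurable_funTS.
have mqt : measurable_fun setT qt.
  by apply: measurable_patch => //; exact: measurable_funTS.
have ipt : mu.-integrable setT (EFin \o pt).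
  by apply: integrable_patch => //; exact: ip.
have iqt : mu.-integrable setT (EFin \o qt).
  by apply: integrable_patch => //; exact: iq.
pose f (z : mR * mR) : R := if z.2 <= z.1 then pt z.1 * qt z.2 else 0.
have mf : measurable_fun setT f.
  apply: measurable_fun_ifT => //.
    by apply: measurable_fun_ler; [exact: measurable_snd|exact: measurable_fst].
  apply: measurable_funM.
    by apply: measurableT_comp => //; exact: measurable_fst.
  by apply: measurableT_comp => //; exact: measurable_snd.
have iqn : mu.-integrable setT (fun y => `|qt y|%:E) by exact: (integrable_norm iqt).
have intf : (mu \x mu)%E.-integrable setT (EFin \o f).
  apply: (@ae_le_integrable_prod _ _ _ _ _ mu mu f
     (fun x => (\int[mu]_y `|qt y|) * `|pt x|)) => //.
    by apply: integrable_EFinZ => //; exact: (integrable_norm ipt).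
  apply: ae_true => x.
  apply: (@le_trans _ _ (\int[mu]_y (`|pt x|%:E * `|qt y|%:E))%E).
    apply: ge0_le_integral => //.
    - by apply/measurable_EFinP/measurableT_comp => //; apply: measurableT_comp.
    - by apply: measurable_funeM; apply/measurable_EFinP/measurableT_comp.
    - move=> y _; rewrite -EFinM lee_fin /f/=.
      by case: ifP => _; rewrite ?normrM// normr0 mulr_ge0.
  rewrite integralZl// mulrC EFinM /Rintegral fineK//.
  exact: integrable_fin_num.
have E := etrans (Rintegral12 intf) (esym (Rintegral21 intf)).
rewrite [RHS]Rintegral_mkcond [LHS]Rintegral_mkcond.
rewrite [LHS](_ : _ = \int[mu]_x \int[mu]_y f (x, y)); last first.
  apply: eq_Rintegral => x _; rewrite patchE; case: ifPn => xD; last first.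
    rewrite Rintegral_mkcond; rewrite (_ : _ \_ _ = cst 0).
      by rewrite Rintegral_cst// mul0r.
    apply/funext => y; rewrite patchE; case: ifP => // _.
    by rewrite /f /= /pt patchE (negbTE xD) mul0r if_same.
  have /andP[ax xb] : a <= x <= b by move: xD; rewrite inE /= in_itv.
  rewrite Qq// mulrC -RintegralZl// [LHS]Rintegral_mkcond.
  apply: eq_Rintegral => y _; rewrite /f/= /pt /qt !patchE xD.
  rewrite /D !mem_setE !in_itv/=.
  case: (leP y x) => yx; rewrite ?andbF ?andbT//.
  by rewrite (le_trans yx xb) andbT; case: ifP => // _; rewrite mulr0.
rewrite E; apply: eq_Rintegral => y _; rewrite patchE; case: ifPn => yD; last first.
  rewrite Rintegral_mkcond; rewrite (_ : _ \_ _ = cst 0).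
    by rewrite Rintegral_cst// mul0r.
  apply/funext => x; rewrite patchE; case: ifP => // _.
  by rewrite /f /= /qt patchE (negbTE yD) mulr0 if_same.
have /andP[ay yb] : a <= y <= b by move: yD; rewrite inE /= in_itv.
rewrite Pp// -RintegralZr// [RHS]Rintegral_mkcond.
apply: eq_Rintegral => x _; rewrite /f/= /pt /qt !patchE yD.
rewrite /D !mem_setE !in_itv/=.
case: (leP y x) => yx//=.
by rewrite (le_trans ay yx) /=; case: ifP => // _; rewrite mul0r.
Qed.

(** Expanding both sides of the triangle identity gives integration by parts, without
    differentiating anything. *)
Lemma primitiveM P Q p q : primitive P p -> primitive Q q ->
  primitive (P \* Q) ((P \* q) \+ (Q \* p)).
Proof.
move=> HP HQ; have [mp ip Pp] := HP; have [mq iq Qq] := HQ.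
have cP := primitive_continuous HP; have cQ := primitive_continuous HQ.
have iPq a b := primitive_integrableM a b HQ cP.
have iQp a b := primitive_integrableM a b HP cQ.
split=> [|a b|a b ab].
- by apply: measurable_funD; apply: measurable_funM => //; exact: continuous_measurable_fun.
- exact: integrable_EFinD.
- have := primitive_triangle HP HQ ab.
  under eq_Rintegral do rewrite mulrBl.
  under [X in _ = X -> _]eq_Rintegral do rewrite mulrBl.
  rewrite !RintegralB//; try exact: integrable_EFinZ.
  rewrite !RintegralZl// -Pp// -Qq// => E.
  rewrite RintegralD//=; rewrite /= in E *; lra.
Qed.

(** The difference of the densities has integral zero over every interval, so it vanishes almost
    everywhere by Lebesgue differentiation. That theorem is applied to the right of a fixed point;
    the points [-n] exhaust the line. *)
Lemma primitive_unique P p q : primitive P p -> primitive P q ->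
  {ae mu, forall x, p x = q x}.
Proof.
move=> [mp ip Pp] [mq iq Qq].
pose d x := p x - q x.
have id a b : mu.-integrable `[a, b] (EFin \o d) by exact: integrable_EFinB.
have d0 a x : \int[mu]_(y in `[a, x]) d y = 0.
  have [ax|xa] := leP a x; first by rewrite RintegralB// -Pp// -Qq// subrr.
  by rewrite set_itv_ge ?Rintegral_set0// bnd_simp -ltNge.
have ld : locally_integrable setT d.
  split; [exact: measurable_funB|exact: openT|move=> K _ cK].
  have [M [_ HM]] := compact_bounded cK.
  have sub : K `<=` `[- (M + 1), M + 1]%classic.
    move=> x Kx; have := HM (M + 1) _ x Kx; rewrite ltrDl ltr01 => /(_ isT).
    by rewrite /= in_itv/= ler_norml.
  have /integrableP[_ fin] := id (- (M + 1)) (M + 1).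
  apply: le_lt_trans fin; apply: ge0_subset_integral => //.
  - exact: compact_measurable.
  - by apply/measurable_EFinP/measurableT_comp => //; apply: measurable_funTS; exact: measurable_funB.
have Fn (n : nat) : {ae mu, forall x, - n%:R < x -> d x = 0}.
  have := FTC1 (id (- n%:R)) ld; apply: ae_imp => x /= + nx.
  rewrite lte_fin => /(_ nx)[_ <-].
  rewrite (_ : (fun x => _) = cst 0); first by rewrite derive1_cst.
  by apply/funext => y; exact: d0.
have := ae_foralln Fn; apply: ae_imp => x /= dx.
apply/eqP; rewrite -subr_eq0; apply/eqP; apply: (dx (Num.truncn `|x|).+1).
by rewrite ltrNl (le_lt_trans (ler_norm _))// normrN truncnS_gt.
Qed.

End PrimitiveProducts.

(** * Mollified indicators and weak derivatives *)

Section Mollifiers.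
Context {R : realType}.
Local Notation mu := (@lebesgue_measure R).
Local Notation mR := (measurableTypeR R).
Implicit Types (P Q p q f g h : R -> R) (a b c x e : R).

Lemma locally_integrable_itv f a b : locally_integrable setT f ->
  mu.-integrable `[a, b] (EFin \o f).
Proof.
move=> [mf _ fi]; apply/integrableP; split.
  by apply/measurable_EFinP; exact: measurable_funTS.
exact: fi (@subsetT _ _) (@segment_compact R a b).
Qed.

(** A null set contains no interval of positive length. *)
Lemma ae_itv_ex (A : R -> Prop) a b : a < b -> {ae mu, forall x, A x} ->
  exists2 x, a < x < b & A x.
Proof.
move=> ab [N [mN N0 AN]]; apply: contrapT => /forallPNP nA.
have sub : `]a, b[%classic `<=` N.
  by move=> x /=; rewrite in_itv/= => abx; apply: AN => Ax; apply: (nA x).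
have : (mu `]a, b[%classic <= mu N)%E by apply: le_measure; rewrite ?inE.
by rewrite lebesgue_measure_itv/= lte_fin ab N0 -EFinB lee_fin leNgt subr_gt0 ab.
Qed.

Lemma continuous_ae_ge0 f : continuous f -> {ae mu, forall x, 0 <= f x} ->
  forall x, 0 <= f x.
Proof.
move=> cf f0 x; rewrite leNgt; apply/negP => fx.
have [d /= d0 Hd] : \forall y \near x, f y < 0 by move/(_ x)/cvgr_lt : cf => /(_ _ fx).
have [|y /andP[xy yx]] := ae_itv_ex (a := x) (b := x + d) _ f0; first by rewrite ltrDl.
rewrite leNgt Hd//= /ball/= ltr0_norm ?subr_lt0// opprB ltrBlDl//.
Qed.

Lemma smooth_is_derive f x : smooth f -> is_derive x (1 : R) f (derive1 f x).
Proof.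
move=> /(_ 1)[df _]; rewrite derive1E.
by apply: derivableP; apply/derivable1_diffP.
Qed.

Lemma smooth_derive1 f : smooth f -> smooth (derive1 f).
Proof.
by move=> sf k; have [_ /(_ 1)] := sf k.+1; rewrite (_ : derive1 f = 'D_1 f)//; apply/funext => x; rewrite derive1E.
Qed.

Lemma smooth_continuous f : smooth f -> continuous f.
Proof. by move=> /(_ 0). Qed.

(** A smooth indicator of the half-line from [a], switching on during [[a, a + e]]; its derivative
    [mollifier] is a one-sided approximate identity at [a]. *)
Definition step a e x : R := sstep (e^-1 * (x - a)).
Definition mollifier a e x : R := e^-1 * (derive1 sstep (e^-1 * (x - a))).

Lemma smooth_step a e : smooth (step a e).
Proof.
move=> k; rewrite (_ : step a e = (fun x => sstep (e^-1 * x + (- (e^-1 * a))))).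
  exact/Ck_comp_line/smooth_sstep.
by apply/funext => x; rewrite /step mulrBr.
Qed.

Lemma is_derive_step a e x : is_derive x (1 : R) (step a e) (mollifier a e x).
Proof.
have d1 : is_derive x (1 : R) (fun x => e^-1 * (x - a)) (e^-1).
  have -> : (fun x : R => e^-1 * (x - a)) = (fun x : R => e^-1 *: (x - a)) by [].
  apply: is_derive_eq; rewrite subr0 /GRing.scale/= mulr1//.
have := is_derive1_comp (g := fun x => e^-1 * (x - a))
  (smooth_is_derive (e^-1 * (x - a)) smooth_sstep) d1.
by rewrite mulrC.
Qed.

Lemma step_le a e x : 0 < e -> x <= a -> step a e x = 0.
Proof. by move=> e0 xa; rewrite /step sstep_le0// pmulr_rle0 ?invr_gt0// subr_le0. Qed.

Lemma step_ge a e x : 0 < e -> a + e <= x -> step a e x = 1.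
Proof.
by move=> e0 xa; rewrite /step sstep_ge1// ler_pdivlMl// mulr1 lerBrDl.
Qed.

Lemma mollifier_continuous a e : continuous (mollifier a e).
Proof.
have -> : mollifier a e = derive1 (step a e).
  by apply/funext => x; rewrite derive1E; have [_ ->] := is_derive_step a e x.
exact/smooth_continuous/smooth_derive1/smooth_step.
Qed.

Lemma mollifier_out a e x : 0 < e -> (x < a) || (a + e < x) -> mollifier a e x = 0.
Proof.
move=> e0 xae; have [_ <-] := is_derive_step a e x.
case/orP: xae => xa.
  rewrite (near_eq_derive (g := cst (0 : R))); first by rewrite derive_cst.
  by near=> y; rewrite step_le//; near: y; exact: lt_le_nbhsl.
rewrite (near_eq_derive (g := cst (1 : R))); first by rewrite derive_cst.
by near=> y; rewrite step_ge//; near: y; exact: lt_le_nbhsr.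
Unshelve. all: by end_near. Qed.

(** The derivative of [sstep] vanishes outside [[0, 1]] and is bounded on it. That [C] is
    independent of [e] is what the limit at Lebesgue points needs. *)
Lemma sstep_derive_bounded : exists2 C : R, 0 < C &
  forall a e x, 0 < e -> `|mollifier a e x| <= C / e.
Proof.
have [M HM] := continuous_itv_bounded 0 1 (smooth_continuous (smooth_derive1 (@smooth_sstep R))).
exists (`|M| + 1); first by rewrite ltr_wpDl.
move=> a e x e0; rewrite normrM mulrC [X in _ * X]ger0_norm ?invr_ge0 ?(ltW e0)//.
rewrite ler_pM2r ?invr_gt0//.
have [y01|y01] := boolP (e^-1 * (x - a) \in `[0, 1]).
  by rewrite (le_trans (HM _ y01))// (le_trans (ler_norm M))// lerDl.
suff -> : derive1 sstep (e^-1 * (x - a)) = 0 by rewrite normr0 addr_ge0.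
have : mollifier a e x = 0.
  apply: mollifier_out => //; move: y01; rewrite in_itv/= negb_and -!ltNge.
  by rewrite pmulr_rlt0 ?invr_gt0// subr_lt0 ltr_pdivlMl// mulr1 ltrBrDl.
by move/eqP; rewrite mulf_eq0 invr_eq0 gt_eqF//= => /eqP.
Qed.

Lemma primitive_step a e : primitive (step a e) (mollifier a e).
Proof. exact: is_derive_primitive (is_derive_step a e) (@mollifier_continuous a e). Qed.

End Mollifiers.

(** * Approximation at Lebesgue points *)

Section DuBoisReymond.
Context {R : realType}.
Local Notation mu := (@lebesgue_measure R).
Local Notation mR := (measurableTypeR R).
Implicit Types (P Q p q f g h : R -> R) (a b c x e : R).

Lemma Rintegral_support (D : set mR) f : (forall x, ~ D x -> f x = 0) ->
  \int[mu]_x f x = \int[mu]_(x in D) f x.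
Proof.
move=> f0; rewrite [RHS]Rintegral_mkcond; apply: eq_Rintegral => x _.
by rewrite patchE; case: ifPn => // /negP; rewrite inE => /f0 ->.
Qed.

Lemma integrable_support (D : set mR) f : measurable D ->
  (forall x, ~ D x -> f x = 0) ->
  mu.-integrable D (EFin \o f) -> mu.-integrable setT (EFin \o f).
Proof.
move=> mD f0 intf; have := integrable_patch mD intf; rewrite (_ : patch _ D f = f)//.
by apply/funext => x; rewrite patchE; case: ifPn => // /negP; rewrite inE => /f0 ->.
Qed.

Lemma mollifier_integrable f a e : 0 < e ->
  mu.-integrable `[a, a + e] (EFin \o f) ->
  mu.-integrable setT (EFin \o (mollifier a e \* f)).
Proof.
move=> e0 intf; have [C C0 HC] := @sstep_derive_bounded R.
apply: (@integrable_support `[a, a + e]%classic) => //.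
  move=> x /= xae; rewrite mollifier_out ?mul0r//.
  by move/negP : xae; rewrite in_itv/= negb_and -!ltNge.
apply: (@integrableM_bound _ _ _ _ (C / e)) => //.
- by apply: measurable_funTS; apply: continuous_measurable_fun; exact: mollifier_continuous.
- by move=> x _; exact: HC.
Qed.

Lemma Rintegral_mollifier a e : 0 < e -> \int[mu]_x mollifier a e x = 1.
Proof.
move=> e0; rewrite (@Rintegral_support `[a, a + e]%classic).
  have [_ _ <-] := primitive_step a e; last by rewrite lerDl ltW.
  by rewrite step_ge// step_le// subr0.
move=> x xae; rewrite mollifier_out//.
by move/negP : xae; rewrite /= in_itv/= negb_and -!ltNge.
Qed.

(** The error is at most [C / e] times the integral of [|f - f a|] over the ball of radius [2 e],
    that is, [4 C] times the mean deviation on that ball; hence the threshold [eta / (4 * C)]. *)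
Lemma mollifier_approx f a : measurable_fun (setT : set mR) f -> lebesgue_pt f a ->
  forall d eta : R, 0 < d -> 0 < eta -> mu.-integrable `[a, a + d] (EFin \o f) ->
  exists2 e : R, 0 < e <= d &
    forall e' : R, 0 < e' <= e -> `|\int[mu]_x (mollifier a e' x * f x) - f a| < eta.
Proof.
move=> mf fa d eta d0 eta0 intf; have [C C0 HC] := @sstep_derive_bounded R.
have eC0 : 0 < eta / (4 * C) by rewrite divr_gt0// mulr_gt0.
have : \forall r \near 0^'+, (davg f a r < (eta / (4 * C))%:E)%E.
  have := fa; rewrite /lebesgue_pt => cv.
  have [U [oU U0] HU] : exists2 U : set \bar R, open_nbhs 0%E U & U `<=` [set z | (z < (eta / (4 * C))%:E)%E].
    exists [set z | (z < (eta / (4 * C))%:E)%E] => //; split => //=.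
    exact: open_ereal_lt_ereal.
  have {}cv : \forall r \near 0^'+, U (davg f a r) := cv _ (open_nbhs_nbhs (conj oU U0)).
  by apply: filterS cv => r Ur; exact: HU.
move=> [r /= r0 Hr].
(* The quarter keeps the radius [2 * e] strictly below [r]. *)
exists (Num.min d (r / 4)); first by rewrite lt_min d0 divr_gt0//= ge_min lexx.
move=> e; rewrite le_min => /and3P[e0 ed er].
have davge : (davg f a (2 * e) < (eta / (4 * C))%:E)%E.
  apply: Hr => /=; last by rewrite mulr_gt0.
  rewrite /ball/= sub0r normrN gtr0_norm ?mulr_gt0//.
  by move: er; rewrite ler_pdivlMr//; lra.
have intfe : mu.-integrable `[a, a + e] (EFin \o f).
  by apply: integrableS intf => //; apply: subset_itvl; rewrite bnd_simp lerD2l.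
have intc (k : R) : mu.-integrable `[a, a + e] (EFin \o cst k).
  by apply: continuous_itv_integrable => x; exact: cvg_cst.
have intfc : mu.-integrable `[a, a + e] (EFin \o (fun x => f x - f a)).
  exact: (integrable_EFinB _ intfe (intc (f a))).
have -> : \int[mu]_x (mollifier a e x * f x) - f a = \int[mu]_x (mollifier a e x * (f x - f a)).
  rewrite -[in LHS](mulr1 (f a)) -(Rintegral_mollifier a e0) -RintegralZl//; last first.
    have := mollifier_integrable e0 (intc 1).
    by rewrite (_ : _ \* _ = mollifier a e)//; apply/funext => x /=; rewrite mulr1.
  rewrite -RintegralB//; last 2 first.
  - exact: mollifier_integrable.
  - have := mollifier_integrable e0 (intc (f a)).
    by rewrite (_ : _ \* _ = (fun x => f a * mollifier a e x))//; apply/funext => x /=; rewrite mulrC.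
  by apply: eq_Rintegral => x _; rewrite mulrBr (mulrC (f a)).
apply: le_lt_trans (le_normr_Rintegral _ (mollifier_integrable e0 intfc)) _ => //.
rewrite (@Rintegral_support `[a, a + e]%classic); last first.
  move=> x /= xae; rewrite mollifier_out ?mul0r ?normr0//.
  by move/negP : xae; rewrite in_itv/= negb_and -!ltNge.
have intn := integrable_EFin_norm intfc.
apply: (@le_lt_trans _ _ (\int[mu]_(x in `[a, a + e]) (C / e * `|f x - f a|))).
  apply: ae_le_Rintegral => //.
  - apply: integrable_EFin_norm.
    by apply: integrableS (mollifier_integrable e0 intfc).
  - exact: integrable_EFinZ.
  - by apply: ae_true => x _; rewrite normrM ler_wpM2r// HC.
rewrite RintegralZl//.
have I0 : 0 <= \int[mu]_(x in `[a, a + e]) `|f x - f a| by exact: Rintegral_ge0.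
(* The ball is open and must contain the end point [a + e], hence the radius [2 * e] and the measure
   [4 * e]. *)
have bnd : ((\int[mu]_(x in `[a, a + e]) `|f x - f a|)%:E <= (4 * e)%:E * davg f a (2 * e))%E.
  rewrite /davg /iavg.
  have -> : mu (ball a (2 * e)) = (4 * e)%:E.
    by rewrite lebesgue_measure_ball ?mulr_ge0 ?(ltW e0)// -mulr_natr; congr EFin; ring.
  rewrite muleA inver gt_eqF ?mulr_gt0// -EFinM mulfV ?gt_eqF ?mulr_gt0// mul1e.
  rewrite /Rintegral fineK; last exact: integrable_fin_num.
  apply: ge0_subset_integral => //.
  - exact: measurable_ball.
  - apply/measurable_EFinP/measurableT_comp => //; apply: measurable_funTS.
    by apply: measurable_funB.
  - move=> x /=; rewrite in_itv/= /ball/= => /andP[ax xae].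
    by rewrite distrC ger0_norm ?subr_ge0//; lra.
have : ((\int[mu]_(x in `[a, a + e]) `|f x - f a|)%:E < (4 * e * (eta / (4 * C)))%:E)%E.
  apply: le_lt_trans bnd _; rewrite [X in (_ < X)%E]EFinM lte_pmul2l//.
  by rewrite lte_fin mulr_gt0.
rewrite lte_fin => H.
rewrite mulrC -ltr_pdivlMr ?divr_gt0//; apply: lt_le_trans H _.
by rewrite le_eqVlt; apply/orP; left; apply/eqP; field; rewrite !gt_eqF.
Qed.

End DuBoisReymond.

(** * From weak derivatives to primitives *)

Section WeakDerivatives.
Context {R : realType}.
Local Notation mu := (@lebesgue_measure R).
Local Notation mR := (measurableTypeR R).
Implicit Types (P Q p q f g h : R -> R) (a b c x e : R).

Lemma mollifier_diff_integrable f a b d e : a < b -> 0 < e <= d ->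
  mu.-integrable `[a, b + d] (EFin \o f) ->
  mu.-integrable setT (EFin \o (fun x => mollifier a e x * f x)) /\
  mu.-integrable setT (EFin \o (fun x => mollifier b e x * f x)).
Proof.
move=> ab /andP[e0 ed] intf; split; apply: mollifier_integrable => //;
  apply: integrableS intf => //; apply: subset_itv; rewrite bnd_simp ?lerD2l//.
- by rewrite lerD// ltW.
- exact: ltW.
Qed.

(** Integration by parts on [[a, b + e]], at whose ends the smoothed indicator vanishes. *)
Lemma primitive_step_diff G g a b e : primitive G g -> a < b -> 0 < e ->
  \int[mu]_x (g x * (step a e x - step b e x)) =
  - \int[mu]_x (G x * (mollifier a e x - mollifier b e x)).
Proof.
move=> HG ab e0.
pose phi x := step a e x - step b e x.
pose phi' x := mollifier a e x - mollifier b e x.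
have Hphi : primitive phi phi'.
  apply: is_derive_primitive => x.
    by apply: is_deriveB; exact: is_derive_step.
  by apply: cvgB; exact: mollifier_continuous.
have [_ ip PE] := primitiveM HG Hphi.
have ab' : a <= b + e by rewrite ltW// (lt_trans ab)// ltrDl.
have pa : phi a = 0 by rewrite /phi !step_le ?subrr// ltW.
have pb : phi (b + e) = 0 by rewrite /phi !step_ge ?subrr// lerD2r ltW.
have := PE _ _ ab'; rewrite /= pa pb !mulr0 subrr RintegralD//; last 2 first.
- apply: (primitive_integrableM _ _ Hphi); exact: (primitive_continuous HG).
- apply: (primitive_integrableM _ _ HG); exact: (primitive_continuous Hphi).
move/esym/eqP; rewrite addr_eq0 => /eqP E.
rewrite (@Rintegral_support _ `[a, b + e]%classic); last first.
  move=> x /= /negP; rewrite in_itv/= negb_and -!ltNge => /orP[xa|xb].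
    by rewrite !step_le ?subrr ?mulr0 ?ltW// (lt_trans xa).
  by rewrite !step_ge ?subrr ?mulr0 ?ltW// (lt_trans _ xb)// ltrD2r.
rewrite [in RHS](@Rintegral_support _ `[a, b + e]%classic); last first.
  move=> x /= /negP; rewrite in_itv/= negb_and -!ltNge => xab.
  rewrite !mollifier_out ?subrr ?mulr0//.
  - by case/orP: xab => xab; rewrite ?xab ?orbT ?(lt_trans xab ab).
  - by case/orP: xab => xab; rewrite ?xab ?orbT// (lt_trans _ xab) ?orbT// ltrD2r.
by rewrite E opprK; apply: eq_Rintegral => x _; rewrite mulrC.
Qed.

(* Mollified indicator functions of [a, b] are the only test functions needed to
   recover increments of [f] at Lebesgue points. *)
Lemma lebesgue_pt_increment f G g a b d : measurable_fun (setT : set mR) f ->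
  primitive G g -> a < b -> 0 < d -> mu.-integrable `[a, b + d] (EFin \o f) ->
  lebesgue_pt f a -> lebesgue_pt f b ->
  (forall e, 0 < e <= d ->
    \int[mu]_x (f x * (mollifier a e x - mollifier b e x)) =
    - \int[mu]_x (g x * (step a e x - step b e x))) ->
  f b - f a = G b - G a.
Proof.
move=> mf HG ab d0 intf fa fb H.
have cG := primitive_continuous HG.
have mG := primitive_measurable HG.
have Gpt x : lebesgue_pt G x.
  by apply: (@continuous_lebesgue_pt _ _ _ setT) => //; [split => //; exact: openT|exact: cG].
have intG : mu.-integrable `[a, b + d] (EFin \o G) by exact: continuous_itv_integrable.
apply/eqP; rewrite -subr_eq0 -normr_le0; apply/ler_addgt0Pl => eta eta0; rewrite addr0.
have eta4 : 0 < eta / 4 by rewrite divr_gt0.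
have arith (A B A' B' : R) : `|A - f a| < eta / 4 -> `|B - f b| < eta / 4 ->
    `|A' - G a| < eta / 4 -> `|B' - G b| < eta / 4 -> A - B = A' - B' ->
    `|f b - f a - (G b - G a)| <= eta.
  rewrite !ltr_norml ler_norml.
  by move=> /andP[? ?] /andP[? ?] /andP[? ?] /andP[? ?] ?; apply/andP; split; lra.
have suba (k : R -> R) : mu.-integrable `[a, b + d] (EFin \o k) -> mu.-integrable `[a, a + d] (EFin \o k).
  by apply: integrableS => //; apply: subset_itvl; rewrite bnd_simp lerD2r ltW.
have subb (k : R -> R) : mu.-integrable `[a, b + d] (EFin \o k) -> mu.-integrable `[b, b + d] (EFin \o k).
  by apply: integrableS => //; apply: subset_itvr; rewrite bnd_simp ltW.
have [e1 /andP[e10 e1d] H1] := mollifier_approx mf fa d0 eta4 (suba _ intf).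
have [e2 /andP[e20 e2d] H2] := mollifier_approx mf fb d0 eta4 (subb _ intf).
have [e3 /andP[e30 e3d] H3] := mollifier_approx mG (Gpt a) d0 eta4 (suba _ intG).
have [e4 /andP[e40 e4d] H4] := mollifier_approx mG (Gpt b) d0 eta4 (subb _ intG).
pose e := Num.min (Num.min e1 e2) (Num.min e3 e4).
have e0 : 0 < e by rewrite !lt_min e10 e20 e30 e40.
have ee1 : e <= e1 by rewrite !ge_min lexx.
have ee2 : e <= e2 by rewrite !ge_min lexx orbT.
have ee3 : e <= e3 by rewrite !ge_min lexx !orbT.
have ee4 : e <= e4 by rewrite !ge_min lexx !orbT.
have ed : 0 < e <= d by rewrite e0 (le_trans ee1).
have := H1 e; rewrite e0 ee1 => /(_ isT) {}H1.
have := H2 e; rewrite e0 ee2 => /(_ isT) {}H2.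
have := H3 e; rewrite e0 ee3 => /(_ isT) {}H3.
have := H4 e; rewrite e0 ee4 => /(_ isT) {}H4.
have D (k : R -> R) : mu.-integrable `[a, b + d] (EFin \o k) ->
    \int[mu]_x (k x * (mollifier a e x - mollifier b e x)) =
    \int[mu]_x (mollifier a e x * k x) - \int[mu]_x (mollifier b e x * k x).
  move=> /(mollifier_diff_integrable ab ed)[kai kbi]; rewrite -(RintegralB _ kai kbi)//.
  by apply: eq_Rintegral => x _; rewrite mulrC mulrBl.
have E := H e ed; rewrite (primitive_step_diff HG ab e0) opprK (D f intf) (D G intG) in E.
exact: (arith _ _ _ _ H1 H2 H3 H4 E).
Qed.

Lemma test_step_diff a b e : a < b -> 0 < e ->
  test_function setT (fun x => step a e x - step b e x).
Proof.
move=> ab e0; split.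
  move=> k; rewrite (_ : (fun x => _) = step a e \+ (fun x => (-1) * step b e x)).
    by apply: Ck_add; [|apply: Ck_scale]; exact: smooth_step.
  by apply/funext => x /=; rewrite mulN1r.
exists `[a, b + e]%classic; split => //; first exact: segment_compact.
move=> x /= /negP; rewrite in_itv/= negb_and -!ltNge => /orP[xa|xb].
  by rewrite !step_le ?subrr ?ltW// (lt_trans xa).
by rewrite !step_ge ?subrr ?ltW// (lt_trans _ xb)// ltrD2r.
Qed.

Lemma derive1_step_diff a b e x :
  derive1 (fun x => step a e x - step b e x) x = mollifier a e x - mollifier b e x.
Proof.
rewrite derive1E.
have -> : (fun x => step a e x - step b e x) = (step a e \- step b e) by [].
rewrite deriveB; [|by have [] := is_derive_step a e x|by have [] := is_derive_step b e x].
by rewrite (@derive_val _ _ _ _ _ _ _ (is_derive_step a e x)) (@derive_val _ _ _ _ _ _ _ (is_derive_step b e x)).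
Qed.

(** The additive constant is fixed at one Lebesgue point [a] of [f]. Testing with smoothed
    indicators compares every other Lebesgue point with [a], and almost every point is one. *)
Lemma weak_derivative_primitive f g : weak_derivative 1 f g ->
  exists2 F, primitive F g & {ae mu, forall x, f x = F x}.
Proof.
move=> [lf lg wd].
have [mf _ _] := lf; have [mg _ _] := lg.
have [a _ fa] := ae_itv_ex (@ltr01 R) (lebesgue_differentiation lf).
have [F HF Fa] := primitive_exists (f a) a mg (fun a b => locally_integrable_itv a b lg).
exists F => //.
have inc c x : c < x -> lebesgue_pt f c -> lebesgue_pt f x -> f x - f c = F x - F c.
  move=> cx fc fx.
  apply: (lebesgue_pt_increment mf HF cx ltr01 (locally_integrable_itv _ _ lf) fc fx).
  move=> e /andP[e0 e1].
  have := wd _ (test_step_diff cx e0); rewrite expr1 mulN1r => <-.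
  by apply: eq_Rintegral => y _; rewrite derive1n1 derive1_step_diff.
apply: ae_imp (lebesgue_differentiation lf) => x fx.
have [ax|xa|ax] := ltgtP a x; last by rewrite -ax.
- by have := inc _ _ ax fa fx; rewrite Fa => /addIr.
- by have := inc _ _ xa fx fa; rewrite Fa => /addrI/oppr_inj.
Qed.

(** The hypothesis says that [f] is a weak derivative of zero. Its primitive is then continuous and
    almost everywhere zero, hence zero, and so is its density almost everywhere. *)
Lemma dubois_reymond f : locally_integrable setT f ->
  (forall phi, test_function setT phi -> \int[mu]_x (f x * phi x) = 0) ->
  {ae mu, forall x, f x = 0}.
Proof.
move=> lf f0.
have l0 : locally_integrable setT (cst 0 : R -> R).
  by have := locally_integrableB lf lf; congr locally_integrable; apply/funext => x /=; rewrite subrr.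
have [|F HF F0] := @weak_derivative_primitive (cst 0) f.
  split=> // phi tphi; rewrite f0// mulr0.
  by under eq_Rintegral do rewrite mul0r; rewrite Rintegral_cst// mul0r.
have cF := primitive_continuous HF.
have Fz : F = cst 0.
  apply/funext => x; apply/eqP; rewrite eq_le -oppr_ge0; apply/andP; split.
    apply: (continuous_ae_ge0 (f := fun x => - F x)).
      by move=> y; apply: cvgN; exact: cF.
    by apply: ae_imp F0 => y /= <-; rewrite oppr0.
  by apply: continuous_ae_ge0 => //; apply: ae_imp F0 => y /= <-.
have H0 : primitive F (cst 0) by rewrite Fz; exact: primitive_cst.
by apply: ae_imp (primitive_unique HF H0) => x ->.
Qed.

End WeakDerivatives.

(** * Continuous representatives and the product rule *)

Section SpatialRegularity.
Context {R : realType}.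
Local Notation mu := (@lebesgue_measure R).
Local Notation mR := (measurableTypeR R).
Implicit Types (P Q p q f g h : R -> R) (a b c x e : R).

Lemma continuous_ae_eq f g : continuous f -> continuous g ->
  {ae mu, forall x, f x = g x} -> f = g.
Proof.
move=> cf cg fg; apply/funext => x; apply/eqP; rewrite eq_le -subr_ge0 -[X in _ && X]subr_ge0.
apply/andP; split.
  apply: (@continuous_ae_ge0 _ (fun x => g x - f x)).
    by move=> y; apply: cvgB; [exact: cg|exact: cf].
  by apply: ae_imp fg => y /= ->; rewrite subrr.
apply: (@continuous_ae_ge0 _ (fun x => f x - g x)).
  by move=> y; apply: cvgB; [exact: cf|exact: cg].
by apply: ae_imp fg => y /= ->; rewrite subrr.
Qed.

Lemma test_function_support (phi : R -> R) : test_function setT phi ->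
  exists2 r : R, 0 < r & forall x, r <= `|x| -> phi x = 0 /\ derive1 phi x = 0.
Proof.
move=> [_ [K [cK _ phi0]]].
have [M [_ HM]] := compact_bounded cK.
have HK x : `|M| + 1 < `|x| -> phi x = 0.
  move=> Mx; apply: phi0 => Kx.
  have : M < `|M| + 1 by rewrite (le_lt_trans (ler_norm _))// ltrDl.
  by move=> /HM/(_ _ Kx)/=; rewrite leNgt Mx.
(* One unit more than in [HK] leaves a neighbourhood on which [phi] is zero, so that the derivative
   vanishes even where [|x|] equals the radius. *)
exists (`|M| + 2); first by rewrite ltr_wpDl.
move=> x Mx; have Mx' : `|M| + 1 < `|x| by apply: lt_le_trans Mx; rewrite ltrD2l ltr1n.
split; first exact: HK.
rewrite derive1E (near_eq_derive (g := cst (0 : R))) ?derive_cst//.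
near=> y; rewrite HK//; near: y.
by apply: (cvgr_gt `|x|) => //; apply: (cvg_norm (f := id)).
Unshelve. all: by end_near. Qed.

Lemma test_function_derive1 (phi : R -> R) : test_function setT phi ->
  test_function setT (derive1 phi).
Proof.
move=> tphi; have [sphi _] := tphi; split; first exact: smooth_derive1.
have [r r0 Hr] := test_function_support tphi.
exists `[- r, r]%classic; split => //; first exact: segment_compact.
move=> x /negP; rewrite /= in_itv/= -ler_norml -ltNge => /ltW/Hr[].
by [].
Qed.

Lemma test_functionZ c (phi : R -> R) : test_function setT phi ->
  test_function setT (fun x => c * phi x).
Proof.
move=> [sphi [K [cK _ phi0]]]; split; first by move=> k; apply: Ck_scale.
by exists K; split => // x /phi0 ->; rewrite mulr0.
Qed.

Lemma test_function_primitive (phi : R -> R) : test_function setT phi ->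
  primitive phi (derive1 phi).
Proof.
move=> [sphi _]; apply: is_derive_primitive => [x|].
  exact: smooth_is_derive.
by apply: smooth_continuous; exact: smooth_derive1.
Qed.

(** Testing the first weak derivative with [phi'] shows that [uxx] is the weak derivative of [ux];
    the passage to a primitive then applies twice. *)
Lemma weak_derivative2_primitive u ux uxx :
  weak_derivative 1 u ux -> weak_derivative 2 u uxx ->
  exists U G, [/\ primitive U G, primitive G uxx,
    {ae mu, forall x, u x = U x} & {ae mu, forall x, ux x = G x}].
Proof.
move=> wd1 wd2; have [lu lux wd1'] := wd1; have [_ luxx wd2'] := wd2.
have [G HG uxG] : exists2 G, primitive G uxx & {ae mu, forall x, ux x = G x}.
  apply: weak_derivative_primitive; split => // phi tphi.
  have := wd1' _ (test_function_derive1 tphi); have := wd2' _ tphi.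
  rewrite expr1 mulN1r sqrrN expr1n mul1r mulN1r => E1 E2.
  by rewrite -E1; apply/eqP; rewrite -eqr_oppLR; apply/eqP; exact: esym E2.
have [U HU uU] := weak_derivative_primitive wd1.
exists U, G; split => //; apply: primitive_ae_eq HU => //.
exact: primitive_measurable HG.
Qed.

Section ProductRule.
Variables (phi u ux U G g dphiu : R -> R).
Hypotheses (tphi : test_function setT phi) (HU : primitive U G) (HG : primitive G g).
Hypotheses (uU : {ae mu, forall x, u x = U x}) (uxG : {ae mu, forall x, ux x = G x}).
Hypothesis wd : weak_derivative 1 (fun x => phi x * u x) dphiu.

(** The primitive of [dphiu] and [phi * U] are continuous and almost everywhere equal, hence equal,
    so their densities agree almost everywhere. This identifies the witness of the weak
    formulation. *)
Lemma weak_derivativeM :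
  {ae mu, forall x, dphiu x = phi x * G x + U x * derive1 phi x}.
Proof.
have [F HF phiuF] := weak_derivative_primitive wd.
have Hphi := test_function_primitive tphi.
have HphiU := primitiveM Hphi HU.
have FE : phi \* U = F.
  apply: continuous_ae_eq; [exact: primitive_continuous HphiU|exact: primitive_continuous HF|].
  by apply: ae_imp2 phiuF uU => x /= <- ->.
by rewrite -FE in HF; exact: (primitive_unique HF HphiU).
Qed.

(** Turns the divergence form of the equation into the product [u uxx]. There is no boundary term
    because [phi] vanishes at both ends of [[-r, r]]. *)
Lemma weak_derivativeM_by_parts : measurable_fun (setT : set mR) ux ->
  \int[mu]_x (dphiu x * ux x) = - \int[mu]_x (phi x * (U x * g x)).
Proof.
move=> mux; have [_ [mdphiu _ _] _] := wd.
have Hphi := test_function_primitive tphi.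
have HphiU := primitiveM Hphi HU.
have mg : measurable_fun (setT : set mR) g by case: HG.
have mU := primitive_measurable HU; have mG := primitive_measurable HG.
have mphi := primitive_measurable Hphi.
have [_ _] := HphiU; have [mD _ _] := HphiU => _.
have -> : \int[mu]_x (dphiu x * ux x) =
    \int[mu]_x (G x * (phi x * G x + U x * derive1 phi x)).
  apply: ae_eq_Rintegral => //.
  - exact: measurable_funM.
  - exact: measurable_funM.
  - by apply: ae_imp2 weak_derivativeM uxG => x -> -> _; rewrite mulrC.
have [r r0 Hr] := test_function_support tphi.
have out x : ~ `[- r, r]%classic x -> phi x = 0 /\ derive1 phi x = 0.
  by move=> /negP; rewrite /= in_itv/= -ler_norml -ltNge => /ltW/Hr.
rewrite (@Rintegral_support _ `[- r, r]%classic); last first.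
  by move=> x /out[-> ->]; rewrite mul0r mulr0 addr0 mulr0.
rewrite [in RHS](@Rintegral_support _ `[- r, r]%classic); last first.
  by move=> x /out[-> _]; rewrite mul0r.
have rr : - r <= r by rewrite ge0_cp// ltW.
have [_ _ /(_ _ _ rr)] := primitiveM HphiU HG.
have [phir _] := Hr r (ler_norm r).
have [phiNr _] : phi (- r) = 0 /\ derive1 phi (- r) = 0.
  by apply: Hr; rewrite normrN ler_norm.
rewrite /= phir phiNr !mul0r subrr RintegralD//; last 2 first.
- by apply: (primitive_integrableM _ _ HG); exact: primitive_continuous HphiU.
- by apply: (primitive_integrableM _ _ HphiU); exact: primitive_continuous HG.
move/esym/eqP; rewrite addrC addr_eq0 => /eqP ->; congr (- _).
by apply: eq_Rintegral => x _; rewrite /= mulrA.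
Qed.

End ProductRule.
End SpatialRegularity.

(** * The weighted energy estimate *)

Section Energy.
Context {R : realType}.
Local Notation mu := (@lebesgue_measure R).
Local Notation mR := (measurableTypeR R).
Implicit Types (P Q p q f g h : R -> R) (a b c x e : R).

Definition rq x : R := (1 + x ^+ 2)^-1.

Lemma q_gt0 x : 0 < 1 + x ^+ 2.
Proof. by rewrite ltr_pwDl// sqr_ge0. Qed.

Lemma rq_gt0 x : 0 < rq x.
Proof. by rewrite invr_gt0 q_gt0. Qed.

Lemma rq_mul x : rq x * (1 + x ^+ 2) = 1.
Proof. by rewrite mulVf// gt_eqF// q_gt0. Qed.

Lemma rq_le1 x : rq x <= 1.
Proof. by rewrite invf_le1 ?q_gt0// lerDl sqr_ge0. Qed.

Lemma sqr_rq_le1 x : x ^+ 2 * rq x <= 1.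
Proof. by rewrite ler_pdivrMr ?q_gt0// mul1r lerDr. Qed.

Lemma is_derive_rq x : is_derive x (1 : R) rq (- 2 * x * rq x ^+ 2).
Proof.
have d1 : is_derive x (1 : R) (fun x => 1 + x ^+ 2) (2 * x).
  have d2 : is_derive x (1 : R) (fun x : R => x ^+ 2) (2 * x).
    apply: DeriveDef; first exact: exprn_derivable.
    by rewrite exp_derive expr1 /GRing.scale/= mulr1.
  have := is_deriveD (is_derive_cst (1 : R) x 1) d2; rewrite add0r; exact.
have := is_deriveV (f := fun x => 1 + x ^+ 2) (lt0r_neq0 (q_gt0 x)) d1.
rewrite /rq exprVn => H; apply: is_derive_eq.
by rewrite /GRing.scale/=; ring.
Qed.

Lemma continuous_rq : continuous rq.
Proof. by move=> x; apply/differentiable_continuous/derivable1_diffP; have [] := is_derive_rq x. Qed.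

Definition wt x : R := (rq x * rq x) * (rq x * rq x).
Definition wt' x : R := -8 * x * (rq x * wt x).
Definition wt'' x : R := -8 * (rq x * wt x) + 80 * x ^+ 2 * (rq x * (rq x * wt x)).

Lemma is_derive_wt x : is_derive x (1 : R) wt (wt' x).
Proof.
have d1 := is_derive_rq x.
have d2 := is_deriveM (is_deriveM d1 d1) (is_deriveM d1 d1).
apply: (is_derive_eq (f := wt) d2).
set r := rq x; transitivity (r * r * (r * (- 2 * x * r ^+ 2) + r * (- 2 * x * r ^+ 2)) +
  r * r * (r * (- 2 * x * r ^+ 2) + r * (- 2 * x * r ^+ 2))) => //.
by rewrite /wt' /wt -/r; ring.
Qed.

Lemma is_derive_wt' x : is_derive x (1 : R) wt' (wt'' x).
Proof.
have d1 : is_derive x (1 : R) (fun x : R => -8 * x) (-8).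
  have -> : (fun x : R => -8 * x) = (fun x : R => (-8 : R) *: (x : R)) by [].
  by apply: is_derive_eq; rewrite /GRing.scale/= mulr1.
have d2 := is_deriveM d1 (is_deriveM (is_derive_rq x) (is_derive_wt x)).
apply: (is_derive_eq (f := wt') d2).
transitivity ((-8 * x) * (rq x * wt' x + wt x * (-2 * x * rq x ^+ 2)) + rq x * wt x * -8) => //.
by rewrite /wt'' /wt' /wt; ring.
Qed.

Lemma continuous_wt : continuous wt.
Proof. by move=> x; apply/differentiable_continuous/derivable1_diffP; have [] := is_derive_wt x. Qed.

Lemma continuous_wt' : continuous wt'.
Proof. by move=> x; apply/differentiable_continuous/derivable1_diffP; have [] := is_derive_wt' x. Qed.

Lemma continuous_wt'' : continuous wt''.
Proof.
have cX n : continuous (fun x : R => x ^+ n) by exact: exprn_continuous.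
move=> x; apply: cvgD; apply: cvgM.
- exact: cvg_cst.
- by apply: cvgM; [exact: continuous_rq|exact: continuous_wt].
- by apply: cvgM; [exact: cvg_cst|exact: cX].
- apply: cvgM; first exact: continuous_rq.
  by apply: cvgM; [exact: continuous_rq|exact: continuous_wt].
Qed.

Lemma wt_gt0 x : 0 < wt x.
Proof. by rewrite !mulr_gt0 ?rq_gt0. Qed.

Lemma primitive_wt : primitive wt wt'.
Proof. exact: is_derive_primitive is_derive_wt continuous_wt'. Qed.

Lemma primitive_wt' : primitive wt' wt''.
Proof. exact: is_derive_primitive is_derive_wt' continuous_wt''. Qed.

Lemma bracketE x : bracket x ^+ 2 = 1 + x ^+ 2.
Proof. by rewrite sqr_sqrtr addrC// ltW// q_gt0. Qed.

Lemma bracket_ge1 x : 1 <= bracket x.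
Proof. by rewrite -[X in X <= _]sqrtr1 ler_sqrt ?lerDr ?sqr_ge0// addrC ltW// q_gt0. Qed.

Lemma norm_le_bracket x : `|x| <= bracket x.
Proof. by rewrite -sqrtr_sqr ler_sqrt ?lerDl// addrC ltW// q_gt0. Qed.

(** Each derivative of the weight gains a factor [1 / bracket x]; here the gain absorbs the growth
    of a gradient. *)
Lemma wt'_le x : bracket x * `|wt' x| <= 8 * wt x.
Proof.
rewrite /wt' 2!normrM (ger0_norm (ltW (mulr_gt0 (rq_gt0 x) (wt_gt0 x)))).
rewrite normrN (@ger0_norm _ 8)//.
have -> : bracket x * (8 * `|x| * (rq x * wt x)) = (bracket x * `|x|) * rq x * (8 * wt x) by ring.
have w8 : 0 <= 8 * wt x by rewrite mulr_ge0// ltW// wt_gt0.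
rewrite -[leRHS]mul1r ler_wpM2r//.
rewrite ler_pdivrMr ?q_gt0// mul1r -bracketE expr2 ler_wpM2l ?norm_le_bracket//.
exact: le_trans (bracket_ge1 x).
Qed.

(** [wt''] is [rq x * wt x] times [80 y - 8] with [y = x^2 rq x] in [[0, 1]], and 88 is [80 + 8].
    The gain of [1 + x^2] absorbs the growth of a solution. *)
Lemma wt''_le x : (1 + x ^+ 2) * `|wt'' x| <= 88 * wt x.
Proof.
have r0 := rq_gt0 x; have w0 := wt_gt0 x.
have -> : wt'' x = rq x * (wt x * (80 * (x ^+ 2 * rq x) - 8)) by rewrite /wt''; ring.
set y := 80 * _ - 8.
have -> : `|rq x * (wt x * y)| = rq x * (wt x * `|y|).
  by rewrite normrM (gtr0_norm r0) normrM (gtr0_norm w0).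
have -> : (1 + x ^+ 2) * (rq x * (wt x * `|y|)) = (rq x * (1 + x ^+ 2)) * (`|y| * wt x) by ring.
rewrite rq_mul mul1r ler_pM2r// /y.
have := sqr_rq_le1 x; have : 0 <= x ^+ 2 * rq x by rewrite mulr_ge0 ?sqr_ge0// ltW.
by rewrite ler_norml; set z := _ * _; move=> ? ?; apply/andP; split; lra.
Qed.

(** Taylor's formula with step [L = bracket x]: the remainder is at most [M L^2], and since
    [1 + (x + L)^2 <= 5 L^2] the two values of [F] contribute at most [5 C L^2] and [C L^2].
    Dividing by [L] gives the constant [6 C + M]. *)
Lemma primitive_gradient_bound F G g (C M : R) : primitive F G -> primitive G g ->
  0 <= C -> (forall x, `|F x| <= C * (1 + x ^+ 2)) ->
  {ae mu, forall x, `|g x| <= M} ->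
  forall x, `|G x| <= (6 * C + M) * bracket x.
Proof.
move=> HF HG C0 FC gM x.
set L := bracket x.
have L1 : 1 <= L by exact: bracket_ge1.
have L0 : 0 < L by exact: lt_le_trans L1.
have LE : L ^+ 2 = 1 + x ^+ 2 by exact: bracketE.
have M0 : 0 <= M by have [y _ ] := ae_itv_ex (@ltr01 R) gM; exact: le_trans.
have cG := primitive_continuous HG.
have xL : x <= x + L by rewrite lerDl ltW.
have [_ iG FE] := HF; have [mg ig GE] := HG.
have icst k a b : mu.-integrable `[a, b] (EFin \o (fun=> k)).
  by apply: continuous_itv_integrable => y; exact: cvg_cst.
have lenE a b (ab : a <= b) k : \int[mu]_(y in `[a, b]) k = k * (b - a).
  by rewrite Rintegral_cst//= lebesgue_measure_itv/= lte_fin; case: ltP => [//|ba]; rewrite (@le_anti _ _ a b) ?ab ?ba// subrr.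
have Glip s : x <= s <= x + L -> `|G s - G x| <= M * L.
  move=> /andP[xs sL]; rewrite GE//.
  apply: le_trans (le_normr_Rintegral _ (ig _ _)) _ => //.
  apply: (@le_trans _ _ (\int[mu]_(y in `[x, s]) M)).
    apply: ae_le_Rintegral => //; first exact: integrable_EFin_norm.
    by apply: ae_imp gM => y.
  by rewrite lenE// ler_wpM2l// lerBlDl.
have main : `|F (x + L) - F x - G x * L| <= M * L * L.
  have -> : G x * L = \int[mu]_(y in `[x, x + L]) G x by rewrite lenE//; congr (_ * _); ring.
  rewrite FE// -RintegralB//.
  apply: le_trans (le_normr_Rintegral _ _) _ => //; first exact: integrable_EFinB.
  apply: (@le_trans _ _ (\int[mu]_(y in `[x, x + L]) (M * L))).
    apply: le_Rintegral => //.
    by apply: integrable_EFin_norm; exact: integrable_EFinB.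
  by rewrite lenE// (_ : x + L - x = L)//; ring.
have F1 := FC (x + L); have F2 := FC x.
have xL2 : 1 + (x + L) ^+ 2 <= 5 * L ^+ 2.
  have := norm_le_bracket x; rewrite -/L ler_norml => /andP[h1 h2].
  rewrite LE. have : 0 <= (L - x) ^+ 2 by exact: sqr_ge0. rewrite !sqrrD LE. nra.
have {}F1 : `|F (x + L)| <= C * (5 * L ^+ 2) by apply: le_trans F1 _; rewrite ler_wpM2l.
rewrite -LE in F2.
rewrite -(ler_pM2r L0) -[X in _ * X <= _](gtr0_norm L0) -normrM.
have -> : (6 * C + M) * L * L = (6 * C + M) * L ^+ 2 by ring.
rewrite (_ : M * L * L = M * L ^+ 2) in main; last by ring.
move: main F1 F2; rewrite !ler_norml => /andP[? ?] /andP[? ?] /andP[? ?].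
by apply/andP; split; lra.
Qed.


Lemma integrable_rq : mu.-integrable setT (EFin \o rq).
Proof.
apply/integrableP; split.
  by apply/measurable_EFinP; apply: continuous_measurable_fun; exact: continuous_rq.
have -> : (\int[mu]_x `|(EFin \o rq) x| = \int[mu]_x (rq x)%:E)%E.
  by apply: eq_integral => x _ /=; rewrite ger0_norm// ltW// rq_gt0.
rewrite ge0_symfun_integralT; last 3 first.
- by move=> x; rewrite ltW// rq_gt0.
- exact: continuous_rq.
- by move=> x /=; rewrite /rq sqrrN.
rewrite (_ : [set x : R | 0 <= x] = `[0, +oo[%classic); last first.
  by apply/seteqP; split => x /=; rewrite in_itv/= andbT.
by rewrite (integral0y_oneDsqr R) -EFinM ltry.
Qed.

Lemma cvg_Rintegral_itv f : mu.-integrable setT (EFin \o f) ->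
  \int[mu]_(x in `[- n%:R, n%:R]) f x @[n --> \oo] --> \int[mu]_x f x.
Proof.
move=> intf.
have mf : measurable_fun (setT : set mR) f by apply/measurable_EFinP; case/integrableP : intf.
pose D n : set mR := `[- n%:R, n%:R]%classic.
have mfD n : measurable_fun setT (f \_ (D n)).
  by apply: measurable_patch; [exact: measurable_itv|exact: measurable_funTS].
have cv : (\int[mu]_x ((f \_ (D n)) x)%:E)%E @[n --> \oo] --> (\int[mu]_x f x)%:E.
  rewrite /Rintegral fineK; last exact: integrable_fin_num.
  have [//||//|||_ _] := @dominated_convergence _ mR R mu setT measurableT
    (fun n => EFin \o (f \_ (D n))) (EFin \o f) (fun x => `|f x|%:E).
  - by move=> n; exact/measurable_EFinP.
  - by apply/measurable_EFinP.
  - apply: ae_true => x _; apply: cvg_near_cst; near=> n.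
    rewrite /= patchE mem_set//= /D /= in_itv/= -ler_norml.
    by near: n; exact: nbhs_infty_ger.
  - exact: integrable_EFin_norm.
  - apply: ae_true => x n _; rewrite /= lee_fin patchE.
    by case: ifP => // _; rewrite normr0.
  - by [].
have E n : \int[mu]_(x in D n) f x = fine (\int[mu]_x ((f \_ (D n)) x)%:E).
  by rewrite /Rintegral integral_mkcond; congr fine; apply: eq_integral => x _; rewrite restrict_EFin.
by rewrite (eq_cvg _ _ E); exact: fine_cvg cv.
Unshelve. all: by end_near. Qed.

(** * The energy estimate at a fixed time *)

Section EnergyEstimate.
Variables (F1 G1 g1 F2 G2 g2 : R -> R) (C M1 M2 : R).
Hypotheses (HF1 : primitive F1 G1) (HG1 : primitive G1 g1).
Hypotheses (HF2 : primitive F2 G2) (HG2 : primitive G2 g2).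
Hypotheses (C0 : 0 <= C) (F1C : forall x, `|F1 x| <= C * (1 + x ^+ 2)).
Hypotheses (F2C : forall x, `|F2 x| <= C * (1 + x ^+ 2)).
Hypotheses (g1M : {ae mu, forall x, `|g1 x| <= M1}).
Hypotheses (g2M : {ae mu, forall x, `|g2 x| <= M2}).
Hypothesis F1_ge0 : forall x, 0 <= F1 x.

Let W x := F1 x - F2 x.
Let V x := G1 x - G2 x.
Let v x := g1 x - g2 x.
(** [A] is the coefficient of [w_xx] times the weight. The density [p] of [P] is left as the product
    rule delivers it; after cancellation it is [A W v + A V^2 - A'' W^2 / 2]. *)
Let A x := F1 x * wt x.
Let A' x := F1 x * wt' x + wt x * G1 x.
Let A'' x := (F1 x * wt'' x + wt' x * G1 x) + (wt x * g1 x + G1 x * wt' x).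
Let P x := A x * (W x * V x) + (- 2^-1) * (A' x * (W x * W x)).
Let p x := A x * (W x * v x + V x * V x) + (W x * V x) * A' x +
  (- 2^-1) * (A' x * (W x * V x + W x * V x) + (W x * W x) * A'' x).

Lemma energy_primitive : primitive P p.
Proof.
have HN (f g : R -> R) (c : R) : primitive f g -> primitive (fun x => c * f x) (fun x => c * g x).
  move=> H; have := primitiveM (primitive_cst c) H.
  by congr primitive; apply/funext => x /=; rewrite mulr0 addr0.
have HW : primitive W V.
  have := primitiveD HF1 (HN _ _ (-1) HF2).
  by congr primitive; apply/funext => x /=; rewrite mulN1r.
have HV : primitive V v.
  have := primitiveD HG1 (HN _ _ (-1) HG2).
  by congr primitive; apply/funext => x /=; rewrite mulN1r.
have HA : primitive A A' := primitiveM HF1 primitive_wt.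
have HA' : primitive A' A''.
  exact: (primitiveD (primitiveM HF1 primitive_wt') (primitiveM primitive_wt HG1)).
have HWV := primitiveM HW HV; have HWW := primitiveM HW HW.
exact: (primitiveD (primitiveM HA HWV) (HN _ _ _ (primitiveM HA' HWW))).
Qed.

Let Q x : R := 1 + x ^+ 2.
Let K1 : R := 6 * C + M1.
Let K2 : R := 6 * C + M2.
(** The coefficient of [W^2 wt]: half of the bound on [A''], to which [F1 wt''] contributes [88 C],
    the two mixed terms [8 K1] each and [wt g1] contributes [M1], plus [M2] from the zero-order term
    [g2 W]. *)
Let K : R := 2^-1 * (88 * C + 16 * K1 + M1) + M2.

Let M10 : 0 <= M1.
Proof. by have [y _] := ae_itv_ex (@ltr01 R) g1M; exact: le_trans. Qed.

Let M20 : 0 <= M2.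
Proof. by have [y _] := ae_itv_ex (@ltr01 R) g2M; exact: le_trans. Qed.

Let K10 : 0 <= K1.
Proof. by rewrite addr_ge0// mulr_ge0. Qed.

Let K20 : 0 <= K2.
Proof. by rewrite addr_ge0// mulr_ge0. Qed.

Let G1K x : `|G1 x| <= K1 * bracket x.
Proof. exact: (primitive_gradient_bound HF1 HG1 C0 F1C g1M). Qed.

Let G2K x : `|G2 x| <= K2 * bracket x.
Proof. exact: (primitive_gradient_bound HF2 HG2 C0 F2C g2M). Qed.

Let WQ x : `|W x| <= 2 * C * Q x.
Proof.
have := F1C x; have := F2C x; rewrite /W /Q !ler_norml.
by move=> /andP[? ?] /andP[? ?]; apply/andP; split; lra.
Qed.

Let VL x : `|V x| <= (K1 + K2) * bracket x.
Proof.
have := G1K x; have := G2K x; rewrite /V !ler_norml.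
by move=> /andP[? ?] /andP[? ?]; apply/andP; split; lra.
Qed.

Let Q0 x : 0 < Q x. Proof. exact: q_gt0. Qed.
Let L0 x : 0 < bracket x. Proof. exact: lt_le_trans (bracket_ge1 x). Qed.
Let LQ x : bracket x <= Q x.
Proof. by rewrite /Q -bracketE expr2; apply: ler_peMr; [exact: ltW|exact: bracket_ge1]. Qed.

(** Boundary terms cost one power of [Q] for each of [F1], [W] and [V]; the fourth power in the
    weight is left over as decay. *)
Let Q3wt x : Q x * Q x * Q x * wt x = rq x.
Proof.
have -> : Q x * Q x * Q x * wt x = (rq x * Q x) * (rq x * Q x) * (rq x * Q x) * rq x.
  by rewrite /wt; ring.
by rewrite rq_mul !mul1r.
Qed.

Let Q2wt x : Q x * Q x * wt x <= rq x.
Proof.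
have -> : Q x * Q x * wt x = (rq x * Q x) * (rq x * Q x) * rq x * rq x by rewrite /wt; ring.
by rewrite rq_mul !mul1r ler_piMr ?rq_le1// ltW// rq_gt0.
Qed.

Let A''wt x : `|g1 x| <= M1 -> `|A'' x| <= (88 * C + 16 * K1 + M1) * wt x.
Proof.
move=> gx; have w0 := wt_gt0 x.
have h1 : `|F1 x * wt'' x| <= 88 * C * wt x.
  rewrite normrM; apply: le_trans (ler_wpM2r (normr_ge0 _) (F1C x)) _.
  have -> : 88 * C * wt x = C * (88 * wt x) by ring.
  by rewrite -mulrA ler_wpM2l// wt''_le.
have h2 : `|wt' x * G1 x| <= 8 * K1 * wt x.
  rewrite normrM mulrC; apply: le_trans (ler_wpM2r (normr_ge0 _) (G1K x)) _.
  have -> : 8 * K1 * wt x = K1 * (8 * wt x) by ring.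
  by rewrite -mulrA ler_wpM2l// wt'_le.
have h3 : `|wt x * g1 x| <= M1 * wt x by rewrite normrM (gtr0_norm w0) mulrC ler_wpM2r// ltW.
rewrite /A'' (mulrC (G1 x)); move: h1 h2 h3; rewrite !ler_norml.
by move=> /andP[? ?] /andP[? ?] /andP[? ?]; apply/andP; split; lra.
Qed.

Let P_bound x : `|P x| <= (2 * C ^+ 2 * (K1 + K2) + 2 * C ^+ 2 * (8 * C + K1)) * rq x.
Proof.
have w0 := wt_gt0 x; have r0 := rq_gt0 x.
have A0 : `|A x| <= C * Q x * wt x by rewrite normrM (gtr0_norm w0) ler_wpM2r ?F1C// ltW.
have A'0 : `|A' x| <= (8 * C + K1) * Q x * wt x.
  have h1 : `|F1 x * wt' x| <= 8 * C * Q x * wt x.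
    rewrite normrM; apply: le_trans (ler_wpM2r (normr_ge0 _) (F1C x)) _.
    rewrite -bracketE; have h := ler_wpM2l (ltW (L0 x)) (wt'_le x).
    have -> : C * bracket x ^+ 2 * `|wt' x| = C * (bracket x * (bracket x * `|wt' x|)) by ring.
    have -> : 8 * C * Q x * wt x = C * (Q x * (8 * wt x)) by ring.
    rewrite ler_wpM2l//; apply: le_trans h _.
    by rewrite ler_wpM2r// mulr_ge0// ltW.
  have h2 : `|wt x * G1 x| <= K1 * Q x * wt x.
    rewrite normrM (gtr0_norm w0) mulrC ler_wpM2r ?(ltW w0)//.
    by apply: le_trans (G1K x) _; rewrite ler_wpM2l.
  by apply: le_trans (ler_normD _ _) _; lra.
have B1 : `|A x * (W x * V x)| <= 2 * C ^+ 2 * (K1 + K2) * rq x.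
  rewrite (normrM (A x)) (normrM (W x)); apply: (@le_trans _ _ ((C * Q x * wt x) * ((2 * C * Q x) * ((K1 + K2) * Q x)))).
    apply: ler_pM => //.
    apply: ler_pM => //; apply: le_trans (VL x) _.
    by rewrite ler_wpM2l// addr_ge0.
  by rewrite -Q3wt le_eqVlt; apply/orP; left; apply/eqP; ring.
have B2 : `|A' x * (W x * W x)| <= 4 * C ^+ 2 * (8 * C + K1) * rq x.
  rewrite (normrM (A' x)) (normrM (W x)); apply: (@le_trans _ _ (((8 * C + K1) * Q x * wt x) * ((2 * C * Q x) * (2 * C * Q x)))).
    apply: ler_pM => //.
    exact: ler_pM.
  by rewrite -Q3wt le_eqVlt; apply/orP; left; apply/eqP; ring.
rewrite /P; move: B1 B2; rewrite !ler_norml.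
by move=> /andP[? ?] /andP[? ?]; apply/andP; split; lra.
Qed.

Let h x := (F1 x * g1 x - F2 x * g2 x) * W x * wt x.

(** From [F1 g1 - F2 g2 = F1 v + g2 W] follows [h = p + W^2 (g2 wt + A'' / 2) - A V^2], and the last
    term is discarded because [F1] is nonnegative. *)
Lemma energy_pointwise x : `|g1 x| <= M1 -> `|g2 x| <= M2 ->
  h x <= p x + K * (W x ^+ 2 * wt x).
Proof.
move=> g1x g2x; have w0 := wt_gt0 x.
have := A''wt g1x; rewrite ler_norml => /andP[_ A''x].
have E : h x = p x + (W x ^+ 2 * (g2 x * wt x + 2^-1 * A'' x) - A x * V x ^+ 2).
  by rewrite /h /p /A /W /V /v; field.
rewrite E lerD2l; apply: (@le_trans _ _ (W x ^+ 2 * (g2 x * wt x + 2^-1 * A'' x))).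
  by rewrite gerBl mulr_ge0 ?sqr_ge0// mulr_ge0// ltW.
have -> : K * (W x ^+ 2 * wt x) = W x ^+ 2 * (K * wt x) by ring.
rewrite ler_wpM2l ?sqr_ge0//.
have : g2 x * wt x <= M2 * wt x by rewrite ler_wpM2r ?(ltW w0)// (le_trans (ler_norm _)).
by rewrite /K; lra.
Qed.

Lemma W2wt_bound x : `|W x ^+ 2 * wt x| <= 4 * C ^+ 2 * rq x.
Proof.
have w0 := wt_gt0 x.
rewrite normrM (gtr0_norm w0) normrX.
apply: (@le_trans _ _ ((2 * C * Q x) ^+ 2 * wt x)).
  by rewrite ler_wpM2r ?(ltW w0)// lerXn2r// nnegrE// mulr_ge0 ?mulr_ge0// ltW.
have -> : (2 * C * Q x) ^+ 2 * wt x = 4 * C ^+ 2 * (Q x * Q x * wt x) by ring.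
by rewrite ler_wpM2l// mulr_ge0// sqr_ge0.
Qed.

Lemma h_bound x : `|g1 x| <= M1 -> `|g2 x| <= M2 ->
  `|h x| <= 2 * C ^+ 2 * (M1 + M2) * rq x.
Proof.
move=> g1x g2x; have w0 := wt_gt0 x.
rewrite /h normrM (gtr0_norm w0) normrM.
apply: (@le_trans _ _ ((C * Q x * M1 + C * Q x * M2) * (2 * C * Q x) * wt x)).
  rewrite ler_wpM2r ?(ltW w0)// ler_pM//.
  by apply: le_trans (ler_normB _ _) _; rewrite !normrM lerD// ler_pM.
have -> : (C * Q x * M1 + C * Q x * M2) * (2 * C * Q x) * wt x =
  2 * C ^+ 2 * (M1 + M2) * (Q x * Q x * wt x) by ring.
by rewrite ler_wpM2l// mulr_ge0 ?addr_ge0// mulr_ge0// sqr_ge0.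
Qed.

Let cW : continuous W.
Proof.
have c1 := primitive_continuous HF1; have c2 := primitive_continuous HF2.
by move=> x; exact: cvgB (c1 x) (c2 x).
Qed.

Let mW2wt : measurable_fun (setT : set mR) (fun x => W x ^+ 2 * wt x).
Proof.
apply: measurable_funM.
  by apply: measurable_funX; exact: continuous_measurable_fun.
by apply: continuous_measurable_fun; exact: continuous_wt.
Qed.

Let mh : measurable_fun (setT : set mR) h.
Proof.
have [mg1 _ _] := HG1; have [mg2 _ _] := HG2.
have mF1 := primitive_measurable HF1; have mF2 := primitive_measurable HF2.
apply: measurable_funM; last by apply: continuous_measurable_fun; exact: continuous_wt.
apply: measurable_funM; last exact: continuous_measurable_fun.
by apply: measurable_funB; exact: measurable_funM.
Qed.

Let iW2wt : mu.-integrable setT (EFin \o (fun x => W x ^+ 2 * wt x)).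
Proof.
apply: (@ae_le_integrable _ _ _ mu setT _ (fun x => 4 * C ^+ 2 * rq x)) => //.
  exact: integrable_EFinZ integrable_rq.
by apply: ae_true => x _; exact: W2wt_bound.
Qed.

Let ih : mu.-integrable setT (EFin \o h).
Proof.
apply: (@ae_le_integrable _ _ _ mu setT _ (fun x => 2 * C ^+ 2 * (M1 + M2) * rq x)) => //.
  exact: integrable_EFinZ integrable_rq.
by apply: ae_imp2 g1M g2M => x ? ? _; exact: h_bound.
Qed.

(** Over [[-n, n]] the density [p] integrates to [P n - P (-n)], at most [2 D / (1 + n^2)], which
    disappears in the limit. *)
Lemma energy_le : \int[mu]_x h x <= K * \int[mu]_x (W x ^+ 2 * wt x).
Proof.
have HP := energy_primitive; have [_ ip PE] := HP.
set D := 2 * C ^+ 2 * (K1 + K2) + 2 * C ^+ 2 * (8 * C + K1).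
have D0 : 0 <= D.
  by rewrite addr_ge0// mulr_ge0 ?addr_ge0 ?mulr_ge0 ?sqr_ge0.
have cv2 : 2 * D * rq n%:R + K * \int[mu]_(x in `[- n%:R, n%:R]) (W x ^+ 2 * wt x) @[n --> \oo]
    --> 0 + K * \int[mu]_x (W x ^+ 2 * wt x).
  apply: cvgD; last by apply: cvgM; [exact: cvg_cst|exact: cvg_Rintegral_itv].
  rewrite -[X in _ --> X](mulr0 (2 * D)); apply: cvgM; first exact: cvg_cst.
  (* [rq n] lies below the harmonic sequence since [n <= n^2]. *)
  apply: (@squeeze_cvgr _ _ _ _ (cst 0) (@harmonic R)); [|exact: cvg_cst|exact: cvg_harmonic].
  apply: nearW => n /=; rewrite (ltW (rq_gt0 _))/= /rq lef_pV2 ?posrE ?q_gt0//.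
  rewrite -natr1 addrC lerD2l -natrX ler_nat; case: n => // n.
  by rewrite expnS expn1 leq_pmulr.
rewrite -[leRHS]add0r.
apply: (ler_cvg_to (cvg_Rintegral_itv ih) cv2); apply: nearW => n.
have nn : - n%:R <= n%:R :> R by rewrite ge0_cp.
have sub (f : R -> R) : mu.-integrable setT (EFin \o f) -> mu.-integrable `[- n%:R, n%:R] (EFin \o f).
  by apply: integrableS.
have iK : mu.-integrable `[- n%:R, n%:R] (EFin \o (fun x => K * (W x ^+ 2 * wt x))).
  by apply: integrable_EFinZ => //; exact: sub.
apply: (@le_trans _ _ (\int[mu]_(x in `[- n%:R, n%:R]) (p x + K * (W x ^+ 2 * wt x)))).
  apply: ae_le_Rintegral => //; [exact: sub|exact: integrable_EFinD|].
  by apply: ae_imp2 g1M g2M => x ? ? _; exact: energy_pointwise.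
rewrite RintegralD// -PE// RintegralZl//; last exact: sub.
rewrite lerD2r.
have rqN : rq (- n%:R) = rq n%:R by rewrite /rq sqrrN.
have := P_bound n%:R; have := P_bound (- n%:R); rewrite -/D rqN !ler_norml.
by move=> /andP[? ?] /andP[? ?]; lra.
Qed.

(** Substituting [K1 = 6 C + M1] turns [K] into [92 C + 17/2 M1 + M2]. The product bound separates
    the constant in time from the time-dependent norms. *)
Lemma energy_estimate :
  \int[mu]_x ((F1 x * g1 x - F2 x * g2 x) * (F1 x - F2 x) * wt x) <=
  (92 * C + 9) * (1 + M1 + M2) * \int[mu]_x ((F1 x - F2 x) ^+ 2 * wt x).
Proof.
apply: le_trans energy_le _; rewrite ler_wpM2r//.
  by apply: Rintegral_ge0 => x _; rewrite mulr_ge0 ?sqr_ge0// ltW// wt_gt0.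
rewrite /K /K1; have CM1 := mulr_ge0 C0 M10; have CM2 := mulr_ge0 C0 M20.
have ? := M10; have ? := M20; lra.
Qed.

End EnergyEstimate.

End Energy.

(** * The weak formulation in time *)

Section AlmostEverywhere.

Lemma Lnorm_oo_ae d (T : measurableType d) (R : realType) (mu : {measure set T -> \bar R})
    (f : T -> \bar R) : (0 < mu setT)%E ->
  {ae mu, forall x, (`|f x| <= Lnorm mu +oo f)%E}.
Proof.
by move=> mu0; rewrite unlock mu0; exact: (ess_sup_ge mu (abse \o f)).
Qed.

Context {R : realType}.
Local Notation mu := (@lebesgue_measure R).
Local Notation mR := (measurableTypeR R).
Local Notation RR := (mR * mR)%type.
Local Notation mu2 := (mu \x mu)%E.

(** The measure of a null set of the plane is the integral of the measures of its sections. *)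
Lemma ae_xsection (P : RR -> Prop) : {ae mu2, forall z, P z} ->
  {ae mu, forall t, {ae mu, forall x, P (t, x)}}.
Proof.
move=> [N [mN N0 PN]].
have mN' : measurable_fun (setT : set mR) (mu \o xsection N) by exact: measurable_fun_xsection.
have : (\int[mu]_t `|(mu \o xsection N) t| = 0)%E.
  by rewrite -[RHS]N0; apply: eq_integral => t _; rewrite gee0_abs.
move/(ae_eq_integral_abs mu measurableT mN'); apply: ae_imp => t /= /(_ I) Nt.
exists (xsection N t); split => //; first exact: measurable_xsection.
by move=> x nP; rewrite /xsection /= inE; apply: PN => /= H; apply: nP.
Qed.

Lemma lebesgue_measureT_gt0 : (0 < mu setT)%E.
Proof.
apply: (@lt_le_trans _ _ (mu `[0, 1]%classic)).
  by rewrite lebesgue_measure_itv/= lte_fin ltr01 sube0 lte_fin ltr01.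
by apply: le_measure; rewrite ?inE.
Qed.

Lemma lebesgue_measure2T_gt0 : (0 < mu2 setT)%E.
Proof.
by rewrite -setXTT product_measure1E// mule_gt0// lebesgue_measureT_gt0.
Qed.

Lemma Linf_norm_ae (D : set R) (f : R -> R) :
  {ae mu, forall x, D x -> (`|f x|%:E <= Linf_norm D f)%E}.
Proof.
have := @Lnorm_oo_ae _ mR R mu (EFin \o (f \_ D)) lebesgue_measureT_gt0.
by apply: ae_imp => x /= + Dx; rewrite patchE mem_set.
Qed.

Lemma Linf_norm_ge0 (D : set R) (f : R -> R) : (0 <= Linf_norm D f)%E.
Proof. exact: Lnorm_ge0. Qed.

Lemma Linf_norm_fin_ae (D : set R) (f : R -> R) : (Linf_norm D f < +oo)%E ->
  {ae mu, forall x, D x -> `|f x| <= fine (Linf_norm D f)}.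
Proof.
move=> ffin; have := Linf_norm_ae D f; apply: ae_imp => x /= + Dx => /(_ Dx).
by rewrite -lee_fin fineK// ge0_fin_numE// Linf_norm_ge0.
Qed.

Lemma bracket_Linf_ae (I : set R) (u : R -> R -> R) : bracket_Linf 2 I u ->
  exists2 C : R, 0 <= C & {ae mu, forall t, I t ->
    {ae mu, forall x, `|u t x| <= C * (1 + x ^+ 2)}}.
Proof.
move=> [_]; set N := Lnorm _ _ _ => Nfin.
have N0 : (0 <= N)%E by exact: Lnorm_ge0.
have NE : N = (fine N)%:E by rewrite fineK// ge0_fin_numE.
exists (fine N); first exact: fine_ge0.
have := @Lnorm_oo_ae _ RR R mu2 (EFin \o ((fun p : RR => bracket p.2 ^- 2 * u p.1 p.2) \_ (I `*` setT))) lebesgue_measure2T_gt0.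
move/ae_xsection; apply: ae_imp => t Ht It; apply: ae_imp Ht => x /=.
rewrite patchE mem_set//= -/N NE lee_fin normrM ger0_norm ?invr_ge0 ?sqr_ge0//.
by rewrite bracketE ler_pdivrMl ?q_gt0// mulrC.
Qed.

(* Compactness of [0, T], phrased with [near_covering]. *)
Lemma C_W1oo_bounded (Tbar T : R) (u ux : R -> R -> R) (r : R) :
  0 < T < Tbar -> C_W1oo_loc Tbar u ux ->
  exists2 K : R, 0 <= K & forall t, 0 <= t <= T ->
    {ae mu, forall x, `[- r, r]%classic x -> `|ux t x| <= K}.
Proof.
move=> /andP[T0 TT] [_ _ Hloc Hc].
pose P (n : nat) (t : R) := 0 <= t <= T ->
  {ae mu, forall x, `[- r, r]%classic x -> `|ux t x| <= n%:R}.
have cov : \forall n \near \oo, `[0, T]%classic `<=` P n.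
  apply: ((@compact_near_coveringP _ `[0, T]%classic).1 (@segment_compact R 0 T) nat \oo).
  move=> s; rewrite /= in_itv/= => /andP[s0 sT].
  have sI : s \in `[0, Tbar[ by rewrite in_itv/= s0 (le_lt_trans sT).
  have [_ [_ /(_ r) fin] _] := Hloc _ sI.
  have bs := Linf_norm_fin_ae fin.
  set B := fine _ in bs.
  have near_s : \forall t \near s, `[0, Tbar[%classic t -> ((Linf_norm `[- r, r] (u t \- u s))%R +
         (Linf_norm `[- r, r] (ux t \- ux s))%R < 1)%E.
    exact: (Hc s r sI _ (open_nbhs_nbhs (conj (@open_ereal_lt_ereal R 1%E) (@lte01 R)))).
  exists ([set t | `[0, Tbar[%classic t -> ((Linf_norm `[- r, r] (u t \- u s))%R +
         (Linf_norm `[- r, r] (ux t \- ux s))%R < 1)%E], [set n : nat | B + 1 <= n%:R]).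
    by split => //; exact: nbhs_infty_ger.
  move=> [t n] /= [Ht Hn] /andP[t0 tT].
  have tI : t \in `[0, Tbar[ by rewrite in_itv/= t0 (le_lt_trans tT).
  have {}Ht := Ht tI.
  have l1 : ((Linf_norm `[- r, r] (ux t \- ux s))%R < 1)%E.
    by apply: le_lt_trans Ht; rewrite leeDr// Linf_norm_ge0.
  have := Linf_norm_ae `[- r, r]%classic (ux t \- ux s).
  apply: ae_imp2 bs => x /= h1 h2 xr.
  have {}h1 := h1 xr; have {}h2 := le_lt_trans (h2 xr) l1.
  rewrite lte_fin in h2; apply: le_trans Hn.
  by rewrite -(subrK (ux s x) (ux t x)) (le_trans (ler_normD _ _))// addrC lerD// ltW.
have [n _ Hn] := cov.
exists n%:R => // t t0T; apply: (Hn n) => //=.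
Qed.

Lemma test_integrable (f phi : R -> R) : locally_integrable setT f ->
  test_function setT phi -> mu.-integrable setT (EFin \o (fun x => phi x * f x)).
Proof.
move=> lf tphi; have [r r0 Hr] := test_function_support tphi.
have cphi := smooth_continuous tphi.1.
have [M HM] := continuous_itv_bounded (- r) r cphi.
apply: (@integrable_support _ `[- r, r]%classic) => //.
  move=> x /negP; rewrite /= in_itv/= -ler_norml -ltNge => /ltW/Hr[-> _].
  by rewrite mul0r.
apply: (@integrableM_bound _ _ _ _ M) => //.
  by apply: measurable_funTS; exact: continuous_measurable_fun.
exact: locally_integrable_itv.
Qed.

(** Projection onto [[0, T]]. Composed with it, a solution becomes continuous in time on the whole
    line, where Lebesgue points and mollifiers are available. *)
Definition clamp (T t : R) : R := Num.min T (Num.max 0 t).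

Lemma clamp_itv T t : 0 <= T -> 0 <= clamp T t <= T.
Proof. by move=> T0; rewrite /clamp le_min T0 le_max lexx ge_min lexx. Qed.

Lemma clamp_id T t : 0 <= t <= T -> clamp T t = t.
Proof. by move=> /andP[t0 tT]; rewrite /clamp max_r// min_r. Qed.

Lemma clamp_le0 T t : 0 <= T -> t <= 0 -> clamp T t = 0.
Proof. by move=> T0 t0; rewrite /clamp max_l// min_r. Qed.

Lemma clamp_lip T s t : `|clamp T t - clamp T s| <= `|t - s|.
Proof.
rewrite /clamp; wlog st : s t / s <= t.
  by move=> H; have [/H//|/ltW/H] := leP s t; rewrite distrC [leRHS]distrC.
rewrite (ger0_norm (x := t - s)) ?subr_ge0//.
rewrite ler_norml /Num.min /Num.max.
have [s0|s0] := ltP (0 : R) s; have [t1|t1] := ltP (0 : R) t;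
  case: ltP => ?; case: ltP => ?; apply/andP; split; lra.
Qed.

(** The increment is at most the sup norm of the difference over the support of [phi] times the
    integral of [|phi|]; the added 1 avoids a division by zero. *)
Lemma C_W1oo_pairing_continuous (Tbar T : R) (u ux : R -> R -> R) (phi : R -> R) :
  0 < T < Tbar -> C_W1oo_loc Tbar u ux -> test_function setT phi ->
  continuous (fun t => \int[mu]_x (phi x * u (clamp T t) x)).
Proof.
move=> /andP[T0 TT] [_ _ Hloc Hc] tphi t0.
have cI t : clamp T t \in `[0, Tbar[.
  by have /andP[? ?] := clamp_itv t (ltW T0); rewrite in_itv/=; apply/andP; split; lra.
have lu t : locally_integrable setT (u (clamp T t)).
  by have [_ _ []] := Hloc _ (cI t).
have [r r0 Hr] := test_function_support tphi.
have iphi : mu.-integrable setT (EFin \o phi).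
  apply: (@integrable_support _ `[- r, r]%classic) => //.
    by move=> x /negP; rewrite /= in_itv/= -ler_norml -ltNge => /ltW/Hr[-> _].
  exact: continuous_itv_integrable (smooth_continuous tphi.1).
have inphi := integrable_EFin_norm iphi.
set I := \int[mu]_x `|phi x|.
have I0 : 0 <= I by exact: Rintegral_ge0.
apply/cvgrPdist_le => eta eta0.
have e0 : (0 < (eta / (I + 1))%:E)%E by rewrite lte_fin divr_gt0// ltr_wpDl.
have near_s : \forall t \near clamp T t0, `[0, Tbar[%classic t ->
    ((Linf_norm `[- r, r] (u t \- u (clamp T t0)))%R +
     (Linf_norm `[- r, r] (ux t \- ux (clamp T t0)))%R < (eta / (I + 1))%:E)%E.
  exact: (Hc _ r (cI t0) _ (open_nbhs_nbhs (conj (@open_ereal_lt_ereal R _) e0))).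
have [d /= d0 Hd] := near_s.
exists d => //= t td.
have {}Hd : ((Linf_norm `[- r, r] (u (clamp T t) \- u (clamp T t0)))%R +
     (Linf_norm `[- r, r] (ux (clamp T t) \- ux (clamp T t0)))%R < (eta / (I + 1))%:E)%E.
  apply: Hd; last exact: cI.
  by rewrite /ball/=; apply: le_lt_trans td; rewrite clamp_lip.
have l1 : ((Linf_norm `[- r, r] (u (clamp T t) \- u (clamp T t0)))%R < (eta / (I + 1))%:E)%E.
  by apply: le_lt_trans Hd; rewrite leeDl// Linf_norm_ge0.
have i1 := test_integrable (lu t) tphi; have i0 := test_integrable (lu t0) tphi.
rewrite distrC -RintegralB//.
apply: le_trans (le_normr_Rintegral _ _) _ => //; first exact: integrable_EFinB.
apply: (@le_trans _ _ (\int[mu]_x ((eta / (I + 1)) * `|phi x|))).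
  apply: ae_le_Rintegral => //.
  - by apply: integrable_EFin_norm; exact: integrable_EFinB.
  - exact: integrable_EFinZ.
  - have := Linf_norm_ae `[- r, r]%classic (u (clamp T t) \- u (clamp T t0)).
    apply: ae_imp => x /= Hx _; rewrite -mulrBr normrM mulrC.
    have [xr|xr] := leP `|x| r; last first.
      by have [-> _] := Hr _ (ltW xr); rewrite normr0 !mulr0.
    rewrite ler_wpM2r//; apply: ltW.
    have : `[- r, r]%classic x by rewrite /= in_itv/= -ler_norml.
    by move/Hx => /le_lt_trans/(_ l1); rewrite lte_fin.
rewrite RintegralZl// -/I mulrAC ler_pdivrMr ?ltr_wpDl// ler_wpM2l ?ltW//.
by rewrite ltrDl.
Qed.

End AlmostEverywhere.

(** * Product test functions in time and space *)

Section TensorTestFunctions.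
Context {R : realType}.

Lemma continuous_fst_linear : continuous (fst : R * R -> R).
Proof. by move=> x; exact: cvg_fst. Qed.

Lemma continuous_snd_linear : continuous (snd : R * R -> R).
Proof. by move=> x; exact: cvg_snd. Qed.

Lemma derive_comp_linear (V W : normedModType R) (L : {linear V -> W}) (f : W -> R) v x :
  continuous L -> differentiable f (L x) ->
  'D_v (fun x => f (L x)) x = 'D_(L v) f (L x).
Proof.
move=> cL df; have dL : differentiable L x by exact: linear_differentiable.
rewrite !deriveE//; last exact: (@differentiable_comp _ _ _ _ L).
by rewrite (diff_comp (f := L))//= diff_lin.
Qed.

Lemma smooth_fst (theta : R -> R) : smooth theta -> smooth (fun p : R * R => theta p.1).
Proof.
move=> sth k.
have := @Ck_comp_affine _ _ _ k (fst : {linear (R * R)%type -> R}) 0 theta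
  continuous_fst_linear (sth k).
by congr Ck; apply/funext => x; rewrite addr0.
Qed.

Lemma smooth_snd (phi : R -> R) : smooth phi -> smooth (fun p : R * R => phi p.2).
Proof.
move=> sphi k.
have := @Ck_comp_affine _ _ _ k (snd : {linear (R * R)%type -> R}) 0 phi
  continuous_snd_linear (sphi k).
by congr Ck; apply/funext => x; rewrite addr0.
Qed.

Lemma smooth_tensor (theta phi : R -> R) : smooth theta -> smooth phi ->
  smooth (fun p : R * R => theta p.1 * phi p.2).
Proof.
move=> sth sphi k.
apply: (@Ck_mul _ _ k (fun p : R * R => theta p.1) (fun p : R * R => phi p.2)).
  exact: smooth_fst.
exact: smooth_snd.
Qed.

(** Time is bounded only from above, so [a] may be negative; below it is -1. *)
Lemma spacetime_test_tensor (T a b : R) (theta phi : R -> R) : smooth theta -> b < T ->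
  (forall t, ~ `[a, b]%classic t -> theta t = 0) -> test_function setT phi ->
  spacetime_test T (fun p => theta p.1 * phi p.2).
Proof.
move=> sth bT th0 [sphi [K [cK _ phi0]]]; split; first exact: smooth_tensor.
exists (`[a, b]%classic `*` K); split.
- by apply: compact_setX => //; exact: segment_compact.
- by move=> [t x] /= [+ _]; rewrite in_itv/= => /andP[_ tb]; exact: le_lt_trans bT.
- move=> [t x] /= ntx; have [tab|tab] := pselect (`[a, b]%classic t).
    by rewrite (phi0 x) ?mulr0// => Kx; apply: ntx.
  by rewrite th0 ?mul0r.
Qed.

Lemma dt_tensor (theta phi : R -> R) p : smooth theta -> smooth phi ->
  dt (fun p : R * R => theta p.1 * phi p.2) p = derive1 theta p.1 * phi p.2.
Proof.
move=> sth sphi; rewrite /dt.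
have d1 (f : R -> R) x : smooth f -> differentiable f x by move=> /(_ 1)[].
have dth : differentiable (fun p : R * R => theta p.1) p by have [] := smooth_fst sth 1.
have dphi : differentiable (fun p : R * R => phi p.2) p by have [] := smooth_snd sphi 1.
rewrite (deriveM (f := fun p : R * R => theta p.1) (g := fun p : R * R => phi p.2)); try exact: diff_derivable.
rewrite (derive_comp_linear (L := (fst : {linear (R * R)%type -> R})) (1, 0) continuous_fst_linear); last exact: d1.
rewrite (derive_comp_linear (L := (snd : {linear (R * R)%type -> R})) (1, 0) continuous_snd_linear); last exact: d1.
by rewrite /= derive0 scaler0 add0r -derive1E /GRing.scale/= mulrC.
Qed.

End TensorTestFunctions.

(** * Integrating the equation in time *)

Section WeakFormulationInTime.
Context {R : realType}.
Local Notation mu := (@lebesgue_measure R).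
Local Notation mR := (measurableTypeR R).
Local Notation RR := (mR * mR)%type.
Local Notation mu2 := (mu \x mu)%E.
Implicit Types (t x : R).

Lemma ae_integral_le (D : set mR) (f b : R -> R) (c : R) : measurable D ->
  measurable_fun D f -> mu.-integrable D (EFin \o b) ->
  {ae mu, forall x, D x -> `|f x| <= c * b x} ->
  (\int[mu]_(x in D) `|f x|%:E <= (c * \int[mu]_(x in D) b x)%:E)%E.
Proof.
move=> mD mf ib fb.
have icb : mu.-integrable D (EFin \o (fun x => c * b x)) by exact: integrable_EFinZ.
have iF := ae_le_integrable mD mf icb fb.
have inf := integrable_EFin_norm iF.
rewrite -(fineK (integrable_fin_num mD inf)) lee_fin -RintegralZl//.
apply: (ae_le_Rintegral mD inf icb); apply: ae_imp fb => x /= H Dx; exact: H.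
Qed.

Lemma measurable_slice (f : RR -> R) (t : R) : measurable_fun (setT : set RR) f ->
  measurable_fun (setT : set mR) (fun x => f (t, x)).
Proof. by move=> mf; apply: (measurableT_comp mf); exact: pair1_measurable. Qed.

Lemma integrableM_bound_prod (f h : RR -> R) (M : R) :
  measurable_fun (setT : set RR) h -> (forall z, `|h z| <= M) ->
  mu2.-integrable setT (EFin \o f) -> mu2.-integrable setT (EFin \o (h \* f)).
Proof.
move=> mh hM intf.
have mf : measurable_fun (setT : set RR) f by apply/measurable_EFinP; case/integrableP : intf.
apply: (@ae_le_integrable _ _ _ mu2 setT _ (fun z => M * `|f z|)) => //.
- exact: measurable_funM.
- by apply: integrable_EFinZ => //; exact: integrable_EFin_norm.
- by apply: ae_true => z _ /=; rewrite normrM ler_wpM2r.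
Qed.

Lemma locally_integrableM (h f : R -> R) : continuous h -> mu.-integrable setT (EFin \o f) ->
  locally_integrable setT (h \* f).
Proof.
move=> ch intf.
have mf : measurable_fun (setT : set mR) f by apply/measurable_EFinP; case/integrableP : intf.
split; [|exact: openT|].
  by apply: measurable_funM => //; exact: continuous_measurable_fun.
move=> K _ cK.
have mK : measurable (K : set mR) by exact: compact_measurable.
have [M0 [_ HM]] := compact_bounded (continuous_compact (continuous_subspaceT ch) cK).
have : mu.-integrable K (EFin \o (h \* f)).
  apply: (@integrableM_bound _ _ _ _ (M0 + 1)) => //.
  - by apply: measurable_funTS; exact: continuous_measurable_fun.
  - by move=> x Kx; apply: (HM (M0 + 1)); [rewrite ltrDl|exists x].
  - exact: integrableS intf.
by case/integrableP.
Qed.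

Variables (Tbar T : R) (u ux uxx : R -> R -> R) (C : R) (M : R -> R).
Hypotheses (T0 : 0 < T) (TT : T < Tbar) (C0 : 0 <= C).
Hypothesis HC : C_W1oo_loc Tbar u ux.
Hypothesis Hweak : forall psi : R * R -> R, spacetime_test Tbar psi ->
  exists dx_psi_u : R -> R -> R,
    spacetime_dx 1 `[0, Tbar[ (fun t x => psi (t, x) * u t x) dx_psi_u /\
    \int[mu]_x (u 0 x * psi (0, x)) +
    \int[mu2]_(p in `[0, Tbar[ `*` setT)
      (u p.1 p.2 * dt psi p - 2^-1 * (dx_psi_u p.1 p.2 * ux p.1 p.2)) = 0.
Hypothesis Hxx : spacetime_dx 2 `[0, T] u uxx.
Hypothesis uC : {ae mu, forall t, `[0, T]%classic t ->
  {ae mu, forall x, `|u t x| <= C * (1 + x ^+ 2)}}.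
Hypothesis iM : mu.-integrable setT (EFin \o M).
Hypothesis M0 : forall t, 0 <= M t.
Hypothesis uxxM : {ae mu, forall t, `[0, T]%classic t ->
  {ae mu, forall x, `|uxx t x| <= M t}}.

(* Extending the right-hand side by zero lets time integrals start at -1, so that
   the test functions are constant in time near t = 0 and the initial datum
   appears as the value of the (clamped) solution at negative times. *)
Definition source t x : R := if 0 <= t <= T then 2^-1 * (u t x * uxx t x) else 0.

Lemma source_measurable : measurable_fun (setT : set RR) (fun p : RR => source p.1 p.2).
Proof.
have mI : measurable (`[0, T]%classic : set mR) by exact: measurable_itv.
have mD : measurable (`[0, T]%classic `*` setT : set RR) by exact: measurableX.
have mu1 : measurable_fun (`[0, T]%classic `*` setT : set RR) (fun p : RR => u p.1 p.2).
  have [mu1 _ _ _] := HC; apply: measurable_funS mu1.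
    by apply: measurableX => //; exact: measurable_itv.
  move=> [t x] /= [+ _]; rewrite !in_itv/= => /andP[-> tT]; split => //.
  exact: le_lt_trans TT.
have [muxx _] := Hxx.
have := measurable_patch mD (measurable_funM mu1 muxx).
move/(measurable_funM (@measurable_cst _ _ _ _ setT (2^-1 : R))).
congr measurable_fun; apply/funext => -[t x] /=; rewrite patchE /source.
have -> : ((t, x) \in `[0, T]%classic `*` (setT : set mR)) = (0 <= t <= T).
  apply/idP/idP => [/set_mem[]|tT]; first by rewrite /= in_itv.
  by apply/mem_set; split => //=; rewrite in_itv.
by case: ifP => _ //; rewrite mulr0.
Qed.

Lemma source_bound : {ae mu, forall t, {ae mu, forall x,
  `|source t x| <= (2^-1 * C * M t) * (1 + x ^+ 2)}}.
Proof.
apply: ae_imp2 uC uxxM => t Hu Hx; rewrite /source.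
have [tT|/negbTE tT] := boolP (0 <= t <= T); last first.
  by apply: ae_true => x; rewrite normr0 !mulr_ge0// ltW// q_gt0.
have tI : `[0, T]%classic t by rewrite /= in_itv.
apply: ae_imp2 (Hu tI) (Hx tI) => x h1 h2.
rewrite normrM ger0_norm ?invr_ge0// -!mulrA ler_wpM2l ?invr_ge0// normrM.
have -> : C * (M t * (1 + x ^+ 2)) = (C * (1 + x ^+ 2)) * M t by ring.
exact: ler_pM.
Qed.

Lemma source_integrable : mu2.-integrable setT (EFin \o (fun p : RR => source p.1 p.2 * wt p.2)).
Proof.
have mf : measurable_fun (setT : set RR) (fun p : RR => source p.1 p.2 * wt p.2).
  apply: measurable_funM; first exact: source_measurable.
  by apply: measurableT_comp => //; apply: continuous_measurable_fun; exact: continuous_wt.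
apply: (@ae_le_integrable_prod _ _ _ _ _ mu mu _ (fun t => (2^-1 * C * \int[mu]_x rq x) * M t)) => //.
  exact: integrable_EFinZ.
apply: ae_imp source_bound => t Ht.
have -> : 2^-1 * C * (\int[mu]_x rq x) * M t = 2^-1 * C * M t * \int[mu]_x rq x by ring.
apply: ae_integral_le => //; first exact: (measurable_slice (f := fun p : RR => source p.1 p.2 * wt p.2)).
  exact: integrable_rq.
apply: ae_imp Ht => x h _ /=; rewrite normrM (gtr0_norm (wt_gt0 x)).
apply: (@le_trans _ _ (2^-1 * C * M t * (1 + x ^+ 2) * wt x)).
  by rewrite ler_wpM2r// ltW// wt_gt0.
rewrite -mulrA ler_wpM2l ?mulr_ge0//.
have -> : (1 + x ^+ 2) * wt x = (rq x * (1 + x ^+ 2)) * (rq x * rq x * rq x) by rewrite /wt; ring.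
rewrite rq_mul mul1r ler_piMl ?(ltW (rq_gt0 x))//.
by rewrite mulr_ile1 ?rq_le1 ?(ltW (rq_gt0 x)).
Qed.

(** The function [phi / wt] is bounded, having compact support, which reduces the claim to the
    weighted source. *)
Lemma source_test_integrable (phi : R -> R) : test_function setT phi ->
  mu2.-integrable setT (EFin \o (fun p : RR => phi p.2 * source p.1 p.2)).
Proof.
move=> tphi; have [r r0 Hr] := test_function_support tphi.
have cphi := smooth_continuous tphi.1.
have cq : continuous (fun x => phi x / wt x).
  move=> x; apply: cvgM; first exact: cphi.
  by apply: cvgV; [rewrite gt_eqF// wt_gt0|exact: continuous_wt].
have [B HB] := continuous_itv_bounded (- r) r cq.
have B0 : 0 <= B by apply: le_trans (HB 0 _); rewrite //= in_itv/= oppr_le0 (ltW r0).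
have -> : (fun p : RR => phi p.2 * source p.1 p.2) =
    (fun p : RR => phi p.2 / wt p.2) \* (fun p : RR => source p.1 p.2 * wt p.2).
  by apply/funext => p /=; rewrite mulrACA mulVf ?mulr1// gt_eqF// wt_gt0.
apply: (@integrableM_bound_prod _ _ B).
- by apply: (measurableT_comp (f := fun x => phi x / wt x)) => //; exact: continuous_measurable_fun.
- move=> [t x] /=; have [xr|xr] := leP `|x| r.
    by apply: HB; rewrite /= in_itv/= -ler_norml.
  by have [-> _] := Hr _ (ltW xr); rewrite mul0r normr0.
- exact: source_integrable.
Qed.

Lemma weak_derivative_zero (g : R -> R) : weak_derivative 1 (fun=> 0) g ->
  {ae mu, forall x, g x = 0}.
Proof.
move=> wd; have [F HF F0] := weak_derivative_primitive wd.
have FE : (fun=> 0) = F.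
  apply: continuous_ae_eq; [by move=> x; exact: cvg_cst|exact: primitive_continuous HF|].
  exact: F0.
by rewrite -FE in HF; apply: (primitive_unique HF); exact: primitive_cst.
Qed.

Lemma smooth_step_diff (a b e : R) : smooth (fun t => step a e t - step b e t).
Proof.
move=> k; rewrite (_ : (fun x => _) = step a e \+ (fun x => (-1) * step b e x)).
  by apply: Ck_add; [|apply: Ck_scale]; exact: smooth_step.
by apply/funext => x /=; rewrite mulN1r.
Qed.

Lemma step_diff_out (t0 e t : R) : 0 < t0 -> 0 < e -> e < 1 ->
  ~ `[-1, t0 + e]%classic t -> step (-1) e t - step t0 e t = 0.
Proof.
move=> t00 e0 e1 /negP; rewrite /= in_itv/= negb_and -!ltNge => /orP[xa|xb].
  by rewrite !step_le ?subrr ?ltW//; lra.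
by rewrite !step_ge ?subrr ?ltW//; lra.
Qed.

Section Pairing.
Variable phi : R -> R.
Hypothesis tphi : test_function setT phi.

Let F (t : R) : R := \int[mu]_x (phi x * u (clamp T t) x).
Let g (t : R) := \int[mu]_x (phi x * source t x).

Let cF : continuous F.
Proof. by apply: (C_W1oo_pairing_continuous _ HC) => //; rewrite T0. Qed.

Let ig : mu.-integrable setT (EFin \o g).
Proof. exact: (integrable_Rintegral1 (source_test_integrable tphi)). Qed.

Section OneTestFunction.
Variables (t0 e : R).
Hypotheses (t00 : 0 < t0) (e0 : 0 < e) (e1 : e < 1) (t0e : t0 + e <= T).

Local Ltac lra_section := have ? := T0; have ? := TT; have ? := t00; have ? := e0;
  have ? := e1; have ? := t0e; lra.

(** It rises during [[-1, -1 + e]], which is over before time 0, equals 1 up to [t0] and falls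
    during [[t0, t0 + e]]. At nonnegative times only the second transition is visible. *)
Let theta (t : R) : R := step (-1) e t - step t0 e t.

Let derive_theta (t : R) : derive1 theta t = mollifier (-1) e t - mollifier t0 e t.
Proof. exact: derive1_step_diff. Qed.

Let theta_out (t : R) : ~ `[-1, t0 + e]%classic t -> theta t = 0.
Proof. exact: step_diff_out. Qed.

Let theta_le1 (t : R) : `|theta t| <= 1.
Proof.
have h1 := sstep_ge0 (e^-1 * (t - (-1))); have h2 := sstep_le1 (e^-1 * (t - (-1))).
have h3 := sstep_ge0 (e^-1 * (t - t0)); have h4 := sstep_le1 (e^-1 * (t - t0)).
by rewrite /theta /step ler_norml; apply/andP; split; lra.
Qed.

Let mollifier_N1 (t : R) : 0 <= t -> mollifier (-1) e t = 0.
Proof. by move=> t_ge0; rewrite mollifier_out//; apply/orP; right; lra_section. Qed.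

Let theta0 : theta 0 = 1.
Proof. by rewrite /theta step_ge ?step_le ?subr0//; lra_section. Qed.

Let psi (p : R * R) := theta p.1 * phi p.2.

Let dt_psi p : dt psi p = derive1 theta p.1 * phi p.2.
Proof. by rewrite /psi dt_tensor//; [exact: smooth_step_diff|exact: tphi.1]. Qed.

Variable dx : R -> R -> R.
Hypothesis Hdx : spacetime_dx 1 `[0, Tbar[ (fun t x => psi (t, x) * u t x) dx.

Let I (p : RR) := u p.1 p.2 * dt psi p - 2^-1 * (dx p.1 p.2 * ux p.1 p.2).
Let D : set RR := `[0, Tbar[%classic `*` setT.

Let mD : measurable D.
Proof. by apply: measurableX => //; exact: measurable_itv. Qed.

Let mI : measurable_fun setT (I \_ D).
Proof.
apply: measurable_patch => //.
have [mu1 mux _ _] := HC; have [mdx _] := Hdx.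
apply: measurable_funB.
  apply: measurable_funM => //; apply: measurable_funTS.
  rewrite (_ : dt psi = fun p => derive1 theta p.1 * phi p.2); last exact/funext.
  apply: measurable_funM.
    apply: (measurableT_comp (f := derive1 theta)) => //.
    by apply: continuous_measurable_fun; apply: smooth_continuous; apply: smooth_derive1; exact: smooth_step_diff.
  apply: (measurableT_comp (f := phi)) => //.
  by apply: continuous_measurable_fun; apply: smooth_continuous; exact: tphi.1.
by apply: measurable_funM => //; exact: measurable_funM.
Qed.

Let slice : {ae mu, forall t, [/\
  0 <= t < Tbar -> weak_derivative 1 (fun x => psi (t, x) * u t x) (dx t),
  0 <= t <= T -> weak_derivative 2 (u t) (uxx t) &
  0 <= t <= T -> {ae mu, forall x, `|u t x| <= C * (1 + x ^+ 2)}]}.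
Proof.
have [_ h1] := Hdx; have [_ h2] := Hxx.
have h12 : {ae mu, forall t, (0 <= t < Tbar -> weak_derivative 1 (fun x => psi (t, x) * u t x) (dx t)) /\
  (0 <= t <= T -> weak_derivative 2 (u t) (uxx t))}.
  apply: ae_imp2 h1 h2 => t h1 h2; split => ht; [apply: h1|apply: h2];
    by rewrite /= in_itv.
by apply: ae_imp2 h12 uC => t [h3 h4] h5; split => // ht; apply: h5; rewrite /= in_itv.
Qed.

Let ID (t x : R) : (I \_ D) (t, x) = if 0 <= t < Tbar then I (t, x) else 0.
Proof.
rewrite patchE; have -> : ((t, x) \in D) = (0 <= t < Tbar); last by [].
apply/idP/idP => [/set_mem[]|tT]; first by rewrite /= in_itv.
by apply/mem_set; split => //=; rewrite in_itv.
Qed.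

(** Bounds on [uxx] stop at [T], but beyond it [psi] is zero, and the witness [dx t] is a weak
    derivative of zero. *)
Let slice_dx_late (t : R) : T < t -> 0 <= t < Tbar ->
  weak_derivative 1 (fun x => psi (t, x) * u t x) (dx t) ->
  {ae mu, forall x, I (t, x) = 0}.
Proof.
move=> Tt tI wd.
have th0 : theta t = 0 by apply: theta_out; rewrite /= in_itv/= => /andP[_]; lra_section.
have thd0 : derive1 theta t = 0.
  by rewrite derive_theta !mollifier_out ?subrr//; apply/orP; right; lra_section.
have : {ae mu, forall x, dx t x = 0}.
  apply: weak_derivative_zero; move: wd; congr weak_derivative.
  by apply/funext => x; rewrite /psi/= th0 !mul0r.
by apply: ae_imp => x h; rewrite /I/= dt_psi/= thd0 h; ring.
Qed.

(** The place where the equation takes the form [u uxx / 2]; the factor -2 compensates the one half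
    in [source] and the sign of the integration by parts. *)
Let slice_dx (t : R) : 0 <= t <= T ->
  weak_derivative 1 (fun x => psi (t, x) * u t x) (dx t) ->
  weak_derivative 2 (u t) (uxx t) ->
  {ae mu, forall x, dx t x = theta t * (phi x * ux t x + u t x * derive1 phi x)} /\
  \int[mu]_x (dx t x * ux t x) = - 2 * (theta t * g t).
Proof.
move=> tT wd wd2.
have tI : t \in `[0, Tbar[ by rewrite in_itv/=; apply/andP; split; lra_section.
have [_ _ /(_ _ tI)[_ [mux _] wd1] _] := HC.
have [U [G [HU HG uU uxG]]] := weak_derivative2_primitive wd1 wd2.
have tphit : test_function setT (fun x => theta t * phi x) by exact: test_functionZ.
have dphit : derive1 (fun x => theta t * phi x) = (fun x => theta t * derive1 phi x).
  apply/funext => x; rewrite !derive1E.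
  have := deriveZ (theta t) (ex_derive (f := phi) (is_derive := smooth_is_derive x tphi.1)).
  exact.
split.
  have h := weak_derivativeM tphit HU uU wd.
  have h' : {ae mu, forall x, dx t x = theta t * phi x * ux t x + U x * (theta t * derive1 phi x)}.
    by apply: ae_imp2 h uxG => x; rewrite dphit => -> ->.
  by apply: ae_imp2 h' uU => x -> ->; ring.
rewrite (weak_derivativeM_by_parts tphit HU HG uU uxG wd)//.
have [r r0 Hr] := test_function_support tphi.
have cphi := smooth_continuous tphi.1; have cU := primitive_continuous HU.
have mphi : measurable_fun (setT : set mR) phi by exact: continuous_measurable_fun.
have mU := primitive_measurable HU; have muxx : measurable_fun (setT : set mR) (uxx t) by case: HG.
have mh : measurable_fun (setT : set mR) (fun x => phi x * (U x * uxx t x)).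
  by apply: measurable_funM => //; exact: measurable_funM.
have ih : mu.-integrable setT (EFin \o (fun x => phi x * (U x * uxx t x))).
  apply: (@integrable_support _ `[- r, r]%classic) => //.
    by move=> x /negP; rewrite /= in_itv/= -ler_norml -ltNge => /ltW/Hr[-> _]; rewrite mul0r.
  have := @primitive_integrableM _ _ _ (phi \* U) (- r) r HG.
  move=> /(_ (fun x => cvgM (cphi x) (cU x))).
  by congr (_.-integrable _ _); apply/funext => x /=; rewrite mulrA.
have -> : g t = 2^-1 * \int[mu]_x (phi x * (U x * uxx t x)).
  rewrite -RintegralZl//; apply: ae_eq_Rintegral => //.
  - apply: measurable_funM => //.
    exact: (measurable_slice (f := fun p : RR => source p.1 p.2) t source_measurable).
  - exact: measurable_funM.
  - by apply: ae_imp uU => x h _; rewrite /source tT h; ring.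
have -> : \int[mu]_x (theta t * phi x * (U x * uxx t x)) = theta t * \int[mu]_x (phi x * (U x * uxx t x)).
  by rewrite -RintegralZl//; apply: eq_Rintegral => x _; ring.
by field.
Qed.

(** Majorants for Fubini's theorem, uniform in [t] by compactness of [[0, T]]; they may depend on
    [e]. All functions live on the support of [phi], and [rq] merely serves as an integrable
    majorant on the line. *)
Let slice_bound : exists2 B : R, 0 <= B & forall t : R, 0 <= t <= T ->
  {ae mu, forall x, dx t x = theta t * (phi x * ux t x + u t x * derive1 phi x)} ->
  {ae mu, forall x, `|u t x| <= C * (1 + x ^+ 2)} ->
  {ae mu, forall x, `|u t x * dt psi (t, x)| <= B * rq x /\ `|dx t x * ux t x| <= B * rq x}.
Proof.
have [r r0 Hr] := test_function_support tphi.
have [B1 HB1] := continuous_itv_bounded (- r) r (smooth_continuous tphi.1).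
have [B2 HB2] := continuous_itv_bounded (- r) r (smooth_continuous (smooth_derive1 tphi.1)).
have [B3 B30 HB3] := @sstep_derive_bounded R.
have [K K0 HK] : exists2 K : R, 0 <= K & forall t : R, 0 <= t <= T ->
    {ae mu, forall x, `[- r, r]%classic x -> `|ux t x| <= K}.
  by apply: (C_W1oo_bounded _ _ HC); rewrite T0.
pose Q := 1 + r ^+ 2.
have Q0 : 0 <= Q by rewrite /Q addr_ge0// sqr_ge0.
have zr : `[- r, r]%classic 0 by rewrite /= in_itv/= oppr_le0 (ltW r0).
have B10 : 0 <= B1 by apply: le_trans (HB1 _ zr).
have B20 : 0 <= B2 by apply: le_trans (HB2 _ zr).
have B3e : 0 <= B3 / e by rewrite divr_ge0// ltW.
(* On the support, where [1 + x^2 <= Q], [A1] bounds [u * dt psi] and [A2] bounds [dx * ux]. *)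
pose A1 := C * Q * ((B3 / e + B3 / e) * B1).
pose A2 := (B1 * K + C * Q * B2) * K.
have A10 : 0 <= A1 by rewrite /A1 !mulr_ge0// addr_ge0.
have A20 : 0 <= A2 by rewrite /A2 mulr_ge0// addr_ge0// ?mulr_ge0.
exists ((A1 + A2) * Q); first by rewrite mulr_ge0// addr_ge0.
move=> t tT hdx hu.
have hdu : {ae mu, forall x, dx t x = theta t * (phi x * ux t x + u t x * derive1 phi x) /\
    `|u t x| <= C * (1 + x ^+ 2)} by apply: ae_imp2 hdx hu => x h1 h2; split.
apply: ae_imp2 (HK t tT) hdu => x hK [hdx' hu'].
have [xr|xr] := leP `|x| r; last first.
  have [p0 p'0] := Hr _ (ltW xr).
  rewrite dt_psi/= hdx' p0 p'0 !(mulr0, mul0r, addr0, normr0).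
  by split; rewrite mulr_ge0 ?(ltW (rq_gt0 x))// mulr_ge0// addr_ge0.
have xI : `[- r, r]%classic x by rewrite /= in_itv/= -ler_norml.
have Qx : 1 + x ^+ 2 <= Q.
  by rewrite lerD2l -[x ^+ 2]real_normK ?num_real// lerXn2r// nnegrE// ltW.
have Q1 : 1 <= Q * rq x by rewrite /rq ler_pdivlMr ?q_gt0// mul1r.
have ur : `|u t x| <= C * Q by apply: le_trans hu' _; rewrite ler_wpM2l.
have pr := HB1 x xI; have p'r := HB2 x xI; have kr := hK xI.
have b1 : `|u t x * dt psi (t, x)| <= A1.
  rewrite dt_psi/= derive_theta !normrM ler_pM// ler_pM//.
  by apply: le_trans (ler_normB _ _) _; rewrite lerD// HB3.
have b2 : `|dx t x * ux t x| <= A2.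
  rewrite hdx' !normrM ler_pM//.
  apply: (@le_trans _ _ (1 * (B1 * K + C * Q * B2))); last by rewrite mul1r.
  rewrite ler_pM// ?theta_le1//.
  by apply: le_trans (ler_normD _ _) _; rewrite !normrM lerD// ler_pM.
have AQ (a : R) : 0 <= a -> a <= A1 + A2 -> a <= (A1 + A2) * Q * rq x.
  move=> a0 aA; apply: le_trans aA _; rewrite -mulrA ler_peMr// addr_ge0//.
split; apply: AQ => //; first by apply: le_trans b1 _; rewrite lerDl.
by apply: le_trans b2 _; rewrite lerDr.
Qed.

(** On [[0, T]] the derivative of [theta] is [- mollifier t0 e]; at all other times both sides
    vanish. *)
Let slice_integral : {ae mu, forall t : R,
  \int[mu]_x (I \_ D) (t, x) = - (mollifier t0 e t * F t) + theta t * g t}.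
Proof.
have [B B0 HB] := slice_bound.
apply: ae_imp slice => t [wd wd2 hu].
have [tT|tT] := boolP (0 <= t <= T); last first.
  have -> : mollifier t0 e t = 0.
    rewrite mollifier_out//; move: tT; rewrite negb_and -!ltNge => /orP[h|h].
      by apply/orP; left; lra_section.
    by apply/orP; right; lra_section.
  have -> : g t = 0.
    rewrite /g; under eq_Rintegral do rewrite /source (negbTE tT) mulr0.
    by rewrite Rintegral_cst// mul0r.
  rewrite mul0r mulr0 addr0 oppr0.
  apply: ae_Rintegral0 => //; first exact: measurable_slice.
  have [tTb|tTb] := boolP (0 <= t < Tbar); last first.
    by apply: ae_true => x _; rewrite ID (negbTE tTb).
  have Tt : T < t.
    by move: tTb tT => /andP[t_ge0 _]; rewrite negb_and t_ge0/= -ltNge.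
  by apply: ae_imp (slice_dx_late Tt tTb (wd tTb)) => x h _; rewrite ID tTb.
have tTb : 0 <= t < Tbar by apply/andP; split; lra_section.
have [hdx hint] := slice_dx tT (wd tTb) (wd2 tT).
have hb := HB t tT hdx (hu tT).
have tI : t \in `[0, Tbar[ by rewrite in_itv.
have [_ _ /(_ _ tI)[_ [mux _] [lu _ _]] _] := HC.
have [mdx _ _] : locally_integrable setT (dx t) by have [_ + _] := wd tTb.
have irq := @integrable_rq R.
have i1 : mu.-integrable setT (EFin \o (fun x => u t x * dt psi (t, x))).
  have := integrable_EFinZ (derive1 theta t) measurableT (test_integrable lu tphi).
  by congr (_.-integrable _ _); apply/funext => x /=; rewrite dt_psi/=; congr EFin; ring.
have i2 : mu.-integrable setT (EFin \o (fun x => dx t x * ux t x)).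
  apply: (@ae_le_integrable _ _ _ mu setT _ (fun x => B * rq x)) => //.
  - exact: measurable_funM.
  - exact: integrable_EFinZ.
  - by apply: ae_imp hb => x [].
under eq_Rintegral do rewrite ID tTb /I.
rewrite RintegralB//; last exact: integrable_EFinZ.
rewrite RintegralZl// hint.
have -> : \int[mu]_x (u t x * dt psi (t, x)) = - mollifier t0 e t * F t.
  rewrite /F clamp_id// -RintegralZl//; last exact: test_integrable.
  apply: eq_Rintegral => x _; rewrite dt_psi/= derive_theta mollifier_N1 ?sub0r; last by case/andP: tT.
  by ring.
by field.
Qed.

Let integrable_I : mu2.-integrable setT (EFin \o (I \_ D)).
Proof.
have [B B0 HB] := slice_bound.
have irq := @integrable_rq R.
have J0 : 0 <= \int[mu]_x rq x by apply: Rintegral_ge0 => x _; rewrite ltW// rq_gt0.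
(* The factor [(1 + T^2) * rq t] is at least 1 on [[0, T]] and integrable over the line. *)
apply: (@ae_le_integrable_prod _ _ _ _ _ mu mu _
  (fun t => (2 * B * \int[mu]_x rq x * (1 + T ^+ 2)) * rq t)) => //.
  exact: integrable_EFinZ.
apply: ae_imp slice => t [wd wd2 hu].
apply: (@le_trans _ _ ((2 * B * (1 + T ^+ 2) * rq t) * \int[mu]_x rq x)%:E); last first.
  by rewrite lee_fin le_eqVlt; apply/orP; left; apply/eqP; ring.
apply: ae_integral_le => //; first exact: measurable_slice.
have triv x : 0 <= 2 * B * (1 + T ^+ 2) * rq t * rq x.
  by rewrite !mulr_ge0 ?(ltW (rq_gt0 _))// addr_ge0 ?sqr_ge0.
have [tT|tT] := boolP (0 <= t <= T); last first.
  have [tTb|tTb] := boolP (0 <= t < Tbar); last first.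
    by apply: ae_true => x _; rewrite ID (negbTE tTb) normr0.
  have Tt : T < t.
    by move: tTb tT => /andP[t_ge0 _]; rewrite negb_and t_ge0/= -ltNge.
  by apply: ae_imp (slice_dx_late Tt tTb (wd tTb)) => x h _; rewrite ID tTb h normr0.
have tTb : 0 <= t < Tbar by apply/andP; split; lra_section.
have [hdx hint] := slice_dx tT (wd tTb) (wd2 tT).
apply: ae_imp (HB t tT hdx (hu tT)) => x [h1 h2] _; rewrite ID tTb /I.
have Q1 : 1 <= (1 + T ^+ 2) * rq t.
  rewrite /rq ler_pdivlMr ?q_gt0// mul1r lerD2l lerXn2r// ?nnegrE ?(ltW T0)//; by case/andP: tT.
apply: (@le_trans _ _ (2 * (B * rq x))).
  apply: le_trans (ler_normB _ _) _ => /=.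
  have -> : `|2^-1 * (dx t x * ux t x)| = 2^-1 * `|dx t x * ux t x|.
    by rewrite [LHS]normrM ger0_norm// invr_ge0.
  have : 0 <= `|dx t x * ux t x| by []. lra.
have -> : 2 * B * (1 + T ^+ 2) * rq t * rq x = ((1 + T ^+ 2) * rq t) * (2 * (B * rq x)) by ring.
by rewrite ler_peMl// mulr_ge0// mulr_ge0// ltW// rq_gt0.
Qed.

Lemma one_test_identity :
  \int[mu]_x (u 0 x * psi (0, x)) +
    \int[mu2]_(p in `[0, Tbar[ `*` setT)
      (u p.1 p.2 * dt psi p - 2^-1 * (dx p.1 p.2 * ux p.1 p.2)) = 0 ->
  F 0 - \int[mu]_t (mollifier t0 e t * F t) + \int[mu]_t (theta t * g t) = 0.
Proof.
have iF : mu.-integrable setT (EFin \o (fun t => mollifier t0 e t * F t)).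
  by apply: mollifier_integrable => //; exact: continuous_itv_integrable.
have itg : mu.-integrable setT (EFin \o (fun t => theta t * g t)).
  apply: (@integrableM_bound _ _ _ _ 1) => //.
  by apply: continuous_measurable_fun; apply: smooth_continuous; exact: smooth_step_diff.
move=> E; rewrite -[RHS]E -addrA; congr (_ + _).
  rewrite /F clamp_id ?lexx ?(ltW T0)//; apply: eq_Rintegral => x _.
  by rewrite /psi/= theta0 mul1r mulrC.
rewrite [RHS]Rintegral_mkcond -(Rintegral12 integrable_I).
have -> : \int[mu]_t \int[mu]_x (I \_ D) (t, x) =
    \int[mu]_t (- (mollifier t0 e t * F t) + theta t * g t).
  apply: ae_eq_Rintegral => //.
  - by have /integrableP[/measurable_EFinP] := integrable_Rintegral1 integrable_I.
  - apply: measurable_funD; last by have /integrableP[/measurable_EFinP] := itg.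
    by apply: measurableT_comp => //; have /integrableP[/measurable_EFinP] := iF.
  - by apply: ae_imp slice_integral => t ->.
under [RHS]eq_Rintegral do rewrite addrC.
by rewrite RintegralB// addrC.
Qed.

End OneTestFunction.

(** The preceding identity says that [F' = g] weakly. As [F] is continuous, every point is a
    Lebesgue point and increments are recovered at all times. *)
Lemma pairing_increment (t0 : R) : 0 < t0 < T ->
  F t0 - F 0 = \int[mu]_(t in `[-1, t0]) g t.
Proof.
move=> /andP[t00 t0T].
(* This choice forces [e < 1], so that the first transition ends before time 0, and
   [t0 + e <= T]. *)
pose d : R := Num.min (2^-1) (T - t0).
have d0 : 0 < d by rewrite lt_min invr_gt0 subr_gt0 t0T ltr0n.
have mg : measurable_fun (setT : set mR) g by have /integrableP[/measurable_EFinP] := ig.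
have mI a b : measurable (`[a, b]%classic : set mR) by exact: measurable_itv.
have [G HG _] := primitive_exists 0 0 mg
  (fun a b => integrableS (measurableT : measurable (setT : set mR)) (mI a b) (@subsetT _ _) ig).
have N1t0 : -1 < t0 by lra.
have Fpt t : lebesgue_pt F t.
  apply: (@continuous_lebesgue_pt _ _ _ setT) => //; [by split => //; exact: openT| |exact: cF].
  exact: continuous_measurable_fun.
have F1 t : t <= 0 -> F t = F 0 by move=> t_le0; rewrite /F !clamp_le0// ltW.
rewrite -(F1 (-1)) ?lerN10//.
have [_ _ <-] := HG; last exact: ltW.
apply: (lebesgue_pt_increment (f := F) _ HG N1t0 d0) => //.
- exact: continuous_measurable_fun.
- exact: continuous_itv_integrable.
move=> e /andP[e0]; rewrite le_min => /andP[e2 eT].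
have e1 : e < 1 by lra.
have t0e : t0 + e <= T by lra.
have [dx [Hdx E]] := Hweak (spacetime_test_tensor (smooth_step_diff (-1) t0 e)
   (le_lt_trans t0e TT) (fun t => step_diff_out (t := t) t00 e0 e1) tphi).
have {}E := one_test_identity t00 e0 e1 t0e Hdx E.
have iF a : mu.-integrable setT (EFin \o (fun t => mollifier a e t * F t)).
  by apply: mollifier_integrable => //; exact: continuous_itv_integrable.
(* The mollifier at -1 is supported in negative times, where [F] is constantly [F 0]. *)
have FN1 : \int[mu]_t (mollifier (-1) e t * F t) = F 0.
  have -> : \int[mu]_t (mollifier (-1) e t * F t) = \int[mu]_t (F 0 * mollifier (-1) e t).
    apply: eq_Rintegral => t _; have [t0_le|/ltW/F1 ->] := leP 0 t; last by rewrite mulrC.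
    by rewrite mollifier_out ?mulr0 ?mul0r//; apply/orP; right; lra.
  rewrite RintegralZl// ?Rintegral_mollifier ?mulr1//.
  have i1 : mu.-integrable `[-1, -1 + e] (EFin \o cst (1 : R)).
    by apply: continuous_itv_integrable => x; exact: cvg_cst.
  have := mollifier_integrable e0 i1.
  by congr (_.-integrable _ _); apply/funext => x /=; rewrite mulr1.
have -> : \int[mu]_t (F t * (mollifier (-1) e t - mollifier t0 e t)) =
    \int[mu]_t (mollifier (-1) e t * F t) - \int[mu]_t (mollifier t0 e t * F t).
  by rewrite -RintegralB//; apply: eq_Rintegral => t _ /=; ring.
rewrite FN1; apply/eqP; rewrite -addr_eq0; apply/eqP; rewrite -[RHS]E; congr (_ + _).
by apply: eq_Rintegral => t _; rewrite mulrC.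
Qed.

End Pairing.

(** The du Bois-Reymond lemma removes the test function in [x]. The time integral is formed with the
    weight and divided by it afterwards, because it is the weighted source that is integrable in
    both variables. *)
Lemma source_increment (t : R) : 0 < t < T ->
  {ae mu, forall x, u t x - u 0 x = \int[mu]_(s in `[-1, t]) source s x}.
Proof.
move=> /andP[t0 tT].
have I0 : 0 \in `[0, Tbar[ by rewrite in_itv/= lexx (lt_trans T0).
have It : t \in `[0, Tbar[ by rewrite in_itv/= ltW//= (lt_trans tT).
have [_ _ HL _] := HC.
have [_ _ [lu0 _ _]] := HL _ I0; have [_ _ [lut _ _]] := HL _ It.
pose J : set mR := `[-1, t]%classic.
have mJ : measurable J by exact: measurable_itv.
have mJT : measurable (J `*` setT : set RR) by exact: measurableX.
have JE s x : ((s, x) \in J `*` (setT : set mR)) = (s \in J).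
  by apply/idP/idP => [/set_mem[]|/set_mem sJ]; [move=> /= ? _; exact/mem_set|exact/mem_set].
pose f : RR -> R := (fun p : RR => source p.1 p.2 * wt p.2) \_ (J `*` setT).
have intf : mu2.-integrable setT (EFin \o f).
  by apply: integrable_patch => //; exact: integrableS source_integrable.
pose S x := \int[mu]_s f (s, x).
have iS : mu.-integrable setT (EFin \o S) := integrable_Rintegral2 intf.
have wtN0 x : wt x != 0 by rewrite gt_eqF// wt_gt0.
have cq : continuous (fun x => (wt x)^-1).
  by move=> x; apply: cvgV; [exact: wtN0|exact: continuous_wt].
have lS : locally_integrable setT ((fun x => (wt x)^-1) \* S) by exact: locally_integrableM.
pose D := (u t \- u 0) \- ((fun x => (wt x)^-1) \* S).
have lD : locally_integrable setT D.
  by apply: locally_integrableB => //; exact: locally_integrableB.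
have D0 : {ae mu, forall x, D x = 0}.
  apply: dubois_reymond => // phi tphi.
  pose gf : RR -> R := (fun p : RR => phi p.2 * source p.1 p.2) \_ (J `*` setT).
  have intg : mu2.-integrable setT (EFin \o gf).
    by apply: integrable_patch => //; apply: integrableS (source_test_integrable tphi).
  have ES : \int[mu]_x (phi x * ((wt x)^-1 * S x)) = \int[mu]_(s in J) \int[mu]_x (phi x * source s x).
    transitivity (\int[mu]_x \int[mu]_s gf (s, x)).
      apply: ae_eq_Rintegral => //.
      - by have [] := test_integrable lS tphi => /integrableP[/measurable_EFinP].
      - by have /integrableP[/measurable_EFinP] := integrable_Rintegral2 intg.
      - apply: ae_imp (ae_integrable2 intf) => x ifx _.
        rewrite mulrA -RintegralZl//; apply: eq_Rintegral => s _.
        rewrite /f /gf !patchE JE; case: ifP => _ /=; last by rewrite mulr0.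
        by field; exact: wtN0.
    rewrite (Rintegral21 intg) -(Rintegral12 intg) [RHS]Rintegral_mkcond.
    apply: eq_Rintegral => s _; rewrite patchE.
    case: ifPn => sJ; first by apply: eq_Rintegral => x _; rewrite /gf patchE JE sJ.
    rewrite -[RHS](_ : \int[mu]_x (cst (0 : R) x) = 0); last by rewrite Rintegral_cst// mul0r.
    by apply: eq_Rintegral => x _; rewrite /gf patchE JE (negbTE sJ).
  have t0T : 0 < t < T by rewrite t0.
  have := pairing_increment tphi t0T.
  have [ct c0] : clamp T t = t /\ clamp T 0 = 0.
    by split; apply: clamp_id; rewrite ?lexx ?(ltW T0)// (ltW t0) (ltW tT).
  rewrite ct c0 -ES => E.
  transitivity (\int[mu]_x (phi x * u t x) - \int[mu]_x (phi x * u 0 x) -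
    \int[mu]_x (phi x * ((wt x)^-1 * S x))); last by rewrite E subrr.
  rewrite -RintegralB ?test_integrable// -RintegralB ?test_integrable//; last first.
    by apply: integrable_EFinB => //; exact: test_integrable.
  by apply: eq_Rintegral => x _; rewrite /D /=; ring.
apply: ae_imp2 D0 (ae_integrable2 intf) => x Dx ifx.
have {Dx}-> : u t x - u 0 x = (wt x)^-1 * S x by apply/eqP; rewrite -subr_eq0; exact/eqP.
rewrite [RHS]Rintegral_mkcond -RintegralZl//; apply: eq_Rintegral => s _.
by rewrite /f !patchE JE; case: ifP => _ /=; [field; exact: wtN0|rewrite mulr0].
Qed.

End WeakFormulationInTime.

(** * Uniqueness *)

Section StrongSolutionData.
Context {R : realType}.
Local Notation mu := (@lebesgue_measure R).
Local Notation mR := (measurableTypeR R).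
Local Notation RR := (mR * mR)%type.
Local Notation mu2 := (mu \x mu)%E.
Implicit Types (t x : R).

Record strong_data (Tbar T : R) (u ux uxx : R -> R -> R) (C : R) (M : R -> R) : Prop :=
  StrongData {
  sd_T0 : 0 < T;
  sd_TT : T < Tbar;
  sd_C0 : 0 <= C;
  sd_C_W1oo : C_W1oo_loc Tbar u ux;
  sd_weak : forall psi : R * R -> R, spacetime_test Tbar psi ->
    exists dx_psi_u : R -> R -> R,
      spacetime_dx 1 `[0, Tbar[ (fun t x => psi (t, x) * u t x) dx_psi_u /\
      \int[mu]_x (u 0 x * psi (0, x)) +
      \int[mu2]_(p in `[0, Tbar[ `*` setT)
        (u p.1 p.2 * dt psi p - 2^-1 * (dx_psi_u p.1 p.2 * ux p.1 p.2)) = 0;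
  sd_u_ge0 : forall t, t \in `[0, Tbar[ -> {ae mu, forall x, 0 <= u t x};
  sd_uxx : spacetime_dx 2 `[0, T] u uxx;
  sd_uC : {ae mu, forall t, `[0, T]%classic t ->
    {ae mu, forall x, `|u t x| <= C * (1 + x ^+ 2)}};
  sd_iM : mu.-integrable setT (EFin \o M);
  sd_M0 : forall t, 0 <= M t;
  sd_uxxM : {ae mu, forall t, `[0, T]%classic t ->
    {ae mu, forall x, `|uxx t x| <= M t}} }.

Lemma strong_solution_data (Tbar T : R) (u : R -> R -> R) : 0 < T < Tbar ->
  strong_solution Tbar (u 0) u -> exists ux uxx C M, strong_data Tbar T u ux uxx C M.
Proof.
move=> TT [[ux [HC u0 Hweak]] /(_ T TT)[/bracket_Linf_ae[C C0 uC] [uxx [Hxx iN]]]].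
move: TT => /andP[T0 TT].
pose J : set mR := `[0, T]%classic.
have mJ : measurable J by exact: measurable_itv.
pose N t := Linf_norm setT (uxx t).
have N0 t : (0 <= N t)%E by exact: Linf_norm_ge0.
(* [fine] sends an infinite norm to 0; this happens on a null set of times only, as the norm is
   integrable. *)
pose M : mR -> R := (fine \o N) \_ J.
exists ux, uxx, C, M; split => //.
- apply: integrable_patch => //.
  have mN : measurable_fun J N by case/integrableP : iN.
  apply: (le_integrable _ _ _ iN) => //.
    by apply/measurable_EFinP; exact: measurableT_comp.
  move=> t _ /=; rewrite -/(N t) (gee0_abs (N0 t)) ger0_norm ?fine_ge0//.
  by case: (N t) (N0 t) => // _; rewrite leey.
- by move=> t; rewrite /M patchE; case: ifP => // _; rewrite fine_ge0.
- have := integrable_ae mJ iN; apply: ae_imp => t Nt Jt.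
  rewrite /M patchE mem_set//=.
  have Nfin : (N t < +oo)%E by rewrite ltey_eq; apply/orP; left; exact: Nt.
  by apply: ae_imp (Linf_norm_fin_ae Nfin) => x; exact.
Qed.

(** For the continuous representative the sign and the growth bound hold at every point, as the
    energy estimate requires. *)
Lemma strong_data_slice (Tbar T : R) (u ux uxx : R -> R -> R) (C : R) (M : R -> R) :
  strong_data Tbar T u ux uxx C M ->
  {ae mu, forall t, 0 <= t <= T -> exists U G, [/\ primitive U G, primitive G (uxx t),
    {ae mu, forall x, u t x = U x}, (forall x, 0 <= U x) &
    (forall x, `|U x| <= C * (1 + x ^+ 2))] /\ {ae mu, forall x, `|uxx t x| <= M t}}.
Proof.
move=> H; have [T0 TT C0 HC _ u0 [_ Hxx] uC _ _ uxxM] := H.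
have h : {ae mu, forall t, `[0, T]%classic t -> weak_derivative 2 (u t) (uxx t) /\
    {ae mu, forall x, `|u t x| <= C * (1 + x ^+ 2)}}.
  by apply: ae_imp2 Hxx uC => t h1 h2 tJ; split; [exact: h1|exact: h2].
apply: ae_imp2 h uxxM => t h1 h2 tT.
have tJ : `[0, T]%classic t by rewrite /= in_itv.
have [{}h1 uCt] := h1 tJ; have {}h2 := h2 tJ.
have tI : t \in `[0, Tbar[.
  by rewrite in_itv/=; case/andP: tT => -> /le_lt_trans ->.
have [_ _ /(_ _ tI)[_ _ wd1] _] := HC.
have [U [G [HU HG uU _]]] := weak_derivative2_primitive wd1 h1.
have cU := primitive_continuous HU.
exists U, G; split => //; split => //.
  apply: continuous_ae_ge0 => //.
  by apply: ae_imp2 (u0 t tI) uU => x + <-.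
move=> x; rewrite -subr_ge0; move: x; apply: continuous_ae_ge0.
  move=> x; apply: cvgB; last by apply: cvg_norm; exact: cU.
  apply: cvgM; first exact: cvg_cst.
  by apply: cvgD; [exact: cvg_cst|exact: exprn_continuous].
by apply: ae_imp2 uCt uU => x + <-; rewrite subr_ge0.
Qed.

End StrongSolutionData.

(** * Gronwall's inequality for absolutely continuous functions *)

Section Gronwall.
Context {R : realType}.
Local Notation mu := (@lebesgue_measure R).
Local Notation mR := (measurableTypeR R).
Implicit Types (E A Kp K : R -> R) (a b t : R).

Lemma primitiveX Kp K n : primitive Kp K ->
  primitive (fun t => Kp t ^+ n.+1) (fun t => n.+1%:R * (K t * Kp t ^+ n)).
Proof.
move=> HK; elim: n => [|n IH].
  by move: HK; congr primitive; apply/funext => t; rewrite ?expr1// expr0 mulr1 mul1r.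
have := primitiveM HK IH; congr primitive; apply/funext => t /=.
by rewrite -[n.+2]addn1 natrD !exprS; ring.
Qed.

Lemma exp_coeff_cvg0 (x : R) : exp_coeff x @ \oo --> 0.
Proof. exact/cvg_series_cvg_0/is_cvg_series_exp_coeff. Qed.

(** Iterating the integral inequality [n] times from a crude bound [B] gives [E <= B Kp^n / n!], and
    the terms of the exponential series tend to zero. *)
Lemma gronwall E A Kp K a b : primitive E A -> primitive Kp K -> a <= b ->
  E a = 0 -> Kp a = 0 -> (forall t, 0 <= K t) ->
  {ae mu, forall t, a <= t <= b -> A t <= K t * E t} -> E b <= 0.
Proof.
move=> HE HK ab Ea Ka K0 AK.
have cE := primitive_continuous HE; have cK := primitive_continuous HK.
have [B HB] := continuous_itv_bounded a b cE.
have [_ iA EA] := HE.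
have step n t : a <= t <= b -> n`!%:R * E t <= B * Kp t ^+ n.
  elim: n t => [|n IH] t /andP[at_ tb].
    rewrite fact0 mul1r expr0 mulr1; apply: le_trans (ler_norm _) _.
    by apply: HB; rewrite /= in_itv/= at_.
  have [_ iX EX] := primitiveX n HK.
  have -> : E t = \int[mu]_(s in `[a, t]) A s by rewrite -EA// Ea subr0.
  have -> : Kp t ^+ n.+1 = \int[mu]_(s in `[a, t]) (n.+1%:R * (K s * Kp s ^+ n)).
    by rewrite -EX// Ka expr0n subr0.
  rewrite -!RintegralZl//.
  apply: ae_le_Rintegral; [exact: measurable_itv| | |].
  - exact: integrable_EFinZ.
  - exact: integrable_EFinZ.
  - apply: ae_imp AK => s As; rewrite /= in_itv/= => /andP[as_ st].
    have sI : a <= s <= b by rewrite as_ (le_trans st).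
    rewrite factS natrM -mulrA [leRHS]mulrCA ler_wpM2l//.
    apply: (@le_trans _ _ (n`!%:R * (K s * E s))); first by rewrite ler_wpM2l// As.
    by rewrite mulrCA [leRHS]mulrCA ler_wpM2l// IH.
have lim0 : (B * exp_coeff (Kp b) n) @[n --> \oo] --> (B * 0).
  by apply: cvgM; [exact: cvg_cst|exact: exp_coeff_cvg0].
rewrite mulr0 in lim0.
apply: (@cvgr_to_ge _ _ _ _ _ _ (E b) lim0); near=> n.
rewrite /exp_coeff mulrA ler_pdivlMr ?ltr0n ?fact_gt0// mulrC; apply: step.
by rewrite ab lexx.
Unshelve. all: by end_near. Qed.

End Gronwall.

(** * Absolute continuity of the energy in time *)

Section DifferenceEnergy.
Context {R : realType}.
Local Notation mu := (@lebesgue_measure R).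
Local Notation mR := (measurableTypeR R).
Local Notation RR := (mR * mR)%type.
Local Notation mu2 := (mu \x mu)%E.
Implicit Types (s t x : R).

Lemma ae_integrable_wt (f : RR -> R) :
  mu2.-integrable setT (EFin \o (fun p : RR => f p * wt p.2)) ->
  {ae mu, forall x, mu.-integrable setT (EFin \o (fun s => f (s, x)))}.
Proof.
move/ae_integrable2; apply: ae_imp => x /(integrable_EFinZ (wt x)^-1 measurableT).
by congr (_.-integrable _ _); apply/funext => s /=; congr EFin; field; rewrite gt_eqF// wt_gt0.
Qed.

Variables (eta : R -> R -> R) (m K : R -> R) (B : R).

Definition time_integral t x : R := \int[mu]_(s in `[-1, t]) eta s x.
Let H := time_integral.

Hypothesis meta : measurable_fun (setT : set RR) (fun p : RR => eta p.1 p.2).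
Hypothesis im : mu.-integrable setT (EFin \o m).
Hypothesis etam : {ae mu, forall s, {ae mu, forall x, `|eta s x| <= m s * (1 + x ^+ 2)}}.
Hypothesis Hetam : {ae mu, forall s, {ae mu, forall x,
  `|H s x * eta s x| <= B * m s * (1 + x ^+ 2) ^+ 2}}.
Hypothesis iK : mu.-integrable setT (EFin \o K).
Hypothesis K0 : forall s, 0 <= K s.
Hypothesis AK : {ae mu, forall s,
  \int[mu]_x (2 * (H s x * eta s x) * wt x) <= K s * \int[mu]_x (H s x ^+ 2 * wt x)}.

(** [H] is a partial integral of a function of three variables. Tonelli is applied to positive and
    negative parts separately, since slices are integrable for almost every [x] only. *)
Lemma time_integral_measurable : measurable_fun (setT : set RR) (fun p : RR => H p.1 p.2).
Proof.
pose cut (z : RR * mR) : R := if (-1 <= z.2) && (z.2 <= z.1.1) then eta z.2 z.1.2 else 0.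
have m2 : measurable_fun (setT : set (RR * mR)) (snd : _ -> mR) by exact: measurable_snd.
have m11 : measurable_fun (setT : set (RR * mR)) (fun z => z.1.1 : mR).
  by apply: measurableT_comp => //; exact: measurable_fst.
have m12 : measurable_fun (setT : set (RR * mR)) (fun z => z.1.2 : mR).
  by apply: measurableT_comp => //; exact: measurable_fst.
have mcut : measurable_fun setT cut.
  apply: measurable_fun_ifT => //.
  - by apply: measurable_and; apply: measurable_fun_ler.
  - have mp : measurable_fun (setT : set (RR * mR)) (fun z => (z.2, z.1.2) : RR).
      exact: measurable_fun_pair.
    exact: (measurableT_comp meta mp).
have HE p : H p.1 p.2 = fine ((\int[mu]_r (EFin \o cut)^\+ (p, r)) - \int[mu]_r (EFin \o cut)^\- (p, r))%E.
  rewrite /H /time_integral Rintegral_mkcond /Rintegral integralE; congr (fine (_ - _)%E);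
    apply: eq_integral => r _; rewrite ?funeposE ?funenegE /= patchE /cut /=;
    by rewrite mem_setE in_itv.
rewrite (_ : (fun p => _) = fun p : RR => fine ((\int[mu]_r (EFin \o cut)^\+ (p, r)) - \int[mu]_r (EFin \o cut)^\- (p, r))%E); last exact/funext.
apply: (measurableT_comp (f := fine)) => //; apply: emeasurable_funB.
- have := @measurable_fun_fubini_tonelli_F _ _ _ mR R mu ((EFin \o cut)^\+)%E.
  apply => //.
  by apply: measurable_funepos; exact/measurable_EFinP.
- have := @measurable_fun_fubini_tonelli_F _ _ _ mR R mu ((EFin \o cut)^\-)%E.
  apply => //.
  by apply: measurable_funeneg; exact/measurable_EFinP.
Qed.

Let z (p : RR) : R := 2 * (H p.1 p.2 * eta p.1 p.2) * wt p.2.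

Let mwt : measurable_fun (setT : set RR) (fun p : RR => wt p.2).
Proof. by apply: measurableT_comp => //; apply: continuous_measurable_fun; exact: continuous_wt. Qed.

Let mz : measurable_fun (setT : set RR) z.
Proof.
apply: measurable_funM => //; apply: measurable_funM => //; apply: measurable_funM => //.
exact: time_integral_measurable.
Qed.

Let q2wt x : (1 + x ^+ 2) ^+ 2 * wt x <= rq x.
Proof.
have -> : (1 + x ^+ 2) ^+ 2 * wt x = (rq x * (1 + x ^+ 2)) ^+ 2 * (rq x * rq x) by rewrite /wt; ring.
by rewrite rq_mul expr1n mul1r ler_piMl ?rq_le1 ?ltW ?rq_gt0.
Qed.

Let iz : mu2.-integrable setT (EFin \o z).
Proof.
apply: (@ae_le_integrable_prod _ _ _ _ _ mu mu _ (fun s => (2 * B * \int[mu]_x rq x) * m s)) => //.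
  exact: integrable_EFinZ.
apply: ae_imp Hetam => s Hs.
have -> : 2 * B * (\int[mu]_x rq x) * m s = 2 * (B * m s) * \int[mu]_x rq x by ring.
apply: ae_integral_le => //; first exact: measurable_slice.
  exact: integrable_rq.
apply: ae_imp Hs => x h _; rewrite /z/= normrM (gtr0_norm (wt_gt0 x)) normrM ger0_norm//.
apply: (@le_trans _ _ (2 * (B * m s * ((1 + x ^+ 2) ^+ 2 * wt x)))).
  rewrite -mulrA ler_wpM2l// (mulrA (B * m s)).
  by rewrite ler_wpM2r// ltW// wt_gt0.
rewrite -(mulrA 2) ler_wpM2l// ler_wpM2l ?q2wt//.
have := le_trans (normr_ge0 _) h.
by rewrite pmulr_lge0// exprn_gt0// q_gt0.
Qed.

Let ieta : {ae mu, forall x, mu.-integrable setT (EFin \o eta^~ x)}.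
Proof.
apply: (@ae_integrable_wt (fun p : RR => eta p.1 p.2)).
  apply: (@ae_le_integrable_prod _ _ _ _ _ mu mu _ (fun s => (\int[mu]_x rq x) * m s)) => //.
  - exact: measurable_funM.
  - exact: integrable_EFinZ.
  apply: ae_imp etam => s Hs; rewrite mulrC.
  apply: ae_integral_le => //.
  - apply: (measurable_slice (f := fun p : RR => eta p.1 p.2 * wt p.2)).
    exact: measurable_funM.
  - exact: integrable_rq.
  apply: ae_imp Hs => x h _; rewrite normrM (gtr0_norm (wt_gt0 x)).
  have ms : 0 <= m s by have := le_trans (normr_ge0 _) h; rewrite pmulr_lge0// q_gt0.
  apply: (@le_trans _ _ (m s * (1 + x ^+ 2) * wt x)); first by rewrite ler_wpM2r// ltW// wt_gt0.
  rewrite -mulrA ler_wpM2l//; apply: le_trans (q2wt x).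
  by rewrite ler_wpM2r ?(ltW (wt_gt0 _))// expr2 ler_peMr ?(ltW (q_gt0 _))// lerDl sqr_ge0.
Qed.

(** The product rule in time for fixed [x], starting from the value 0 at -1. The exceptional set is
    that of [ieta], independent of [t]. *)
Let H2 t : -1 <= t -> {ae mu, forall x,
  H t x ^+ 2 = \int[mu]_(s in `[-1, t]) (2 * (H s x * eta s x))}.
Proof.
move=> tN1; apply: ae_imp ieta => x ix.
have me : measurable_fun (setT : set mR) (eta^~ x) by apply/measurable_EFinP; case/integrableP : ix.
have mI a b : measurable (`[a, b]%classic : set mR) by exact: measurable_itv.
have [P HP P1] := primitive_exists 0 (-1) me
  (fun a b => integrableS (measurableT : measurable (setT : set mR)) (mI a b) (@subsetT _ _) ix).
have PH s : -1 <= s -> P s = H s x by have [_ _ EP] := HP => /EP; rewrite P1 subr0.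
have [_ _ /(_ _ _ tN1)] := primitiveM HP HP.
rewrite /= P1 mulr0 subr0 PH// -expr2 => ->.
apply: eq_Rintegral => s; rewrite inE/= in_itv/= => /andP[sN1 _].
by rewrite PH//; ring.
Qed.

Let E t := \int[mu]_x (H t x ^+ 2 * wt x).
Let A s := \int[mu]_x z (s, x).

Let mH2 t : measurable_fun (setT : set mR) (fun x => H t x ^+ 2 * wt x).
Proof.
apply: (measurable_slice (f := fun p : RR => H p.1 p.2 ^+ 2 * wt p.2)).
by apply: measurable_funM => //; apply: measurable_funX; exact: time_integral_measurable.
Qed.

Let EA t : -1 <= t -> mu.-integrable setT (EFin \o (fun x => H t x ^+ 2 * wt x)) /\
  E t = \int[mu]_(s in `[-1, t]) A s.
Proof.
move=> tN1.
pose J : set mR := `[-1, t]%classic.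
have mJ : measurable J by exact: measurable_itv.
have mJT : measurable (J `*` setT : set RR) by exact: measurableX.
have JE s x : ((s, x) \in J `*` (setT : set mR)) = (s \in J).
  by apply/idP/idP => [/set_mem[]|/set_mem sJ]; [move=> /= ? _; exact/mem_set|exact/mem_set].
have izJ : mu2.-integrable setT (EFin \o (z \_ (J `*` setT))).
  by apply: integrable_patch => //; exact: integrableS iz.
have HJ : {ae mu, forall x, setT x -> \int[mu]_s (z \_ (J `*` setT)) (s, x) = H t x ^+ 2 * wt x}.
  apply: ae_imp2 (H2 tN1) (ae_integrable2 izJ) => x -> izx _.
  transitivity (\int[mu]_s ((wt x) * ((wt x)^-1 * (z \_ (J `*` setT)) (s, x)))).
    by apply: eq_Rintegral => s _; rewrite mulrA mulfV ?mul1r// gt_eqF// wt_gt0.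
  rewrite RintegralZl//; last exact: integrable_EFinZ.
  rewrite mulrC; congr (_ * _); rewrite [RHS]Rintegral_mkcond; apply: eq_Rintegral => s _.
  rewrite !patchE JE; case: ifP => _; last by rewrite mulr0.
  by rewrite /z /=; field; rewrite gt_eqF// wt_gt0.
have iR := integrable_Rintegral2 izJ.
split; first exact: ae_integrable_eq HJ.
transitivity (\int[mu]_x \int[mu]_s (z \_ (J `*` setT)) (s, x)).
  apply/esym; apply: (ae_eq_Rintegral _ _ _ HJ) => //.
  by have /integrableP[/measurable_EFinP] := iR.
rewrite (Rintegral21 izJ) -(Rintegral12 izJ) [RHS]Rintegral_mkcond.
apply: eq_Rintegral => s _; rewrite patchE.
case: ifPn => sJ; first by apply: eq_Rintegral => x _; rewrite patchE JE sJ.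
rewrite -[RHS](_ : \int[mu]_x (cst (0 : R) x) = 0); last by rewrite Rintegral_cst// mul0r.
by apply: eq_Rintegral => x _; rewrite patchE JE (negbTE sJ).
Qed.

(** Gronwall is applied to the primitive of [A] that vanishes at -1. It coincides with the energy
    from -1 on, and a nonnegative energy that is at most 0 forces [H t] to vanish almost
    everywhere. *)
Lemma time_integral_eq0 t : -1 <= t -> {ae mu, forall x, H t x = 0}.
Proof.
move=> tN1.
have mI a b : measurable (`[a, b]%classic : set mR) by exact: measurable_itv.
have iA : mu.-integrable setT (EFin \o A) := integrable_Rintegral1 iz.
have mA : measurable_fun (setT : set mR) A by have /integrableP[/measurable_EFinP] := iA.
have mK : measurable_fun (setT : set mR) K by have /integrableP[/measurable_EFinP] := iK.
have [P HP P1] := primitive_exists 0 (-1) mA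
  (fun a b => integrableS (measurableT : measurable (setT : set mR)) (mI a b) (@subsetT _ _) iA).
have [Q HQ Q1] := primitive_exists 0 (-1) mK
  (fun a b => integrableS (measurableT : measurable (setT : set mR)) (mI a b) (@subsetT _ _) iK).
have PE s : -1 <= s -> P s = E s.
  by move=> sN1; have [_ ->] := EA sN1; have [_ _ /(_ _ _ sN1)] := HP; rewrite P1 subr0.
have Pt : P t <= 0.
  apply: (gronwall HP HQ tN1) => //; apply: ae_imp AK => s As /andP[sN1 _].
  by rewrite PE.
have [iE _] := EA tN1.
have E0 : E t = 0.
  apply/eqP; rewrite eq_le -{1}PE// Pt/= Rintegral_ge0// => x _.
  by rewrite mulr_ge0 ?sqr_ge0// ltW// wt_gt0.
have : (\int[mu]_x `|(H t x ^+ 2 * wt x)%:E| = 0)%E.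
  transitivity (E t)%:E; last by rewrite E0.
  rewrite /E /Rintegral fineK; last exact: integrable_fin_num iE.
  apply: eq_integral => x _; rewrite gee0_abs// lee_fin mulr_ge0 ?sqr_ge0//.
have mE : measurable_fun (setT : set mR) (EFin \o (fun x => H t x ^+ 2 * wt x)) by exact/measurable_EFinP.
move/(ae_eq_integral_abs mu measurableT mE); apply: ae_imp => x /= /(_ I) /eqP.
rewrite eqe mulf_eq0 (gt_eqF (wt_gt0 x)) orbF sqrf_eq0 => /eqP; exact.
Qed.

End DifferenceEnergy.

(** * Comparison of two strong solutions *)

Section Uniqueness.
Context {R : realType}.
Local Notation mu := (@lebesgue_measure R).
Local Notation mR := (measurableTypeR R).
Local Notation RR := (mR * mR)%type.
Local Notation mu2 := (mu \x mu)%E.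
Implicit Types (s t x : R).

Lemma ae_neq (a : R) : {ae mu, forall s, s <> a}.
Proof.
exists [set a]; split; [exact: measurable_set1|exact: lebesgue_measure_set1|].
by move=> s /= /contrapT.
Qed.

Section OneSolution.
Variables (Tbar T : R) (u ux uxx : R -> R -> R) (C : R) (M : R -> R).
Hypothesis H : strong_data Tbar T u ux uxx C M.

Lemma strong_data_source_measurable :
  measurable_fun (setT : set RR) (fun p : RR => source T u uxx p.1 p.2).
Proof. by case: H => *; apply: source_measurable; eassumption. Qed.

Lemma strong_data_source_bound : {ae mu, forall t, {ae mu, forall x,
  `|source T u uxx t x| <= (2^-1 * C * M t) * (1 + x ^+ 2)}}.
Proof. by case: H => *; apply: source_bound; eassumption. Qed.

Lemma strong_data_source_integrable :
  {ae mu, forall x, mu.-integrable setT (EFin \o (fun s => source T u uxx s x))}.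
Proof.
apply: (@ae_integrable_wt _ (fun p : RR => source T u uxx p.1 p.2)).
by case: H => *; apply: source_integrable; eassumption.
Qed.

Lemma strong_data_source_increment t : 0 < t < T ->
  {ae mu, forall x, u t x - u 0 x = \int[mu]_(s in `[-1, t]) source T u uxx s x}.
Proof. by case: H => * ; apply: source_increment; eassumption. Qed.

End OneSolution.

Variables (Tbar T : R) (u1 ux1 uxx1 u2 ux2 uxx2 : R -> R -> R) (C1 C2 : R) (M1 M2 : R -> R).
Hypothesis H1 : strong_data Tbar T u1 ux1 uxx1 C1 M1.
Hypothesis H2 : strong_data Tbar T u2 ux2 uxx2 C2 M2.
Hypothesis h0 : {ae mu, forall x, u1 0 x = u2 0 x}.

Let eta s x := source T u1 uxx1 s x - source T u2 uxx2 s x.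
Let C := C1 + C2.
Let m s := 2^-1 * C1 * M1 s + 2^-1 * C2 * M2 s.
(** The 1 of the energy estimate is cut off to [[0, T]], outside which both sources vanish, to make
    [K] integrable over the line. *)
Let K s := (92 * C + 9) * (((cst 1 : R -> R) \_ `[0, T]%classic) s + M1 s + M2 s).

Let C10 : 0 <= C1. Proof. exact: sd_C0 H1. Qed.
Let C20 : 0 <= C2. Proof. exact: sd_C0 H2. Qed.
Let C0 : 0 <= C. Proof. exact: addr_ge0. Qed.

Let m0 s : 0 <= m s.
Proof. by rewrite addr_ge0// !mulr_ge0// ?(sd_M0 H1) ?(sd_M0 H2). Qed.

Let K0 s : 0 <= K s.
Proof.
rewrite mulr_ge0// ?addr_ge0 ?mulr_ge0 ?(sd_M0 H1) ?(sd_M0 H2)//.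
by rewrite patchE; case: ifP.
Qed.

Let iK : mu.-integrable setT (EFin \o K).
Proof.
apply: integrable_EFinZ => //.
have i1 : mu.-integrable setT (EFin \o ((cst 1 : R -> R) \_ `[0, T]%classic)).
  apply: integrable_patch; first exact: measurable_itv.
  by apply: continuous_itv_integrable => x; exact: cvg_cst.
exact: integrable_EFinD measurableT (integrable_EFinD measurableT i1 (sd_iM H1)) (sd_iM H2).
Qed.

Let im : mu.-integrable setT (EFin \o m).
Proof.
have Z (c : R) (f : R -> R) : mu.-integrable setT (EFin \o f) ->
    mu.-integrable setT (EFin \o (fun s => c * f s)) by exact: integrable_EFinZ.
exact: integrable_EFinD measurableT (Z _ _ (sd_iM H1)) (Z _ _ (sd_iM H2)).
Qed.

Let meta : measurable_fun (setT : set RR) (fun p : RR => eta p.1 p.2).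
Proof.
by apply: measurable_funB; [exact: strong_data_source_measurable H1|exact: strong_data_source_measurable H2].
Qed.

Let etam : {ae mu, forall s, {ae mu, forall x, `|eta s x| <= m s * (1 + x ^+ 2)}}.
Proof.
apply: ae_imp2 (strong_data_source_bound H1) (strong_data_source_bound H2) => s.
apply: ae_imp2 => x h1 h2.
by rewrite /m mulrDl (le_trans (ler_normB _ _))// lerD.
Qed.

Let H := time_integral eta.

Let difference t : 0 < t < T -> {ae mu, forall x, H t x = u1 t x - u2 t x}.
Proof.
move=> tT.
have mI : measurable (`[-1, t]%classic : set mR) by exact: measurable_itv.
have hi : {ae mu, forall x, H t x =
    \int[mu]_(s in `[-1, t]) source T u1 uxx1 s x - \int[mu]_(s in `[-1, t]) source T u2 uxx2 s x}.
  apply: ae_imp2 (strong_data_source_integrable H1) (strong_data_source_integrable H2) => x i1 i2.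
  by rewrite /H /time_integral RintegralB//; [exact: integrableS i1|exact: integrableS i2].
have hd : {ae mu, forall x, H t x = (u1 t x - u1 0 x) -
    \int[mu]_(s in `[-1, t]) source T u2 uxx2 s x}.
  by apply: ae_imp2 hi (strong_data_source_increment H1 tT) => x -> ->.
have hd2 : {ae mu, forall x, H t x = (u1 t x - u1 0 x) - (u2 t x - u2 0 x)}.
  by apply: ae_imp2 hd (strong_data_source_increment H2 tT) => x -> ->.
by apply: ae_imp2 hd2 h0 => x -> ->; ring.
Qed.

(* For almost every time, [H] and [eta] are given by continuous representatives
   of [u1] and [u2], to which the energy estimate applies. *)
Let slice : {ae mu, forall s, ~ (0 <= s <= T) \/
  exists U1 G1 U2 G2,
    [/\ [/\ primitive U1 G1, primitive G1 (uxx1 s), primitive U2 G2 & primitive G2 (uxx2 s)],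
       [/\ forall x, `|U1 x| <= C * (1 + x ^+ 2),
           forall x, `|U2 x| <= C * (1 + x ^+ 2) & forall x, 0 <= U1 x],
       [/\ 0 <= s <= T, {ae mu, forall x, `|uxx1 s x| <= M1 s} & {ae mu, forall x, `|uxx2 s x| <= M2 s}] &
       {ae mu, forall x, H s x = U1 x - U2 x /\
          eta s x = 2^-1 * (U1 x * uxx1 s x - U2 x * uxx2 s x)}]}.
Proof.
(* [difference] concerns the open interval, so the two end times are discarded as null. *)
apply: ae_imp2 (ae_and (ae_neq T) (ae_neq 0))
  (ae_and (strong_data_slice H1) (strong_data_slice H2)) => s [sT s0] [h1 h2].
have [sI|sI] := boolP (0 <= s <= T); [right|by left; apply/negP].
have [U1 [G1 [[HU1 HG1 uU1 U10 U1C] uxxM1]]] := h1 sI.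
have [U2 [G2 [[HU2 HG2 uU2 U20 U2C] uxxM2]]] := h2 sI.
have sI' : 0 < s < T.
  case/andP: (sI) => s_ge0 s_leT; rewrite !lt_neqAle s_ge0 s_leT !andbT.
  by apply/andP; split; apply/eqP => // /esym.
exists U1, G1, U2, G2; split=> //.
- split=> // x; [apply: le_trans (U1C x) _|apply: le_trans (U2C x) _];
    by rewrite ler_wpM2r ?(ltW (q_gt0 x))// ?lerDl ?lerDr.
- have hu : {ae mu, forall x, u1 s x = U1 x /\ u2 s x = U2 x} by apply: ae_imp2 uU1 uU2.
  apply: ae_imp2 (difference sI') hu => x -> [e1 e2].
  by rewrite /eta /source sI e1 e2; split => //; ring.
Qed.

Let Hetam : {ae mu, forall s, {ae mu, forall x,
  `|H s x * eta s x| <= (2 * C) * m s * (1 + x ^+ 2) ^+ 2}}.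
Proof.
apply: ae_imp2 slice etam => s [sT _|[U1 [G1 [U2 [G2 [_ [U1C U2C _] _ hH]]]]] hm].
  apply: ae_true => x; rewrite /eta /source (negbTE (introN idP sT)) subrr mulr0 normr0.
  by rewrite mulr_ge0 ?sqr_ge0// mulr_ge0// mulr_ge0.
apply: ae_imp2 hH hm => x [-> _] h.
have -> : 2 * C * m s * (1 + x ^+ 2) ^+ 2 = (2 * C * (1 + x ^+ 2)) * (m s * (1 + x ^+ 2)) by ring.
rewrite normrM ler_pM//; apply: le_trans (ler_normB _ _) _.
have -> : 2 * C * (1 + x ^+ 2) = C * (1 + x ^+ 2) + C * (1 + x ^+ 2) by ring.
exact: lerD.
Qed.

Let AK : {ae mu, forall s,
  \int[mu]_x (2 * (H s x * eta s x) * wt x) <= K s * \int[mu]_x (H s x ^+ 2 * wt x)}.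
Proof.
have mH := time_integral_measurable meta.
have mwt : measurable_fun (setT : set mR) wt by apply: continuous_measurable_fun; exact: continuous_wt.
apply: ae_imp slice => s [sT|[U1 [G1 [U2 [G2 [[HU1 HG1 HU2 HG2] [U1C U2C U10] [sT M1s M2s] hH]]]]]].
  under eq_Rintegral do rewrite /eta /source (negbTE (introN idP sT)) subrr mulr0 mulr0 mul0r.
  rewrite Rintegral_cst// mul0r mulr_ge0// Rintegral_ge0// => x _.
  by rewrite mulr_ge0 ?sqr_ge0// ltW// wt_gt0.
have mHs : measurable_fun (setT : set mR) (H s) := measurable_slice s mH.
have metas : measurable_fun (setT : set mR) (eta s) := measurable_slice s meta.
have mU1 := primitive_measurable HU1; have mU2 := primitive_measurable HU2.
have mg1 : measurable_fun (setT : set mR) (uxx1 s) by case: HG1.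
have mg2 : measurable_fun (setT : set mR) (uxx2 s) by case: HG2.
have -> : \int[mu]_x (2 * (H s x * eta s x) * wt x) =
    \int[mu]_x ((U1 x * uxx1 s x - U2 x * uxx2 s x) * (U1 x - U2 x) * wt x).
  apply: ae_eq_Rintegral => //.
  - by do !apply: measurable_funM => //.
  - by do !apply: measurable_funM => //; apply: measurable_funB => //; exact: measurable_funM.
  - by apply: ae_imp hH => x [-> ->] _; field.
have -> : \int[mu]_x (H s x ^+ 2 * wt x) = \int[mu]_x ((U1 x - U2 x) ^+ 2 * wt x).
  apply: ae_eq_Rintegral => //.
  - by apply: measurable_funM => //; exact: measurable_funX.
  - by apply: measurable_funM => //; apply: measurable_funX; exact: measurable_funB.
  - by apply: ae_imp hH => x [-> _].
have -> : K s = (92 * C + 9) * (1 + M1 s + M2 s).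
  by rewrite /K patchE mem_set//= in_itv.
exact: (energy_estimate HU1 HG1 HU2 HG2 C0 U1C U2C M1s M2s U10).
Qed.

Lemma strong_data_unique t : 0 < t < T -> {ae mu, forall x, u1 t x = u2 t x}.
Proof.
move=> tT; have tN1 : -1 <= t by case/andP: tT => t0 _; lra.
have := time_integral_eq0 meta im etam Hetam iK K0 AK tN1.
move=> Ht; apply: ae_imp2 (difference tT) Ht => x; rewrite /H => -> /eqP.
by rewrite subr_eq0 => /eqP.
Qed.

End Uniqueness.

Theorem theorem1p3 (R : realType) (Tbar : R) (u1 u2 : R -> R -> R)
    (hT : 0 < Tbar)
    (h1 : strong_solution Tbar (u1 0) u1)
    (h2 : strong_solution Tbar (u2 0) u2)
    (h0 : {ae @lebesgue_measure R, forall x, u1 0 x = u2 0 x}) :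
  forall t : R, 0 <= t < Tbar ->
    {ae @lebesgue_measure R, forall x, u1 t x = u2 t x}.
Proof.
move=> t /andP[]; rewrite le_eqVlt => /predU1P[<-//|t0] tT.
(* The strong bounds are available on [[0, T]] for [T < Tbar], and [t] must be interior. *)
pose T := (t + Tbar) / 2.
have tT' : 0 < t < T by rewrite t0/= /T; lra.
have TT : 0 < T < Tbar by rewrite /T; apply/andP; split; lra.
have [ux1 [uxx1 [C1 [M1 H1]]]] := strong_solution_data TT h1.
have [ux2 [uxx2 [C2 [M2 H2]]]] := strong_solution_data TT h2.
exact: (strong_data_unique H1 H2 h0 tT').
Qed.
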